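(* Consider, on the two-dimensional torus $\mathbb T^2$ and for either choice of sign, the half-wave equation $$i\partial_tu+|\nabla|u=\pm|u|^2u,\qquad u|_{t=0}=u_0 .$$ Let $u_0\in H^{3/2}(\mathbb T^2)$, let $T>0$ and let $u\in\mathcal C([0,T],H^{3/2}(\mathbb T^2))$ be the unique (mild) solution. For a step size $\tau>0$ let $u^0=u_0$ and, for $\ell\ge0$, $$\begin{aligned}u^{\ell+1}={}&e^{i\tau|\nabla|}u^\ell\mp i\tau e^{i\tau|\nabla|}\Big((u^\ell)^2\varphi_1(-2i\tau|\nabla|)\overline{u^\ell}\Big)\mp i\tau\big(e^{i\tau|\nabla|}u^\ell\big)^2\varphi_2(-2i\tau|\nabla|)e^{i\tau|\nabla|}\overline{u^\ell}\\&\pm i\tau e^{i\tau|\nabla|}\Big((u^\ell)^2\varphi_2(-2i\tau|\nabla|)\overline{u^\ell}\Big)-\frac{\tau^2}{2}e^{i\tau|\nabla|}\big(|u^\ell|^4u^\ell\big).\end{aligned}$$ Then there exists $C_T>0$ (independent of $\tau$ and $n$) such that $$\|u(n\tau)-u^n\|_{L^2}\le C_T\,\tau^2,\qquad0\le n\tau\le T.$$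
   Context: $|\nabla|$ is the Fourier multiplier with symbol $|k|$, $k\in\mathbb Z^2$; $\varphi_1(z)=(e^z-1)/z$, $\varphi_2(z)=(e^z-\varphi_1(z))/z$, and $\varphi_j(-2i\tau|\nabla|)$, $e^{i\tau|\nabla|}$ are Fourier multipliers. Functions are complex valued. A mild solution is one satisfying $u(t)=e^{it|\nabla|}u_0\mp i\int_0^te^{i(t-\xi)|\nabla|}|u(\xi)|^2u(\xi)\,d\xi$. *)

(* Defs.v *)
From HB Require Import structures.
From mathcomp Require Import all_boot all_order all_algebra.
From mathcomp Require Import complex.
From mathcomp Require Import all_classical all_reals all_analysis.

Set Implicit Arguments.
Unset Strict Implicit.
Unset Printing Implicit Defensive.

Import Order.TTheory GRing.Theory Num.Theory.
Import numFieldNormedType.Exports.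
Local Open Scope classical_set_scope.
Local Open Scope ring_scope.
Local Open Scope complex_scope.

(* T^2 = (R / 2 pi Z)^2 is represented by its fundamental square [0, 2 pi]^2.
   A function on T^2 is given by a function R * R -> R[i], up to null sets for
   [torus_measure], which is supported on that square: values outside it are
   irrelevant (a function on the square can be extended by 0, say). *)

Section HalfWave.
Context {R : realType}.
Local Notation C := R[i].

Lemma two_pi_gt0 : 0 < 2 * pi :> R.
Proof. by rewrite mulr_gt0// pi_gt0. Qed.

(* Lebesgue measure on [0, 2 pi]^2, normalized to total mass 1. *)
Definition torus_measure :=
  (uniform_prob two_pi_gt0 \x uniform_prob two_pi_gt0)%E.

Definition torus_fun : Type := measurableTypeR R * measurableTypeR R -> C.

Definition cexp (z : C) : C :=
  (expR (complex.Re z))%:C * (cos (complex.Im z) +i* sin (complex.Im z)).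

Definition in_L2 (f : torus_fun) : Prop :=
  (fun x => complex.Re (f x)) \in Lfun torus_measure 2%:E /\
  (fun x => complex.Im (f x)) \in Lfun torus_measure 2%:E.

Definition L2norm (f : torus_fun) : \bar R :=
  Lnorm torus_measure 2%:E (fun x => (ComplexField.Normc.normc (f x))%:E).

Definition torus_integral (f : torus_fun) : C :=
  Rintegral torus_measure setT (fun x => complex.Re (f x)) +i*
  Rintegral torus_measure setT (fun x => complex.Im (f x)).

Definition fourier (f : torus_fun) (k : int * int) : C :=
  torus_integral (fun x =>
    f x * cexp (- ('i * (k.1%:~R * x.1 + k.2%:~R * x.2)%:C))).

Definition knorm (k : int * int) : R :=
  Num.sqrt (k.1%:~R ^+ 2 + k.2%:~R ^+ 2).

Definition Hs_norm (s : R) (f : torus_fun) : \bar R :=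
  ((\esum_(k in [set: int * int])
     ((1 + knorm k ^+ 2) `^ s *
      ComplexField.Normc.normc (fourier f k) ^+ 2)%R%:E) `^ 2^-1)%E.

Definition in_Hs (s : R) (f : torus_fun) : Prop :=
  in_L2 f /\ (Hs_norm s f < +oo)%E.

(* The element of L^2 with Fourier coefficients m k * fourier f k, unique up
   to null sets; it exists for f in L^2 and m bounded. *)
Definition fourier_multiplier (m : int * int -> C) (f : torus_fun) :
    torus_fun :=
  xget (fun=> 0)
    [set g : torus_fun | in_L2 g /\ forall k, fourier g k = m k * fourier f k].

(* phi (z |nabla|) *)
Definition nabla_op (phi : C -> C) (z : C) : torus_fun -> torus_fun :=
  fourier_multiplier (fun k => phi (z * (knorm k)%:C)).

(* The singularities at 0 are removable, and 0 is a value of the symbol |k|. *)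
Definition phi1 (z : C) : C :=
  if z == 0 then 1 else (cexp z - 1) / z.

Definition phi2 (z : C) : C :=
  if z == 0 then 2^-1 else (cexp z - phi1 z) / z.

(* exp (i t |nabla|) *)
Definition half_wave (t : R) : torus_fun -> torus_fun :=
  nabla_op cexp ('i * t%:C).

Definition fconj (f : torus_fun) : torus_fun := fun x => (f x)^*.

Definition modulus (z : C) : C := (ComplexField.Normc.normc z)%:C.

Definition Hs_continuous_on (s a b : R) (u : R -> torus_fun) : Prop :=
  (forall t, t \in `[a, b] -> in_Hs s (u t)) /\
  (forall t, t \in `[a, b] ->
     (fun t' => Hs_norm s (fun x => u t' x - u t x)) @ within `[a, b] (nbhs t)
       --> 0%E).

(* g is the Riemann integral over [a, b] of the L^2-valued function F: the
   limit in L^2 of the Riemann sums over tagged partitions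
   a = p 0 <= c 0 <= p 1 <= ... <= p N = b as the mesh tends to 0. For a
   continuous F it coincides with the Bochner integral. *)
Definition is_L2_integral (F : R -> torus_fun) (a b : R) (g : torus_fun) :
    Prop :=
  in_L2 g /\
  forall e : R, 0 < e -> exists2 d : R, 0 < d &
    forall (N : nat) (p c : nat -> R),
      p 0%N = a -> p N = b ->
      (forall i, (i < N)%N ->
         [/\ p i <= c i, c i <= p i.+1 & p i.+1 - p i < d]) ->
      (L2norm (fun x => (\sum_(i < N) (p i.+1 - p i)%:C * F (c i) x) - g x)%R
         < e%:E)%E.

(* u solves i u_t + |nabla| u = sgn |u|^2 u on [0, T] with u(0) = u0, in the
   integrated form
   u(t) = e^{i t |nabla|} u0
          - sgn i \int_0^t e^{i (t - xi) |nabla|} |u(xi)|^2 u(xi) d xi. *)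
Definition mild_solution (sgn : R) (u0 : torus_fun) (T : R)
    (u : R -> torus_fun) : Prop :=
  forall t, t \in `[0, T] ->
    exists2 g : torus_fun,
      is_L2_integral
        (fun xi => half_wave (t - xi)
           (fun x => modulus (u xi x) ^+ 2 * u xi x)) 0 t g &
      {ae torus_measure, forall x,
         u t x = half_wave t u0 x - sgn%:C * 'i * g x}.

Definition scheme_step (sgn tau : R) (v : torus_fun) : torus_fun :=
  let E := half_wave tau in
  let Phi1 := nabla_op phi1 (- (2 * 'i * tau%:C)) in
  let Phi2 := nabla_op phi2 (- (2 * 'i * tau%:C)) in
  let c := sgn%:C * 'i * tau%:C in
  fun x =>
    E v x
    - c * E (fun y => v y ^+ 2 * Phi1 (fconj v) y) x
    - c * (E v x ^+ 2 * Phi2 (E (fconj v)) x)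
    + c * E (fun y => v y ^+ 2 * Phi2 (fconj v) y) x
    - (tau ^+ 2 / 2)%:C * E (fun y => modulus (v y) ^+ 4 * v y) x.

Definition scheme (sgn tau : R) (u0 : torus_fun) (n : nat) : torus_fun :=
  iter n (scheme_step sgn tau) u0.

End HalfWave.

Arguments torus_fun R : clear implicits.
Arguments torus_measure R : clear implicits.

(* Main.v *)
From HB Require Import structures.
Require Import Defs.
From mathcomp Require Import all_boot all_order all_algebra.
From mathcomp Require Import complex ring lra finmap.
From mathcomp Require Import all_classical all_reals all_analysis.
From mathcomp Require Import measurable_realfun.

(** Why the scheme converges at order two.

    Write [a = u(t)], [v(s) = e^{-is|nabla|} u(t + s)], and let the sign be [+].
    Then [v'(s) = -i e^{-is|nabla|} (|u|^2 u)(t + s)].  Up to an error of size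
    [s^2] in [v'], the solution [u(t + s)] may be replaced by
    [e^{is|nabla|} a - i s |a|^2 a]; the correction contributes [- s |a|^4 a]
    to [v'], which is where the last term of the scheme comes from
    ([path_second_order]).  There remains
    [e^{-is|nabla|} ((e^{is|nabla|} a)^2 e^{-is|nabla|} conj a)], a trilinear sum
    over frequencies [k = k1 + k2 + k3] whose phase is [- s (theta + 2 |k3|)] with
    [theta = |k| - |k1| - |k2| - |k3|].  The scheme keeps the part [2 |k3|]
    exactly (it is integrated by [phi1] and [phi2], see [prim1] and [prim2]) and
    interpolates [e^{-is theta}] linearly between [s = 0] and [s = tau].  The
    interpolation error is [O(tau^2 theta^2)], and the decisive inequality is
    [theta^2 <= 4 (|k1||k2| + |k1||k3| + |k2||k3|)] ([defect_sqr]): two powers of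
    the resonance defect cost one derivative on each of only two factors.  If
    [a] is in [H^{3/2}] these two factors are in [H^{1/2}], the third one has an
    absolutely convergent Fourier series, and in dimension two
    [H^{1/2} * H^{1/2}] is contained in [L^2] ([nconv_half]).  Hence
    [twist_interp], and a local error of size [tau^3] in [L^2] with constants
    that depend only on the [H^{3/2}] size of the solution ([local_error]).

    To sum the local errors one needs stability in [L^2] ([Psi_lip]), whose
    constant depends on the [l^1] norm of the Fourier coefficients of the
    numerical solution.  That norm is controlled by a bootstrap: while it is
    bounded, the [L^2] error is [O(tau^2)] and the [H^{3/2}] norm of the numerical
    solution grows at most geometrically ([Psi_tame]); interpolating between these
    two facts ([n1_interp]) makes the [l^1] norm of the error small when [tau] is
    small, and the bootstrap closes.  For [tau] bounded below there are boundedly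
    many steps and a crude bound suffices ([spectral_convergence]).

    All of this takes place on sequences of Fourier coefficients, in the type
    [spec] of weighted square summable sequences, which is a ring under
    convolution.  Functions on the torus are related to it by [repr]: an
    integrable function is determined by its Fourier coefficients
    ([fourier_unique]), products correspond to convolutions, and Parseval's
    identity computes [L2norm].  A mild solution enters only through Riemann sums
    of Duhamel's integral between two times ([mild_increment]). *)

Set Implicit Arguments.
Unset Strict Implicit.
Unset Printing Implicit Defensive.

Import Order.TTheory GRing.Theory Num.Theory.
Import numFieldNormedType.Exports.
Local Open Scope classical_set_scope.
Local Open Scope ring_scope.
Local Open Scope complex_scope.

(** * Complex numbers of modulus one *)

Notation cnorm := ComplexField.Normc.normc.

Section ComplexBasics.
Context {R : realType}.
Local Notation C := R[i].
Implicit Types (z w : C) (x y : R).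

Lemma cnormE z : cnorm z = Num.sqrt (complex.Re z ^+ 2 + complex.Im z ^+ 2).
Proof. by case: z. Qed.

Lemma cnorm_ge0 z : 0 <= cnorm z.
Proof. by case: z => a b /=; exact: sqrtr_ge0. Qed.

Lemma sqr_cnorm z : cnorm z ^+ 2 = complex.Re z ^+ 2 + complex.Im z ^+ 2.
Proof. by rewrite cnormE sqr_sqrtr// addr_ge0// sqr_ge0. Qed.

Lemma cnorm0 : cnorm (0 : C) = 0.
Proof. by rewrite cnormE /= !expr0n /= addr0 sqrtr0. Qed.

Lemma cnorm1 : cnorm (1 : C) = 1.
Proof. by rewrite cnormE /= expr1n expr0n /= addr0 sqrtr1. Qed.

Lemma cnorm_eq0 z : cnorm z = 0 -> z = 0.
Proof. exact: ComplexField.Normc.eq0_normc. Qed.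

Lemma cnormM z w : cnorm (z * w) = cnorm z * cnorm w.
Proof. exact: ComplexField.Normc.normcM. Qed.

Lemma cnormN z : cnorm (- z) = cnorm z.
Proof. by rewrite !cnormE; case: z => a b /=; rewrite !sqrrN. Qed.

Lemma cnormC z : cnorm (conjc z) = cnorm z.
Proof. by rewrite !cnormE; case: z => a b /=; rewrite sqrrN. Qed.

Lemma cnormR x : cnorm (x%:C : C) = `|x|.
Proof. by rewrite cnormE /= expr0n /= addr0 sqrtr_sqr. Qed.

Lemma cnorm_i : cnorm ('i : C) = 1.
Proof. by rewrite cnormE /= expr0n expr1n /= add0r sqrtr1. Qed.

Lemma cnormD z w : cnorm (z + w) <= cnorm z + cnorm w.
Proof. exact: le_normcD. Qed.

Lemma cnormB z w : cnorm (z - w) <= cnorm z + cnorm w.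
Proof. by rewrite -(cnormN w) cnormD. Qed.

Lemma cnormV z : cnorm z^-1 = (cnorm z)^-1.
Proof. exact: ComplexField.Normc.normcV. Qed.

Lemma Re_le_cnorm z : `|complex.Re z| <= cnorm z.
Proof.
by rewrite cnormE -(sqrtr_sqr (complex.Re z)) ler_wsqrtr// lerDl sqr_ge0.
Qed.

Lemma Im_le_cnorm z : `|complex.Im z| <= cnorm z.
Proof.
by rewrite cnormE -(sqrtr_sqr (complex.Im z)) ler_wsqrtr// lerDr sqr_ge0.
Qed.

Lemma cnorm_le z : cnorm z <= `|complex.Re z| + `|complex.Im z|.
Proof.
rewrite cnormE -[leRHS]ger0_norm ?addr_ge0// -sqrtr_sqr ler_wsqrtr// sqrrD.
by rewrite !real_normK ?num_real// lerD2r lerDl mulrn_wge0// mulr_ge0.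
Qed.

Lemma RecD z w : complex.Re (z + w) = complex.Re z + complex.Re w.
Proof. by case: z w => [a b] [c d]. Qed.
Lemma ImcD z w : complex.Im (z + w) = complex.Im z + complex.Im w.
Proof. by case: z w => [a b] [c d]. Qed.
Lemma RecN z : complex.Re (- z) = - complex.Re z. Proof. by case: z. Qed.
Lemma ImcN z : complex.Im (- z) = - complex.Im z. Proof. by case: z. Qed.
Lemma RecM z w : complex.Re (z * w) =
  complex.Re z * complex.Re w - complex.Im z * complex.Im w.
Proof. by case: z w => [a b] [c d]. Qed.
Lemma ImcM z w : complex.Im (z * w) =
  complex.Re z * complex.Im w + complex.Im z * complex.Re w.
Proof. by case: z w => [a b] [c d]. Qed.
Lemma complex_ext z w : complex.Re z = complex.Re w ->
  complex.Im z = complex.Im w -> z = w.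
Proof. by case: z w => [a b] [c d] /= -> ->. Qed.

Lemma Rec_conj z : complex.Re (conjc z) = complex.Re z. Proof. by case: z. Qed.
Lemma Imc_conj z : complex.Im (conjc z) = - complex.Im z. Proof. by case: z. Qed.

Lemma conjM z w : conjc (z * w) = conjc z * conjc w.
Proof.
apply: complex_ext; rewrite ?RecM ?ImcM ?Rec_conj ?Imc_conj ?RecM ?ImcM.
  by rewrite mulrNN.
by rewrite mulrN mulNr opprD.
Qed.

Lemma conjD z w : conjc (z + w) = conjc z + conjc w.
Proof.
by apply: complex_ext; rewrite ?RecD ?ImcD ?Rec_conj ?Imc_conj ?RecD ?ImcD// opprD.
Qed.

Lemma mul_conj z : z * conjc z = (cnorm z ^+ 2)%:C.
Proof.
rewrite sqr_cnorm; case: z => a b; apply: complex_ext.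
  by rewrite RecM /= mulrN opprK -!expr2.
by rewrite ImcM /= mulrN mulrC addNr.
Qed.

Definition cis x : C := cos x +i* sin x.

Lemma cexp_iR x : cexp ('i * x%:C) = cis x.
Proof.
rewrite /cexp RecM ImcM /= !mul0r !mul1r subr0 add0r.
by rewrite (_ : (expR 0)%:C = 1) ?mul1r ?expR0.
Qed.

Lemma cisD x y : cis (x + y) = cis x * cis y.
Proof.
apply: complex_ext; rewrite ?RecM ?ImcM /= ?cosD ?sinD//.
by rewrite addrC.
Qed.

Lemma cis0 : cis 0 = 1.
Proof. by rewrite /cis cos0 sin0. Qed.

Lemma conj_cis x : conjc (cis x) = cis (- x).
Proof. by rewrite /cis cosN sinN. Qed.

Lemma cnorm_cis x : cnorm (cis x) = 1.
Proof. by rewrite cnormE /= cos2Dsin2 sqrtr1. Qed.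

Lemma sin_MVT x : exists2 c, `|c| <= `|x| & sin x = x * cos c.
Proof.
wlog x0 : x / 0 <= x => [hw|].
  have [/hw//|x0] := leP 0 x.
  have [|c] := hw (- x); first by rewrite oppr_ge0 ltW.
  by rewrite normrN sinN mulNr => ? /oppr_inj ?; exists c.
have [c|c cx] := @MVT_segment R (@sin R) (@cos R) 0 x x0.
  by apply: continuous_subspaceT => ?; exact: continuous_sin.
rewrite sin0 !subr0 mulrC => ->; exists c => //.
by move: cx; rewrite in_itv/= => /andP[c0 cx]; rewrite !ger0_norm.
Qed.

Lemma sin_le_norm x : `|sin x| <= `|x|.
Proof.
have [c _ ->] := sin_MVT x; rewrite normrM ler_piMr//.
by rewrite ler_norml cos_geN1 cos_le1.
Qed.

Lemma cos_sub1 x : 1 - cos x = 2 * sin (x / 2) ^+ 2.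
Proof.
rewrite [in cos x](_ : x = (x / 2) *+ 2); last by rewrite mulr2n -splitr.
by rewrite mulr2n cosD; have := cos2Dsin2 (x / 2); rewrite !expr2; lra.
Qed.

(** From the half-angle formula, so that only the bound on [sin] is needed. *)
Lemma cos_sub1_le x : `|cos x - 1| <= x ^+ 2 / 2.
Proof.
rewrite distrC cos_sub1 ger0_norm; last by rewrite mulr_ge0// sqr_ge0.
have h : sin (x / 2) ^+ 2 <= (x / 2) ^+ 2.
  by rewrite -real_normK ?num_real// -[leRHS]real_normK ?num_real// lerXn2r ?nnegrE// sin_le_norm.
by rewrite (le_trans (ler_wpM2l _ h))// expr_div_n; lra.
Qed.

Lemma cis_sub1_le x : cnorm (cis x - 1) <= `|x|.
Proof.
rewrite cnormE /= subr0 -(sqrtr_sqr x) ler_wsqrtr//.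
have := cos_sub1_le x; rewrite distrC ler_norml => /andP[_].
by have := cos2Dsin2 x; nra.
Qed.

Lemma cis_sub1i_le x : cnorm (cis x - 1 - 'i * x%:C) <= 2 * x ^+ 2.
Proof.
apply: le_trans (cnorm_le _) _.
have -> : complex.Re (cis x - 1 - 'i * x%:C) = cos x - 1.
  by rewrite !RecD !RecN RecM /= !mul0r mulr0 subrr subr0.
have -> : complex.Im (cis x - 1 - 'i * x%:C) = sin x - x.
  by rewrite !ImcD !ImcN ImcM /= mul0r mul1r add0r subr0.
have [c cx ->] := sin_MVT x.
have h : `|x * cos c - x| <= x ^+ 2.
  rewrite -{2}(mulr1 x) -mulrBr normrM.
  have h1 : `|cos c - 1| <= `|x|.
    apply: le_trans cx; apply: le_trans (cis_sub1_le c).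
    by rewrite (_ : cos c - 1 = complex.Re (cis c - 1))// Re_le_cnorm.
  by rewrite (le_trans (ler_wpM2l _ h1))// -expr2 real_normK// num_real.
by have := cos_sub1_le x; have := sqr_ge0 x; lra.
Qed.

End ComplexBasics.

(** * Integrals of complex functions *)

Section ComplexMeasurable.
Context {R : realType} {d} {T : measurableType d}.
Local Notation C := R[i].
Implicit Types f g : T -> C.

Definition cmeas f : Prop :=
  measurable_fun setT (fun x => complex.Re (f x)) /\
  measurable_fun setT (fun x => complex.Im (f x)).

Lemma cmeas_cst (c : C) : cmeas (fun=> c).
Proof. by split; exact: measurable_cst. Qed.

Lemma cmeasD f g : cmeas f -> cmeas g -> cmeas (fun x => f x + g x).
Proof.
move=> [f1 f2] [g1 g2]; split.
- by under eq_fun do rewrite RecD; exact: measurable_funD.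
- by under eq_fun do rewrite ImcD; exact: measurable_funD.
Qed.

Lemma cmeasM f g : cmeas f -> cmeas g -> cmeas (fun x => f x * g x).
Proof.
move=> [f1 f2] [g1 g2]; split.
- under eq_fun do rewrite RecM.
  by apply: measurable_funB; exact: measurable_funM.
- under eq_fun do rewrite ImcM.
  by apply: measurable_funD; exact: measurable_funM.
Qed.

Lemma cmeas_conj f : cmeas f -> cmeas (fun x => conjc (f x)).
Proof.
move=> [f1 f2]; split.
- by rewrite (_ : (fun x => complex.Re (conjc (f x))) = fun x => complex.Re (f x))//;
    apply/funext => x; case: (f x).
- rewrite (_ : (fun x => _) = fun x => - complex.Im (f x)).
    exact: measurable_funN.
  by apply/funext => x; case: (f x).
Qed.

Lemma cmeas_real (g : T -> R) : measurable_fun setT g -> cmeas (fun x => (g x)%:C).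
Proof. by move=> mg; split => //=; exact: measurable_cst. Qed.

Lemma measurable_cnorm f : cmeas f -> measurable_fun setT (fun x => cnorm (f x)).
Proof.
move=> [f1 f2]; under eq_fun do rewrite cnormE.
apply: (measurableT_comp (@continuous_measurable_fun _ _ (@sqrt_continuous R))).
by apply: measurable_funD; apply: measurable_funX.
Qed.

Lemma cmeas_cis (g : T -> R) : measurable_fun setT g -> cmeas (fun x => cis (g x)).
Proof.
move=> mg; split => /=.
- exact: (measurableT_comp (continuous_measurable_fun (@continuous_cos R))).
- exact: (measurableT_comp (continuous_measurable_fun (@continuous_sin R))).
Qed.

End ComplexMeasurable.

Section ComplexIntegral.
Context {R : realType} {d} {T : measurableType d}.
Variable mu : {measure set T -> \bar R}.
Local Notation C := R[i].
Implicit Types f g : T -> C.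

Definition cint f : C :=
  Rintegral mu setT (fun x => complex.Re (f x)) +i*
  Rintegral mu setT (fun x => complex.Im (f x)).

Definition cintegrable f : Prop :=
  cmeas f /\ (\int[mu]_x (cnorm (f x))%:E < +oo)%E.

Lemma cintegrable_Re f : cintegrable f ->
  mu.-integrable setT (EFin \o (fun x => complex.Re (f x))).
Proof.
move=> [[mr mi] h]; apply/integrableP; split; first exact/measurable_EFinP.
apply: le_lt_trans h; apply: ge0_le_integral => //.
- by apply: measurableT_comp => //; exact/measurable_EFinP.
- by apply/measurable_EFinP; exact: measurable_cnorm.
- by move=> x _ /=; rewrite lee_fin Re_le_cnorm.
Qed.

Lemma cintegrable_Im f : cintegrable f ->
  mu.-integrable setT (EFin \o (fun x => complex.Im (f x))).
Proof.
move=> [[mr mi] h]; apply/integrableP; split; first exact/measurable_EFinP.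
apply: le_lt_trans h; apply: ge0_le_integral => //.
- by apply: measurableT_comp => //; exact/measurable_EFinP.
- by apply/measurable_EFinP; exact: measurable_cnorm.
- by move=> x _ /=; rewrite lee_fin Im_le_cnorm.
Qed.

Lemma cintegrable_le f (g : T -> R) : cmeas f -> measurable_fun setT g ->
  (forall x, cnorm (f x) <= g x) -> (\int[mu]_x (g x)%:E < +oo)%E ->
  cintegrable f.
Proof.
move=> mf mg fg h; split => //; apply: le_lt_trans h.
apply: ge0_le_integral => //.
- by move=> x _; rewrite lee_fin cnorm_ge0.
- by apply/measurable_EFinP; exact: measurable_cnorm.
- exact/measurable_EFinP.
- by move=> x _; rewrite lee_fin.
Qed.

Lemma cintegrableD f g : cintegrable f -> cintegrable g ->
  cintegrable (fun x => f x + g x).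
Proof.
move=> [mf hf] [mg hg].
have m1 := measurable_cnorm mf; have m2 := measurable_cnorm mg.
apply: (@cintegrable_le _ (fun x => cnorm (f x) + cnorm (g x))).
- exact: cmeasD.
- exact: measurable_funD.
- by move=> x; exact: cnormD.
- under eq_integral do rewrite EFinD.
  rewrite ge0_integralD//; try exact/measurable_EFinP.
  + exact: lte_add_pinfty.
  + by move=> x _; rewrite lee_fin cnorm_ge0.
  + by move=> x _; rewrite lee_fin cnorm_ge0.
Qed.

Lemma cintegrable_bdM f g (M : R) : cintegrable f -> cmeas g ->
  (forall x, cnorm (g x) <= M) -> cintegrable (fun x => g x * f x).
Proof.
move=> [mf hf] mg gM.
have m1 := measurable_cnorm mf.
apply: (@cintegrable_le _ (fun x => `|M| * cnorm (f x))).
- exact: cmeasM.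
- exact: measurable_funM.
- move=> x; rewrite cnormM ler_wpM2r ?cnorm_ge0//.
  exact: le_trans (gM x) (ler_norm M).
- under eq_integral do rewrite EFinM.
  rewrite ge0_integralZl_EFin//; last exact/measurable_EFinP.
    by rewrite lte_mul_pinfty// lee_fin.
  by move=> x _; rewrite lee_fin cnorm_ge0.
Qed.

Lemma cintegrableZ (c : C) f : cintegrable f -> cintegrable (fun x => c * f x).
Proof.
move=> hf; apply: (@cintegrable_bdM _ (fun=> c) (cnorm c)) => //.
Qed.

Lemma cintegrableN f : cintegrable f -> cintegrable (fun x => - f x).
Proof. by move=> /(cintegrableZ (-1)); under eq_fun do rewrite mulN1r. Qed.

Lemma cintegrableB f g : cintegrable f -> cintegrable g ->
  cintegrable (fun x => f x - g x).
Proof. by move=> hf hg; apply: cintegrableD => //; exact: cintegrableN. Qed.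

Lemma cintD f g : cintegrable f -> cintegrable g ->
  cint (fun x => f x + g x) = cint f + cint g.
Proof.
move=> hf hg; apply: complex_ext; rewrite ?RecD ?ImcD /=.
- under eq_Rintegral do rewrite RecD.
  by rewrite RintegralD//; exact: cintegrable_Re.
- under eq_Rintegral do rewrite ImcD.
  by rewrite RintegralD//; exact: cintegrable_Im.
Qed.

Lemma cintZ (c : C) f : cintegrable f -> cint (fun x => c * f x) = c * cint f.
Proof.
move=> hf; have hr := cintegrable_Re hf; have hi := cintegrable_Im hf.
have hZ (a : R) (h : T -> R) : mu.-integrable setT (EFin \o h) ->
    mu.-integrable setT (EFin \o (fun x => a * h x)).
  move=> hh; rewrite (_ : EFin \o _ = (fun x => (a%:E * (EFin \o h) x)%E)).
    exact: integrableZl.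
  by apply/funext => x /=; rewrite EFinM.
apply: complex_ext; rewrite ?RecM ?ImcM /=.
- under eq_Rintegral do rewrite RecM.
  by rewrite RintegralB ?RintegralZl//; exact: hZ.
- under eq_Rintegral do rewrite ImcM.
  by rewrite RintegralD ?RintegralZl//; exact: hZ.
Qed.

Lemma cintN f : cintegrable f -> cint (fun x => - f x) = - cint f.
Proof.
by move=> /(cintZ (-1)); rewrite mulN1r => <-; congr cint; apply/funext => x; rewrite mulN1r.
Qed.

Lemma cintB f g : cintegrable f -> cintegrable g ->
  cint (fun x => f x - g x) = cint f - cint g.
Proof.
by move=> hf hg; rewrite cintD ?cintN//; exact: cintegrableN.
Qed.

(** Rotating the integral onto the positive real axis reduces the bound to
    the one for the real part. *)
Lemma cnorm_cint_le f : cintegrable f ->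
  ((cnorm (cint f))%:E <= \int[mu]_x (cnorm (f x))%:E)%E.
Proof.
move=> hf; have [h0|h0] := eqVneq (cnorm (cint f)) 0.
  by rewrite h0; apply: integral_ge0 => x _; rewrite lee_fin cnorm_ge0.
have hw : exists2 w : C, cnorm w = 1 & complex.Re (w * cint f) = cnorm (cint f).
  exists ((cnorm (cint f))^-1%:C * conjc (cint f)).
    rewrite cnormM cnormR cnormC ger0_norm ?invr_ge0 ?cnorm_ge0//.
    by rewrite mulVf.
  rewrite -mulrA (mulrC _ (cint f)) mul_conj -rmorphM/=.
  by rewrite expr2 mulrA mulVf// mul1r.
case: hw => w w1 <-; rewrite -cintZ//=.
have hwf := cintegrableZ w hf.
apply: le_trans (_ : (`|Rintegral mu setT (fun x => complex.Re (w * f x))|)%:E <= _)%E.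
  by rewrite lee_fin ler_norm.
rewrite EFin_normr_Rintegral//; last exact: cintegrable_Re.
apply: le_trans (le_abse_integral mu _ _) _ => //.
  by have /measurable_int := cintegrable_Re hwf.
apply: ge0_le_integral => //.
- by apply: measurableT_comp => //; have /measurable_int := cintegrable_Re hwf.
- by apply/measurable_EFinP; apply: measurable_cnorm; exact: hf.1.
- move=> x _ /=; rewrite lee_fin; apply: le_trans (Re_le_cnorm _) _.
  by rewrite cnormM w1 mul1r.
Qed.

Lemma ae_eq_cint f g : cmeas f -> cmeas g ->
  {ae mu, forall x, f x = g x} -> cint f = cint g.
Proof.
move=> [mf1 mf2] [mg1 mg2] fg.
have h (p q : T -> R) : measurable_fun setT p -> measurable_fun setT q ->
    {ae mu, forall x, p x = q x} -> Rintegral mu setT p = Rintegral mu setT q.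
  move=> mp mq pq; rewrite /Rintegral; congr fine.
  apply: ae_eq_integral => //; try exact/measurable_EFinP.
  by apply: filterS pq => x -> _.
by rewrite /cint; congr (_ +i* _); apply: h => //; apply: filterS fg => x ->.
Qed.

(** Dominated convergence in the only form used below: a vanishing property
    of integrals passes to dominated pointwise limits. *)
Lemma cint_dominated (f_ : nat -> T -> C) f (g : T -> R) :
  (forall n, cmeas (f_ n)) -> cmeas f ->
  (forall x, (fun n => complex.Re (f_ n x)) @ \oo --> complex.Re (f x)) ->
  (forall x, (fun n => complex.Im (f_ n x)) @ \oo --> complex.Im (f x)) ->
  measurable_fun setT g -> (\int[mu]_x (g x)%:E < +oo)%E ->
  (forall n x, cnorm (f_ n x) <= g x) ->
  (forall n, cint (f_ n) = 0) -> cint f = 0.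
Proof.
move=> mf_ mf cr ci mg ig fg z.
have g0 x : 0 <= g x by apply: le_trans (fg 0%N x); exact: cnorm_ge0.
have ig' : mu.-integrable setT (EFin \o g).
  apply/integrableP; split; first exact/measurable_EFinP.
  by under eq_integral do rewrite /= ger0_norm//.
have h (p_ : nat -> T -> R) (p : T -> R) : (forall n, measurable_fun setT (p_ n)) ->
    measurable_fun setT p -> (forall x, (fun n => p_ n x) @ \oo --> p x) ->
    (forall n x, `|p_ n x| <= g x) -> (forall n, Rintegral mu setT (p_ n) = 0) ->
    Rintegral mu setT p = 0.
  move=> mp_ mp cp pg pz.
  have [|||||_ _ h] := @dominated_convergence _ T R mu setT measurableT
    (fun n => EFin \o p_ n) (EFin \o p) (EFin \o g).
  - by move=> n; exact/measurable_EFinP.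
  - exact/measurable_EFinP.
  - by apply: aeW => x _; apply: cvg_EFin; [exact: nearW|exact: cp].
  - exact: ig'.
  - by apply: aeW => x n _; rewrite /= lee_fin.
  have ip n : mu.-integrable setT (EFin \o p_ n).
    apply/integrableP; split; first exact/measurable_EFinP.
    apply: le_lt_trans ig; apply: ge0_le_integral => //.
    + by apply: measurableT_comp => //; exact/measurable_EFinP.
    + exact/measurable_EFinP.
    + by move=> x _; rewrite /= lee_fin.
  have h2 : (fun n => (\int[mu]_x (p_ n x)%:E)%E) = fun=> 0%E.
    apply/funext => n; rewrite -[LHS]fineK; last first.
      by apply: integrable_fin_num (ip n).
    by have := pz n; rewrite /Rintegral => ->.
  move: h; rewrite h2 => h.
  by rewrite /Rintegral -(cvg_lim _ h)// lim_cst.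
apply: complex_ext => /=.
- apply: (h (fun n x => complex.Re (f_ n x))) => //.
  + by move=> n; exact: (mf_ n).1.
  + exact: mf.1.
  + by move=> n x; exact: le_trans (Re_le_cnorm _) (fg n x).
  + by move=> n; have /(congr1 (@complex.Re _)) := z n.
- apply: (h (fun n x => complex.Im (f_ n x))) => //.
  + by move=> n; exact: (mf_ n).2.
  + exact: mf.2.
  + by move=> n x; exact: le_trans (Im_le_cnorm _) (fg n x).
  + by move=> n; have /(congr1 (@complex.Im _)) := z n.
Qed.

End ComplexIntegral.

Section ComplexFubini.
Context {R : realType} {d1 d2} {T1 : measurableType d1} {T2 : measurableType d2}.
Variables (m1 : {sigma_finite_measure set T1 -> \bar R})
          (m2 : {sigma_finite_measure set T2 -> \bar R}).
Local Notation C := R[i].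

Let Fubini_re (p : T1 * T2 -> R) :
  (m1 \x m2)%E.-integrable setT (EFin \o p) ->
  (forall x, m2.-integrable setT (fun y => (p (x, y))%:E)) ->
  (forall y, m1.-integrable setT (fun x => (p (x, y))%:E)) ->
  Rintegral m1 setT (fun x => Rintegral m2 setT (fun y => p (x, y))) =
    Rintegral (m1 \x m2)%E setT p /\
  Rintegral m2 setT (fun y => Rintegral m1 setT (fun x => p (x, y))) =
    Rintegral (m1 \x m2)%E setT p.
Proof.
move=> ip i2 i1; split; rewrite /Rintegral.
- under eq_integral do rewrite fineK ?integrable_fin_num//.
  by rewrite -integral12_prod_meas1.
- under eq_integral do rewrite fineK ?integrable_fin_num//.
  by rewrite -integral21_prod_meas1.
Qed.

Lemma cint_Fubini (f : T1 * T2 -> C) :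
  cintegrable (m1 \x m2)%E f ->
  (forall x, cintegrable m2 (fun y => f (x, y))) ->
  (forall y, cintegrable m1 (fun x => f (x, y))) ->
  cint m1 (fun x => cint m2 (fun y => f (x, y))) = cint (m1 \x m2)%E f /\
  cint m2 (fun y => cint m1 (fun x => f (x, y))) = cint (m1 \x m2)%E f.
Proof.
move=> ip i2 i1.
have [r1 r2] := Fubini_re (cintegrable_Re ip)
  (fun x => cintegrable_Re (i2 x)) (fun y => cintegrable_Re (i1 y)).
have [j1 j2] := Fubini_re (cintegrable_Im ip)
  (fun x => cintegrable_Im (i2 x)) (fun y => cintegrable_Im (i1 y)).
by rewrite /cint /= r1 r2 j1 j2.
Qed.

(** Fubini's theorem also yields the measurability of partial integrals,
    which makes functions given by Fourier series measurable. *)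
Lemma cmeas_cint (f : T1 * T2 -> C) :
  cintegrable (m1 \x m2)%E f -> (forall x, cintegrable m2 (fun y => f (x, y))) ->
  cmeas (fun x => cint m2 (fun y => f (x, y))).
Proof.
move=> ip i2.
have h (p : T1 * T2 -> R) : (m1 \x m2)%E.-integrable setT (EFin \o p) ->
    (forall x, m2.-integrable setT (fun y => (p (x, y))%:E)) ->
    measurable_fun setT (fun x => Rintegral m2 setT (fun y => p (x, y))).
  move=> ipp i2p; apply/measurable_EFinP.
  have := measurable_fubini_F ipp; congr measurable_fun; apply/funext => x /=.
  by rewrite /fubini_F /Rintegral fineK// integrable_fin_num.
split.
- exact: h (cintegrable_Re ip) (fun x => cintegrable_Re (i2 x)).
- exact: h (cintegrable_Im ip) (fun x => cintegrable_Im (i2 x)).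
Qed.

Lemma cintegrable_prod (f : T1 * T2 -> C) : cmeas f ->
  (\int[m1]_x \int[m2]_y (cnorm (f (x, y)))%:E < +oo)%E ->
  cintegrable (m1 \x m2)%E f.
Proof.
move=> mf h; split => //; rewrite fubini_tonelli1//.
- by apply/measurable_EFinP; exact: measurable_cnorm.
- by move=> x; rewrite lee_fin cnorm_ge0.
Qed.

End ComplexFubini.

(** * Sums over the lattice of frequencies *)

(** The lattice of frequencies is given the discrete sigma-algebra, so that sums
    over it are integrals for the counting measure, and Fubini's theorem applies. *)
Definition freq := (int * int)%type.
HB.instance Definition _ := Countable.on freq.
HB.instance Definition _ := GRing.Zmodule.on freq.
HB.instance Definition _ := isPointed.Build freq (0 : freq).
HB.instance Definition _ := @isMeasurable.Build default_measure_display
  freq discrete_measurable discrete_measurable0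
  discrete_measurableC discrete_measurableU.

Lemma measurable_freq {d} {Y : measurableType d} (f : freq -> Y) :
  measurable_fun setT f.
Proof. by []. Qed.
Hint Resolve measurable_freq : core.

Lemma measurable_prod_freq {d d'} {X : measurableType d} {Y : measurableType d'}
    (f : X * freq -> Y) :
  (forall k, measurable_fun setT (fun x => f (x, k))) -> measurable_fun setT f.
Proof.
move=> mf _ B mB; rewrite setTI.
rewrite (_ : _ @^-1` _ = \bigcup_k (((fun x => f (x, k)) @^-1` B) `*` [set k])).
  apply: countable_bigcupT_measurable; first exact: countableP.
  move=> k; apply: measurableX => //.
  by rewrite -[X in measurable X]setTI; exact: mf.
apply/seteqP; split => [[x k] /= ?|[x k] [l _ [/= + ->]]//].
by exists k.
Qed.

Lemma freq_enum : exists e : nat -> freq, bijective e.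
Proof.
have /pcard_eqP[e] : ([set: nat] #= [set: freq])%card.
  rewrite card_eq_le; apply/andP; split; last exact: countableP.
  apply/pcard_injP; exists (fun n => (n%:Z, 0) : freq).
  by move=> m n _ _ [].
by exists e; exact: bijTT.
Qed.

Section Counting.
Context {R : realType}.

Lemma counting_bij (T1 T2 : choiceType) (e : T1 -> T2) (A : set T2) :
  bijective e -> counting (e @^-1` A) = counting A :> \bar R.
Proof.
move=> [f ef fe].
have eA : f @` A = e @^-1` A.
  apply/seteqP; split => [_ [y Ay <-]|x Ax]; first by rewrite /= fe.
  by exists (e x).
have cA : (e @^-1` A #= A)%card.
  by rewrite -eA; apply: inj_card_eq => x y _ _; exact: (can_inj fe).
rewrite /counting; have [finA|infA] := pselect (finite_set A).
  have finB : finite_set (e @^-1` A) by rewrite (eq_finite_set cA).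
  rewrite !asboolT//; congr (_%:R%:E).
  exact/fcard_eq.
by rewrite !asboolF// (eq_finite_set cA).
Qed.

Lemma ge0_integral_counting_bij d1 d2 (T1 : measurableType d1)
    (T2 : measurableType d2) (e : T1 -> T2) (f : T2 -> \bar R) :
  bijective e -> measurable_fun setT e -> measurable_fun setT f ->
  (forall y, 0 <= f y)%E ->
  (\int[@counting T1 R]_x f (e x) = \int[@counting T2 R]_y f y)%E.
Proof.
move=> be me mf f0.
rewrite -[RHS](@eq_measure_integral _ _ _ setT _ (pushforward (@counting T1 R) e)).
  by rewrite ge0_integral_pushforward.
by move=> A mA _; rewrite /= /pushforward counting_bij.
Qed.

Definition freq_counting : set freq -> \bar R := counting.
HB.instance Definition _ := Measure.copy freq_counting (@counting freq R).

Lemma sigma_finite_counting_freq : sigma_finite [set: freq] freq_counting.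
Proof.
have [e be] := freq_enum.
exists (fun n => e @` `I_n).
  apply/seteqP; split => // k _; have [f ef fe] := be.
  by exists (f k).+1 => //=; exists (f k) => /=.
move=> n; split => //; rewrite /freq_counting /counting asboolT ?ltry//.
exact: finite_image.
Qed.
HB.instance Definition _ :=
  Measure_isSigmaFinite.Build _ _ _ freq_counting sigma_finite_counting_freq.

Local Notation nu := freq_counting.

Lemma sum_esum (f : freq -> \bar R) : (forall k, 0 <= f k)%E ->
  (\int[nu]_k f k = \esum_(k in [set: freq]) f k)%E.
Proof.
move=> f0; have [e be] := freq_enum.
rewrite /freq_counting -(ge0_integral_counting_bij be)//.
rewrite ge0_integral_count// nneseries_esumT//.
by rewrite (reindex_esum setT setT e)// setTT_bijective.
Qed.

(** Translations and reflections of the lattice preserve sums; this replaces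
    changes of variables in convolutions. *)
Lemma sum_reindex (e : freq -> freq) (f : freq -> \bar R) : bijective e ->
  (forall k, 0 <= f k)%E -> (\int[nu]_k f (e k) = \int[nu]_k f k)%E.
Proof. by move=> be f0; apply: ge0_integral_counting_bij. Qed.

Lemma csum_reindex (e : freq -> freq) (f : freq -> R[i]) : bijective e ->
  cint nu (fun k => f (e k)) = cint nu f.
Proof.
move=> be; rewrite /cint /Rintegral.
have h (p : freq -> \bar R) : (\int[nu]_k p (e k) = \int[nu]_k p k)%E.
  rewrite integralE [RHS]integralE; congr (_ - _)%E.
    by rewrite -[RHS](sum_reindex be)//; apply: eq_integral => k _; rewrite !funeposE.
  by rewrite -[RHS](sum_reindex be)//; apply: eq_integral => k _; rewrite !funenegE.
by rewrite (h (fun k => (complex.Re (f k))%:E)) (h (fun k => (complex.Im (f k))%:E)).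
Qed.

Lemma csum_delta (f : freq -> R[i]) (j : freq) :
  (forall k, k != j -> f k = 0) -> cint nu f = f j.
Proof.
move=> fj.
have h (p : freq -> R) : (forall k, k != j -> p k = 0) -> Rintegral nu setT p = p j.
  move=> pj; rewrite /Rintegral.
  transitivity (fine (\int[nu]_(k in [set j]) (p k)%:E)); last first.
    rewrite (eq_integral (fun=> (p j)%:E)); last by move=> x; rewrite inE /= => ->.
    rewrite integral_cst//= /freq_counting /counting asboolT; last exact: finite_set1.
    by rewrite fset_set1 cardfs1 mule1.
  congr fine; rewrite [RHS]integral_mkcond; apply: eq_integral => k _.
  rewrite patchE; case: ifPn => //; rewrite notin_setE/= => /eqP kj.
  by rewrite pj.
by apply: complex_ext => /=; apply: h => k kj; rewrite fj.
Qed.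

End Counting.
#[global] Hint Resolve measurable_freq : core.

Section NonnegSums.
Context {R : realType}.
Local Notation nu := (@freq_counting R).
Implicit Types (f g p q x : freq -> R) (A B : R).

Lemma le_sum (f g : freq -> \bar R) : (forall k, 0 <= f k)%E ->
  (forall k, f k <= g k)%E -> (\int[nu]_k f k <= \int[nu]_k g k)%E.
Proof.
move=> f0 fg; apply: ge0_le_integral => //.
Qed.

Lemma eq_sum (f g : freq -> \bar R) : f =1 g -> (\int[nu]_k f k = \int[nu]_k g k)%E.
Proof. by move=> fg; apply: eq_integral => k _. Qed.

Lemma sum_add (f g : freq -> \bar R) : (forall k, 0 <= f k)%E ->
  (forall k, 0 <= g k)%E ->
  (\int[nu]_k (f k + g k) = \int[nu]_k f k + \int[nu]_k g k)%E.
Proof. by move=> f0 g0; rewrite ge0_integralD. Qed.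

Lemma sum_scale (c : R) (f : freq -> \bar R) : 0 <= c -> (forall k, 0 <= f k)%E ->
  (\int[nu]_k (c%:E * f k) = c%:E * \int[nu]_k f k)%E.
Proof. by move=> c0 f0; rewrite ge0_integralZl_EFin. Qed.

Lemma sum_ge0 (f : freq -> \bar R) : (forall k, 0 <= f k)%E -> (0 <= \int[nu]_k f k)%E.
Proof. by move=> f0; apply: integral_ge0 => k _. Qed.

Lemma le_term_sum (f : freq -> \bar R) j : (forall k, 0 <= f k)%E ->
  (f j <= \int[nu]_k f k)%E.
Proof.
move=> f0; rewrite sum_esum//; apply: esum_ge; exists [set j].
  by split => //; exact: finite_set1.
by rewrite fsbig_set1.
Qed.

Lemma sum_swap (f : freq -> freq -> \bar R) : (forall k m, 0 <= f k m)%E ->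
  (\int[nu]_k \int[nu]_m f k m = \int[nu]_m \int[nu]_k f k m)%E.
Proof.
move=> f0.
have := @fubini_tonelli _ _ freq freq R nu nu (fun z => f z.1 z.2).
by apply => //; exact: measurable_prod_freq.
Qed.

Lemma addrK_bij (m : freq) : bijective (fun k : freq => k + m).
Proof. by exists (fun k => k - m) => k; rewrite ?addrK ?subrK. Qed.

Lemma subr_bij (m : freq) : bijective (fun k : freq => k - m).
Proof. exact: addrK_bij. Qed.

Lemma subl_bij (k : freq) : bijective (fun m : freq => k - m).
Proof. by exists (fun m => k - m) => m; rewrite subKr. Qed.

Lemma oppr_bij : bijective (fun m : freq => - m).
Proof. by exists (fun m => - m) => m; rewrite opprK. Qed.

(** Bounds rather than norms: each predicate carries finiteness together
    with the value of the bound, and applies to sequences for which no norm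
    has been shown finite yet. *)
Definition l1le f A := 0 <= A /\ (\int[nu]_k (f k)%:E <= A%:E)%E.
Definition l2le f A := 0 <= A /\ (\int[nu]_k (f k ^+ 2)%:E <= (A ^+ 2)%:E)%E.

Lemma l2le_mono f g A B : (forall k, 0 <= f k <= g k) -> A <= B -> l2le g A -> l2le f B.
Proof.
move=> fg AB [A0 h]; split; first exact: le_trans AB.
apply: le_trans (_ : (A ^+ 2)%:E <= _)%E; last first.
  by rewrite lee_fin lerXn2r ?nnegrE//; exact: le_trans AB.
apply: le_trans h; apply: le_sum => k; rewrite lee_fin ?sqr_ge0//.
by have /andP[f0 fgk] := fg k; rewrite lerXn2r ?nnegrE// (le_trans f0).
Qed.

Lemma sum_CS f g A B : (forall k, 0 <= f k) -> (forall k, 0 <= g k) ->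
  l2le f A -> l2le g B -> (\int[nu]_k (f k * g k)%:E <= (A * B)%:E)%E.
Proof.
move=> f0 g0 [A0 fA] [B0 gB].
have h (u : freq -> R) (U : R) : (forall k, 0 <= u k) -> 0 <= U ->
    (\int[nu]_k (u k ^+ 2)%:E <= (U ^+ 2)%:E)%E ->
    (Lnorm nu 2%:E (EFin \o u) <= U%:E)%E.
  move=> u0 U0 hu.
  rewrite unlock /=.
  rewrite -[leRHS](_ : ((U ^+ 2)%:E `^ 2^-1)%E = _); last first.
    by rewrite poweR_EFin -powR_mulrn// -powRrM divff ?powRr1// pnatr_eq0.
  apply: gt0_ler_poweR => //.
  - rewrite in_itv /= ?leey ?andbT; apply: integral_ge0 => k _.
    by rewrite lee_fin powR_ge0.
  - by rewrite in_itv /= leey andbT lee_fin sqr_ge0.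
  - apply: le_trans hu; apply: le_sum => k; first by rewrite lee_fin powR_ge0.
    by rewrite lee_fin ger0_norm// powR_mulrn.
have := @hoelder _ freq R nu f g 2 2 (measurable_freq _) (measurable_freq _).
have e2 : (2^-1 + 2^-1 = 1 :> R) by lra.
move=> /(_ (ltr0Sn _ _) (ltr0Sn _ _) e2) hh.
rewrite EFinM; apply: le_trans (lee_pmul _ _ (h _ _ f0 A0 fA) (h _ _ g0 B0 gB)).
- apply: le_trans hh; rewrite Lnorm1; apply: le_sum => k.
    by rewrite lee_fin mulr_ge0.
  by rewrite /= lee_fin ler_norm.
- exact: Lnorm_ge0.
- exact: Lnorm_ge0.
Qed.

Lemma l2le_add f g A B : (forall k, 0 <= f k) -> (forall k, 0 <= g k) ->
  l2le f A -> l2le g B -> l2le (fun k => f k + g k) (A + B).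
Proof.
move=> f0 g0 lf lg; have fg := sum_CS f0 g0 lf lg.
case: lf lg => A0 fA [B0 gB]; split; first exact: addr_ge0.
have e k : ((f k + g k) ^+ 2)%:E =
    ((f k ^+ 2)%:E + (2%:E * (f k * g k)%:E + (g k ^+ 2)%:E))%E.
  by rewrite -EFinM -!EFinD; congr EFin; ring.
under eq_integral do rewrite e.
rewrite sum_add; last 2 first.
- by move=> k; rewrite lee_fin sqr_ge0.
- by move=> k; rewrite -EFinM -EFinD lee_fin addr_ge0 ?sqr_ge0// !mulr_ge0.
rewrite sum_add; last 2 first.
- by move=> k; rewrite -EFinM lee_fin !mulr_ge0.
- by move=> k; rewrite lee_fin sqr_ge0.
rewrite sum_scale//; last by move=> k; rewrite lee_fin mulr_ge0.
rewrite (_ : (A + B) ^+ 2 = A ^+ 2 + (2 * (A * B) + B ^+ 2)); last by ring.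
rewrite !EFinD; apply: leeD => //; apply: leeD => //.
by rewrite EFinM; apply: lee_wpmul2l => //; rewrite lee_fin.
Qed.

Lemma l2le_scale f (c : R) A : 0 <= c -> l2le f A -> l2le (fun k => c * f k) (c * A).
Proof.
move=> c0 [A0 fA]; split; first exact: mulr_ge0.
under eq_integral do rewrite exprMn EFinM.
rewrite sum_scale ?sqr_ge0//; last by move=> k; rewrite lee_fin sqr_ge0.
by rewrite exprMn [leRHS]EFinM; apply: lee_wpmul2l => //; rewrite lee_fin sqr_ge0.
Qed.

Lemma l2le0 : l2le (fun=> 0) 0.
Proof.
by split => //; under eq_integral do rewrite expr0n; rewrite integral0 expr0n.
Qed.

Definition nconv f g (k : freq) : \bar R := (\int[nu]_m (f (k - m) * g m)%:E)%E.

Lemma nconv_ge0 f g k : (forall k, 0 <= f k) -> (forall k, 0 <= g k) ->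
  (0 <= nconv f g k)%E.
Proof. by move=> f0 g0; apply: sum_ge0 => m; rewrite lee_fin mulr_ge0. Qed.

Lemma nconvC f g : (forall k, 0 <= f k) -> (forall k, 0 <= g k) ->
  nconv f g = nconv g f.
Proof.
move=> f0 g0; apply/funext => k; rewrite /nconv.
rewrite -[RHS](sum_reindex (subl_bij k)); last by move=> m; rewrite lee_fin mulr_ge0.
by apply: eq_sum => m; rewrite subKr mulrC.
Qed.

(** Tonelli's theorem and translation invariance. *)
Lemma nconv_l1 f g A B : (forall k, 0 <= f k) -> (forall k, 0 <= g k) ->
  l1le f A -> l1le g B -> (\int[nu]_k nconv f g k <= (A * B)%:E)%E.
Proof.
move=> f0 g0 [A0 fA] [B0 gB].
rewrite /nconv sum_swap; last by move=> k m; rewrite lee_fin mulr_ge0.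
rewrite (@eq_sum _ (fun m => (\int[nu]_k (f k)%:E * (g m)%:E)%E)); last first.
  move=> m; rewrite muleC -ge0_integralZl_EFin//.
  - rewrite -[RHS](sum_reindex (subr_bij m)).
      by apply: eq_sum => k; rewrite -EFinM mulrC.
    by move=> k; rewrite mule_ge0 ?lee_fin.
  - by move=> k _; rewrite lee_fin.
have fin : (\int[nu]_k (f k)%:E)%E \is a fin_num.
  rewrite ge0_fin_numE; first exact: le_lt_trans fA (ltry _).
  by apply: sum_ge0 => k; rewrite lee_fin.
rewrite ge0_integralZl//=.
- by rewrite EFinM lee_pmul//; apply: sum_ge0 => k; rewrite lee_fin.
- by move=> k _; rewrite lee_fin.
- by apply: sum_ge0 => k; rewrite lee_fin.
Qed.

(** Young's inequality for [l^1] and [l^2]. Splitting [f (k - m) * g m] as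
    the product of [sqrt (f (k - m))] and [sqrt (f (k - m)) * g m], the
    Cauchy-Schwarz inequality bounds the square of the convolution by [A]
    times the convolution of [f] with [g ^+ 2]. The conclusion is about any
    [x] below the convolution, since the latter is extended-real valued. *)
Lemma nconv_l2 f g x A B : (forall k, 0 <= f k) -> (forall k, 0 <= g k) ->
  l1le f A -> l2le g B ->
  (forall k, 0 <= x k /\ ((x k)%:E <= nconv f g k)%E) -> l2le x (A * B).
Proof.
move=> f0 g0 lf lg hx.
have [A0 fA] := lf; have [B0 gB] := lg.
pose Q k := nconv f (fun m => g m ^+ 2) k.
have Q0 k : (0 <= Q k)%E by apply: nconv_ge0 => // m; rewrite sqr_ge0.
have QAB : (\int[nu]_k Q k <= (A * B ^+ 2)%:E)%E.
  by apply: nconv_l1 => //; [move=> k; rewrite sqr_ge0|split => //; rewrite sqr_ge0].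
split; first exact: mulr_ge0.
have xQ k : ((x k ^+ 2)%:E <= A%:E * Q k)%E.
  have Qfin : Q k \is a fin_num.
    rewrite ge0_fin_numE//; apply: le_lt_trans (le_lt_trans QAB (ltry _)).
    exact: le_term_sum.
  have Qr : 0 <= fine (Q k) by exact: fine_ge0.
  have [x0 xk] := hx k.
  have : ((x k)%:E <= (Num.sqrt A * Num.sqrt (fine (Q k)))%:E)%E.
    apply: le_trans xk _; rewrite /nconv.
    rewrite (@eq_sum _ (fun m => (Num.sqrt (f (k - m)) * (Num.sqrt (f (k - m)) * g m))%:E)).
      apply: sum_CS.
      - by move=> m; rewrite sqrtr_ge0.
      - by move=> m; rewrite mulr_ge0// sqrtr_ge0.
      - split; first exact: sqrtr_ge0.
        rewrite sqr_sqrtr//; apply: le_trans fA.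
        rewrite -[leRHS](sum_reindex (subl_bij k)); last by move=> m; rewrite lee_fin.
        by apply: le_sum => m; rewrite lee_fin ?sqr_ge0// sqr_sqrtr.
      - split; first exact: sqrtr_ge0.
        rewrite sqr_sqrtr// fineK//; apply: le_sum => m; rewrite lee_fin ?sqr_ge0//.
        by rewrite exprMn sqr_sqrtr.
    by move=> m; rewrite mulrA -expr2 sqr_sqrtr.
  rewrite -[Q k]fineK// -EFinM !lee_fin => xk'.
  rewrite -[A in leRHS]sqr_sqrtr// -[fine _ in leRHS]sqr_sqrtr// -exprMn.
  by rewrite lerXn2r// nnegrE// mulr_ge0// sqrtr_ge0.
apply: le_trans (le_sum _ xQ) _; first by move=> k; rewrite lee_fin sqr_ge0.
rewrite sum_scale// exprMn expr2 -mulrA EFinM.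
exact: lee_wpmul2l.
Qed.

End NonnegSums.

(** * Weighted sums over the lattice in dimension two *)

Section LatticeSums.
Context {R : realType}.
Local Notation nu := (@freq_counting R).

(** The Japanese bracket of a frequency. *)
Definition jb (k : freq) : R := Num.sqrt (1 + knorm k ^+ 2).

Lemma sqr_knorm (k : freq) : knorm k ^+ 2 = k.1%:~R ^+ 2 + k.2%:~R ^+ 2 :> R.
Proof. by rewrite sqr_sqrtr// addr_ge0// sqr_ge0. Qed.

Lemma knorm_ge0 (k : freq) : 0 <= knorm k :> R.
Proof. exact: sqrtr_ge0. Qed.

Lemma sqr_jb k : jb k ^+ 2 = 1 + knorm k ^+ 2.
Proof. by rewrite sqr_sqrtr// addr_ge0// sqr_ge0. Qed.

Lemma jb_ge1 k : 1 <= jb k.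
Proof. by rewrite -{1}sqrtr1 ler_wsqrtr// lerDl sqr_ge0. Qed.

Lemma jb_gt0 k : 0 < jb k. Proof. exact: lt_le_trans ltr01 (jb_ge1 k). Qed.
Lemma jb_ge0 k : 0 <= jb k. Proof. exact: ltW (jb_gt0 k). Qed.

Lemma knorm_le_jb k : knorm k <= jb k.
Proof.
rewrite -(@ler_pXn2r _ 2)// ?nnegrE ?knorm_ge0 ?jb_ge0// sqr_jb.
by rewrite lerDr.
Qed.

Lemma knormN (k : freq) : knorm (- k) = knorm k :> R.
Proof. by rewrite /knorm /= !rmorphN !sqrrN. Qed.

Lemma jbN k : jb (- k) = jb k.
Proof. by rewrite /jb knormN. Qed.

Lemma dot_le_knorm (k m : freq) :
  `|k.1%:~R * m.1%:~R + k.2%:~R * m.2%:~R| <= knorm k * knorm m :> R.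
Proof.
rewrite -(@ler_pXn2r _ 2)// ?nnegrE ?normr_ge0 ?mulr_ge0 ?knorm_ge0//.
rewrite real_normK ?num_real// exprMn !sqr_knorm.
set a : R := k.1%:~R; set b : R := k.2%:~R; set c : R := m.1%:~R; set d : R := m.2%:~R.
have := sqr_ge0 (a * d - b * c); nra.
Qed.

Lemma knormD (k m : freq) : knorm (k + m) <= knorm k + knorm m :> R.
Proof.
rewrite -(@ler_pXn2r _ 2)// ?nnegrE ?addr_ge0 ?knorm_ge0//.
have := dot_le_knorm k m; rewrite ler_norml => /andP[_].
rewrite sqrrD !sqr_knorm /= !rmorphD/=; lra.
Qed.

Lemma jbD (k m : freq) : jb (k + m) <= jb k + jb m.
Proof.
rewrite -(@ler_pXn2r _ 2)// ?nnegrE ?addr_ge0 ?jb_ge0// sqrrD !sqr_jb.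
have h := knormD k m.
have : knorm (k + m) ^+ 2 <= (knorm k + knorm m) ^+ 2 :> R.
  by rewrite lerXn2r ?nnegrE ?addr_ge0 ?knorm_ge0.
have := knorm_le_jb k; have := knorm_le_jb m.
have := knorm_ge0 k; have := knorm_ge0 m.
by rewrite sqrrD; nra.
Qed.

(** A one-dimensional weight growing like the square root of the frequency;
    see [jb_prod]. *)
Definition wt (n : nat) : R := Num.sqrt (1 + n%:R).

Lemma wt_gt0 n : 0 < wt n.
Proof. by rewrite sqrtr_gt0 ltr_pwDl. Qed.

Lemma sqr_wt n : wt n ^+ 2 = 1 + n%:R.
Proof. by rewrite sqr_sqrtr// addr_ge0. Qed.

(** Splitting the weight into a product reduces the two-dimensional lattice
    sums to one-dimensional ones. *)
Lemma jb_prod (k : freq) : wt `|k.1|%N * wt `|k.2|%N <= 2 * jb k.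
Proof.
rewrite -(@ler_pXn2r _ 2)// ?nnegrE ?mulr_ge0 ?jb_ge0 ?(ltW (wt_gt0 _))//.
rewrite !exprMn !sqr_wt sqr_jb sqr_knorm.
rewrite -[k.1%:~R ^+ 2]real_normK ?num_real// -[k.2%:~R ^+ 2]real_normK ?num_real//.
rewrite -!intr_norm -!abszE.
set a : R := `|k.1|%N%:R; set b : R := `|k.2|%N%:R.
rewrite !pmulrn -/a -/b.
have := sqr_ge0 (a - b); have := sqr_ge0 (a - 1); have := sqr_ge0 (b - 1); nra.
Qed.

Lemma esum_scale_le (T : choiceType) (c M : R) (f : T -> R) : 0 <= c ->
  (forall i, 0 <= f i) -> (\esum_(i in [set: T]) (f i)%:E <= M%:E)%E ->
  (\esum_(i in [set: T]) (c * f i)%:E <= (c * M)%:E)%E.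
Proof.
move=> c0 f0 fM; apply: ge_ereal_sup => _ [X XT <-].
under eq_fsbigr do rewrite EFinM.
rewrite -ge0_mule_fsumr; last by move=> i; rewrite lee_fin.
rewrite EFinM; apply: lee_wpmul2l => //.
by apply: le_trans fM; apply: ereal_sup_ubound; exists X.
Qed.

Lemma esum_int_le (g : nat -> R) (M : R) : (forall n, 0 <= g n) ->
  (forall N, \sum_(n < N) g n <= M) ->
  (\esum_(i in [set: int]) (g `|i|%N)%:E <= (2 * M)%:E)%E.
Proof.
move=> g0 gM.
have hn : (\esum_(n in [set: nat]) (g n)%:E <= M%:E)%E.
  rewrite -nneseries_esumT; last by move=> n; rewrite lee_fin.
  apply: lime_le; first by apply: is_cvg_nneseries => n _ _; rewrite lee_fin.
  by apply: nearW => N; rewrite big_mkord sumEFin lee_fin.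
rewrite (esumID [set i : int | 0 <= i]); last by move=> i _; rewrite lee_fin.
rewrite mulr_natl mulr2n EFinD !setTI; apply: leeD.
  rewrite (_ : [set i : int | 0 <= i] = Posz @` setT).
    by rewrite esum_image => // x y _ _ [].
  by apply/seteqP; split => [[n|n] //= _|_ [n _ <-]//]; exists n.
rewrite (_ : ~` _ = Negz @` setT).
  rewrite esum_image; last by move=> x y _ _ [].
  apply: le_trans hn.
  rewrite [leRHS](esumID (S @` setT)); last by move=> i _; rewrite lee_fin.
  rewrite setTI esum_image; last by move=> x y _ _ [].
  by rewrite leeDl// esum_ge0// => i _; rewrite lee_fin.
by apply/seteqP; split => [[n|n] //= _|_ [n _ <-]//]; exists n.
Qed.

(** Each one-dimensional sum runs over both signs, whence the factor 2. *)
Lemma sum_prod_le (F : freq -> R) (g : nat -> R) (c M : R) : 0 <= c ->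
  (forall n, 0 <= g n) -> (forall N, \sum_(n < N) g n <= M) ->
  (forall k, 0 <= F k <= c * (g `|k.1|%N * g `|k.2|%N)) ->
  (\int[nu]_k (F k)%:E <= (c * (2 * M) ^+ 2)%:E)%E.
Proof.
move=> c0 g0 gM FG.
have M0 : 0 <= 2 * M by rewrite mulr_ge0//; apply: le_trans (gM 0%N); rewrite big_ord0.
apply: (@le_trans _ _ (\int[nu]_k (c%:E * (g `|k.1|%N * g `|k.2|%N)%:E)%E)%E).
  by apply: le_sum => k; have /andP[a b] := FG k; rewrite -?EFinM lee_fin.
rewrite sum_scale//; last by move=> k; rewrite lee_fin mulr_ge0.
rewrite EFinM; apply: lee_wpmul2l => //.
rewrite sum_esum; last by move=> k; rewrite lee_fin mulr_ge0.
have := @esum_esum R int int setT (fun=> setT) (fun i j => (g `|i|%N * g `|j|%N)%:E).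
rewrite (_ : setT `*`` (fun=> setT) = setT); last first.
  by apply/seteqP; split.
move=> <-; last by move=> i j _ _; rewrite lee_fin mulr_ge0.
have hM := esum_int_le g0 gM.
rewrite expr2; apply: le_trans (esum_scale_le M0 (fun i => g0 `|i|%N) hM).
apply: le_esum => i _; rewrite mulrC; exact: (@esum_scale_le _ _ _ _ (g0 _)).
Qed.

Lemma wt_mono n m : (n <= m)%N -> wt n <= wt m.
Proof. by move=> nm; rewrite ler_wsqrtr// lerD2l ler_nat. Qed.

(** One dimension at a time, [wt n ^- 3] is bounded by the increment of [- 2
    / wt n], so its partial sums telescope. *)
Lemma sum_jb3 : exists2 M : R, 0 <= M & (\int[nu]_k ((jb k)^-1 ^+ 3)%:E <= M%:E)%E.
Proof.
pose g n := (wt n)^-1 ^+ 3.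
have g0 n : 0 <= g n by rewrite exprn_ge0// invr_ge0 ltW// wt_gt0.
have gM N : \sum_(n < N) g n <= 3.
  suff h : \sum_(n < N.+1) g n <= 3 - 2 / wt N.
    apply: le_trans (_ : \sum_(n < N.+1) g n <= _).
      by rewrite big_ord_recr/= lerDl.
    by apply: le_trans h _; rewrite gerBl divr_ge0// ltW// wt_gt0.
  elim: N => [|N IH].
    by rewrite big_ord1 /g /wt addr0 sqrtr1 invr1 expr1n; lra.
  rewrite big_ord_recr/=; apply: le_trans (lerD IH (lexx _)) _.
  rewrite /g; set x := wt N; set y := wt N.+1.
  have x0 : 0 < x by exact: wt_gt0.
  have y0 : 0 < y by exact: wt_gt0.
  have xy : x <= y by exact: wt_mono.
  have y2 : y ^+ 2 = x ^+ 2 + 1 by rewrite !sqr_wt -natr1 addrA.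
  suff : y^-1 ^+ 3 <= 2 / x - 2 / y by lra.
  have -> : 2 / x - 2 / y = 2 / (x * y * (x + y)).
    have xy0 : x * y * (x + y) != 0 by rewrite gt_eqF// !mulr_gt0// addr_gt0.
    have e : (y - x) * (x + y) = 1.
      by rewrite (_ : _ * _ = y ^+ 2 - x ^+ 2); [rewrite y2; ring|ring].
    apply: (mulIf xy0); rewrite divfK//.
    transitivity (2 * ((y - x) * (x + y))); last by rewrite e mulr1.
    by field; rewrite !gt_eqF.
  rewrite ler_pdivlMr; last by rewrite !mulr_gt0// addr_gt0.
  rewrite exprVn mulrC ler_pdivrMr ?exprn_gt0//.
  have h1 : x * y * x <= y ^+ 3.
    rewrite !exprS expr0 mulr1 [y * _]mulrCA -mulrA.
    apply: ler_pM => //; [exact: ltW|by rewrite mulr_ge0// ltW|].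
    by rewrite ler_wpM2l// ltW.
  have h2 : x * y * y <= y ^+ 3.
    by rewrite !exprS expr0 mulr1 -mulrA ler_wpM2r// mulr_ge0// ltW.
  by rewrite mulrDr mulr_natl mulr2n lerD.
exists (8 * (2 * 3) ^+ 2); first by rewrite mulr_ge0// sqr_ge0.
apply: (@sum_prod_le _ g) => // k.
rewrite exprn_ge0 ?invr_ge0 ?jb_ge0//= /g -exprMn -invfM.
rewrite (_ : 8 = 2 ^+ 3 :> R); last by ring.
rewrite -exprMn lerXn2r ?nnegrE ?invr_ge0 ?jb_ge0//.
  by rewrite mulr_ge0// invr_ge0 mulr_ge0// ltW// wt_gt0.
rewrite ler_pdivlMr ?mulr_gt0 ?wt_gt0// mulrC ler_pdivrMr ?jb_gt0//.
exact: jb_prod.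
Qed.

(** As [sum_jb3], with [1 / wt n] now bounded by the increment of [2 * sqrt
    n]; the sum over a disc of radius [r] is at most a multiple of the
    square of one-dimensional sums of size [sqrt r]. *)
Lemma sum_jb1 : exists2 M : R, 0 <= M & forall r, 1 <= r ->
  (\int[nu]_m (if jb m <= r then (jb m)^-1 else 0)%:E <= (M * r)%:E)%E.
Proof.
exists 64 => // r r1.
pose g n := if n%:R <= r then (wt n)^-1 else 0.
have g0 n : 0 <= g n by rewrite /g; case: ifP => // _; rewrite invr_ge0 ltW// wt_gt0.
have gM N : \sum_(n < N) g n <= 2 * Num.sqrt (1 + r).
  suff : \sum_(n < N) g n <= 2 * Num.sqrt N%:R /\
      \sum_(n < N) g n <= 2 * Num.sqrt (1 + r) by case.
  elim: N => [|N [IH1 IH2]].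
    by rewrite big_ord0; split; rewrite mulr_ge0// ?sqrtr_ge0.
  rewrite big_ord_recr /= {2 4}/g; set x := Num.sqrt _ in IH1.
  have -> : Num.sqrt N.+1%:R = wt N by rewrite /wt -natr1 addrC.
  set y := wt N.
  have x0 : 0 <= x by exact: sqrtr_ge0.
  have y0 : 0 < y by exact: wt_gt0.
  have xy : x <= y by rewrite ler_wsqrtr// lerDr.
  have y2 : y ^+ 2 = x ^+ 2 + 1 by rewrite sqr_wt sqr_sqrtr// addrC.
  case: ifPn => Nr; last first.
    by rewrite addr0; split => //; apply: le_trans IH1 _; rewrite ler_wpM2l.
  have h : \sum_(i < N) g i + y^-1 <= 2 * y.
    apply: le_trans (lerD IH1 (lexx _)) _.
    have xy0 : 0 < x + y by exact: ltr_wpDl.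
    have : y^-1 <= 2 / (x + y).
      by rewrite ler_pdivlMr// mulrC ler_pdivrMr//; lra.
    have -> : 2 / (x + y) = 2 * (y - x).
      have e : (y - x) * (x + y) = 1.
        by rewrite (_ : _ * _ = y ^+ 2 - x ^+ 2); [rewrite y2; ring|ring].
      by apply: (mulIf (lt0r_neq0 xy0)); rewrite divfK ?lt0r_neq0// -mulrA e mulr1.
    by lra.
  split => //; apply: le_trans h _; rewrite ler_wpM2l// ler_wsqrtr//.
  by rewrite lerD2l.
apply: le_trans (_ : ((2 * (2 * (2 * Num.sqrt (1 + r))) ^+ 2)%:E <= _)%E).
  apply: (@sum_prod_le _ g) => // k.
  case: ifPn => kr; last by rewrite lexx /= !mulr_ge0.
  rewrite invr_ge0 jb_ge0 /= /g.
  have k1 : `|k.1|%N%:R <= r.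
    apply: le_trans kr; apply: le_trans (knorm_le_jb k).
    rewrite -(@ler_pXn2r _ 2)// ?nnegrE ?knorm_ge0// sqr_knorm.
    by rewrite pmulrn abszE intr_norm real_normK ?num_real// lerDl sqr_ge0.
  have k2 : `|k.2|%N%:R <= r.
    apply: le_trans kr; apply: le_trans (knorm_le_jb k).
    rewrite -(@ler_pXn2r _ 2)// ?nnegrE ?knorm_ge0// sqr_knorm.
    by rewrite pmulrn abszE intr_norm real_normK ?num_real// lerDr sqr_ge0.
  rewrite k1 k2 -invfM ler_pdivlMr ?mulr_gt0 ?wt_gt0//.
  rewrite mulrC ler_pdivrMr ?jb_gt0//.
  exact: jb_prod.
rewrite lee_fin !exprMn sqr_sqrtr ?addr_ge0 ?(le_trans ler01)//; lra.
Qed.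

(** The endpoint product estimate [H^{1/2} * H^{1/2} -> L^2] in dimension
    two, for the part of the convolution where the second frequency is the
    smaller one. After Cauchy-Schwarz with weight [jb m] on the second
    factor, the first factor is left with the sum of [1 / jb m] over [jb m
    <= jb (k - m)], which by [sum_jb1] is [O (jb (k - m))]: all the weight
    is put on the first factor, and no logarithm is lost. *)
Lemma nconv_half_low : exists2 C : R, 0 <= C &
  forall (p q x : freq -> R) (P Q : R),
  (forall k, 0 <= p k) -> (forall k, 0 <= q k) ->
  l2le (fun k => Num.sqrt (jb k) * p k) P -> l2le (fun k => Num.sqrt (jb k) * q k) Q ->
  (forall k, 0 <= x k /\ ((x k)%:E <= \int[nu]_m
     (if jb m <= jb (k - m) then p (k - m) * q m else 0)%:E)%E) ->
  l2le x (C * P * Q).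
Proof.
have [M M0 hM] := sum_jb1.
exists (Num.sqrt M); first exact: sqrtr_ge0.
move=> p q x P Q p0 q0 [P0 hP] [Q0 hQ] hx.
(* The square of the first factor in the Cauchy-Schwarz inequality. *)
pose s k m : R := if jb m <= jb (k - m) then p (k - m) ^+ 2 * (jb m)^-1 else 0.
have s0 k m : 0 <= s k m.
  by rewrite /s; case: ifP => // _; rewrite mulr_ge0 ?sqr_ge0// invr_ge0 jb_ge0.
pose S k := (\int[nu]_m (s k m)%:E)%E.
have S0 k : (0 <= S k)%E by apply: sum_ge0 => m; rewrite lee_fin.
have hS : (\int[nu]_k S k <= (M * P ^+ 2)%:E)%E.
  rewrite /S sum_swap; last by move=> k m; rewrite lee_fin.
  rewrite (@eq_sum _ _ (fun m => \int[nu]_j (if jb m <= jb j then p j ^+ 2 * (jb m)^-1 else 0)%:E)%E); last first.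
    move=> m; rewrite -[RHS](sum_reindex (subr_bij m))//.
    move=> k; rewrite lee_fin; case: ifP => // _.
    by rewrite mulr_ge0 ?sqr_ge0// invr_ge0 jb_ge0.
  rewrite sum_swap; last first.
    move=> m k; rewrite lee_fin; case: ifP => // _.
    by rewrite mulr_ge0 ?sqr_ge0// invr_ge0 jb_ge0.
  rewrite EFinM; apply: (@le_trans _ _ (M%:E * \int[nu]_j ((Num.sqrt (jb j) * p j) ^+ 2)%:E)%E).
    rewrite -sum_scale//; last by move=> k; rewrite lee_fin sqr_ge0.
    apply: le_sum => j.
      apply: sum_ge0 => m; rewrite lee_fin; case: ifP => // _.
      by rewrite mulr_ge0 ?sqr_ge0// invr_ge0 jb_ge0.
    rewrite (@eq_sum _ _ (fun m => (p j ^+ 2)%:E * (if jb m <= jb j then (jb m)^-1 else 0)%:E)%E); last first.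
      by move=> m; rewrite -EFinM; case: ifP => // _; rewrite mulr0.
    rewrite sum_scale ?sqr_ge0//; last first.
      by move=> m; rewrite lee_fin; case: ifP => // _; rewrite invr_ge0 jb_ge0.
    apply: le_trans (lee_wpmul2l _ (hM _ (jb_ge1 j))) _; first by rewrite lee_fin sqr_ge0.
    rewrite -!EFinM lee_fin exprMn sqr_sqrtr ?jb_ge0//; lra.
  by apply: lee_wpmul2l => //; rewrite lee_fin.
split; first by rewrite !mulr_ge0// sqrtr_ge0.
have xS k : ((x k ^+ 2)%:E <= (Q ^+ 2)%:E * S k)%E.
  have Sfin : S k \is a fin_num.
    rewrite ge0_fin_numE//; apply: le_lt_trans (le_lt_trans hS (ltry _)).
    exact: le_term_sum.
  have Sr : 0 <= fine (S k) by exact: fine_ge0.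
  have [x0 xk] := hx k.
  have : ((x k)%:E <= (Num.sqrt (fine (S k)) * Q)%:E)%E.
    apply: le_trans xk _.
    rewrite (@eq_sum _ _ (fun m => (Num.sqrt (s k m) * (Num.sqrt (jb m) * q m))%:E)).
      apply: sum_CS.
      - by move=> m; rewrite sqrtr_ge0.
      - by move=> m; rewrite mulr_ge0// sqrtr_ge0.
      - split; first exact: sqrtr_ge0.
        rewrite sqr_sqrtr// fineK//; apply: le_sum => m; rewrite lee_fin ?sqr_ge0//.
        by rewrite sqr_sqrtr.
      - by split.
    move=> m; congr EFin; rewrite /s; case: ifP => _; last by rewrite sqrtr0 mul0r.
    rewrite sqrtrM ?sqr_ge0// sqrtr_sqr ger0_norm// sqrtrV ?jb_ge0//.
    have r0 : Num.sqrt (jb m) != 0 by rewrite gt_eqF// sqrtr_gt0 jb_gt0.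
    by rewrite mulrA divfK// mulrA.
  rewrite -[S k]fineK// -EFinM !lee_fin => xk'.
  rewrite -[fine _ in leRHS]sqr_sqrtr// -exprMn mulrC.
  by rewrite lerXn2r// nnegrE// mulr_ge0// sqrtr_ge0.
apply: le_trans (le_sum _ xS) _; first by move=> k; rewrite lee_fin sqr_ge0.
rewrite sum_scale ?sqr_ge0// [_ * Q]mulrC exprMn [leRHS]EFinM; apply: lee_wpmul2l.
  by rewrite lee_fin sqr_ge0.
by rewrite exprMn sqr_sqrtr.
Qed.

(** The two halves of the convolution, according to which frequency is the
    smaller one, are exchanged by swapping the factors. *)
Lemma nconv_half : exists2 C : R, 0 <= C &
  forall (p q x : freq -> R) (P Q : R),
  (forall k, 0 <= p k) -> (forall k, 0 <= q k) ->
  l2le (fun k => Num.sqrt (jb k) * p k) P -> l2le (fun k => Num.sqrt (jb k) * q k) Q ->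
  (forall k, 0 <= x k /\ ((x k)%:E <= nconv p q k)%E) ->
  l2le x (C * P * Q).
Proof.
have [C C0 hC] := nconv_half_low.
exists (2 * C); first by rewrite mulr_ge0.
move=> p q x P Q p0 q0 hP hQ hx.
pose low (p q : freq -> R) k := (\int[nu]_m
     (if jb m <= jb (k - m) then p (k - m) * q m else 0)%:E)%E.
have low0 (p' q' : freq -> R) k : (forall k, 0 <= p' k) -> (forall k, 0 <= q' k) -> (0 <= low p' q' k)%E.
  by move=> *; apply: sum_ge0 => m; rewrite lee_fin; case: ifP => // _; rewrite mulr_ge0.
have split_conv k : (nconv p q k <= low p q k + low q p k)%E.
  rewrite /low -[X in (_ <= _ + X)%E](sum_reindex (subl_bij k)); last first.
    by move=> m; rewrite lee_fin; case: ifP => // _; rewrite mulr_ge0.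
  rewrite -sum_add; last 2 first.
  - by move=> m; rewrite lee_fin; case: ifP => // _; rewrite mulr_ge0.
  - by move=> m; rewrite lee_fin; case: ifP => // _; rewrite mulr_ge0.
  apply: le_sum => m; first by rewrite lee_fin mulr_ge0.
  rewrite subKr -EFinD lee_fin.
  have h0 : 0 <= p (k - m) * q m by rewrite mulr_ge0.
  have [h|h] := leP (jb m) (jb (k - m)); first by case: ifP => _; rewrite ?lerDl ?mulr_ge0.
  by rewrite (ltW h) add0r mulrC.
have lowfin (p' q' : freq -> R) P' Q' k : (forall k, 0 <= p' k) -> (forall k, 0 <= q' k) ->
    l2le (fun k => Num.sqrt (jb k) * p' k) P' -> l2le (fun k => Num.sqrt (jb k) * q' k) Q' ->
    low p' q' k \is a fin_num.
  move=> p0' q0' hP' hQ'; rewrite ge0_fin_numE ?low0//.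
  have le_sq (u : freq -> R) m : (forall k, 0 <= u k) -> u m <= Num.sqrt (jb m) * u m.
    by move=> u0; rewrite ler_peMl// -sqrtr1 ler_wsqrtr// jb_ge1.
  apply: le_lt_trans (ltry (P' * Q')).
  have lP : l2le (fun m => p' (k - m)) P'.
    case: hP' => P0 hP'; split => //; apply: le_trans hP'.
    rewrite -[leRHS](sum_reindex (subl_bij k)); last by move=> m; rewrite lee_fin sqr_ge0.
    apply: le_sum => m; rewrite lee_fin ?sqr_ge0//.
    by rewrite lerXn2r ?nnegrE ?mulr_ge0 ?sqrtr_ge0// le_sq.
  have lQ : l2le q' Q'.
    by apply: l2le_mono hQ' => // m; rewrite q0' le_sq.
  apply: le_trans (sum_CS _ _ lP lQ) => //.
  apply: le_sum => m; rewrite lee_fin; case: ifP => // _; by rewrite mulr_ge0.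
have finpq k : low p q k \is a fin_num by exact: (lowfin _ _ P Q).
have finqp k : low q p k \is a fin_num by exact: (lowfin _ _ Q P).
have l1 : l2le (fun k => fine (low p q k)) (C * P * Q).
  by apply: (hC p q) => // k; rewrite fine_ge0 ?low0// fineK.
have l2 : l2le (fun k => fine (low q p k)) (C * Q * P).
  by apply: (hC q p) => // k; rewrite fine_ge0 ?low0// fineK.
have fin0 (p' q' : freq -> R) k : (forall k, 0 <= p' k) -> (forall k, 0 <= q' k) -> 0 <= fine (low p' q' k).
  by move=> p0' q0'; rewrite fine_ge0 ?low0.
have := l2le_add (fun k => fin0 p q k p0 q0) (fun k => fin0 q p k q0 p0) l1 l2.
apply: l2le_mono; last by lra.
move=> k; have [-> xk] := hx k; rewrite /= -lee_fin EFinD !fineK//.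
exact: le_trans xk (split_conv k).
Qed.

End LatticeSums.

(** * Characters of the torus *)

Section Torus.
Context {R : realType}.
Local Notation C := R[i].
Local Notation circle := (uniform_prob (@two_pi_gt0 R)).
Local Notation mu := (torus_measure R).
Local Notation TT := (measurableTypeR R * measurableTypeR R)%type.

HB.instance Definition _ := Probability.copy mu (circle \x circle)%E.

Definition expo (k : freq) (x : TT) : C := cis (k.1%:~R * x.1 + k.2%:~R * x.2).

Lemma expoD k m x : expo (k + m) x = expo k x * expo m x.
Proof. by rewrite /expo -cisD /= !rmorphD/=; congr cis; ring. Qed.

Lemma expo0 x : expo 0 x = 1.
Proof. by rewrite /expo /= !mul0r addr0 cis0. Qed.

Lemma expoN k x : expo (- k) x = conjc (expo k x).
Proof. by rewrite /expo conj_cis /= !rmorphN /=; congr cis; ring. Qed.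

Lemma cnorm_expo k x : cnorm (expo k x) = 1.
Proof. exact: cnorm_cis. Qed.

Lemma cmeas_expo k : cmeas (expo k).
Proof.
apply: cmeas_cis; apply: measurable_funD; apply: measurable_funM => //.
Qed.

Lemma fourierE (f : torus_fun R) (k : freq) :
  fourier f k = cint mu (fun x => f x * expo (- k) x).
Proof.
rewrite /fourier /torus_integral.
have -> : (fun x => f x * expo (- k) x) =
    (fun x : TT => f x * cexp (- ('i * (k.1%:~R * x.1 + k.2%:~R * x.2)%:C))).
  apply/funext => x; congr (_ * _).
  by rewrite -mulrN -rmorphN /= cexp_iR /expo /= !rmorphN/=; congr cis; ring.
by [].
Qed.

Lemma torus_measureT : mu [set: TT] = 1%E.
Proof. exact: probability_setT. Qed.

Lemma cintegrable_bounded (f : TT -> C) (M : R) : cmeas f ->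
  (forall x, cnorm (f x) <= M) -> cintegrable mu f.
Proof.
move=> mf fM; apply: (@cintegrable_le _ _ _ _ _ (fun=> M)) => //.
by rewrite integral_cst// (_ : _ [set: _] = 1%E) ?mule1 ?ltry//; exact: torus_measureT.
Qed.

(** The fundamental theorem of calculus for functions with a periodic
    primitive. The density of the uniform law is integrated for nonnegative
    functions only, so 1 is added to the integrand. *)
Lemma integral_circle_FTC (f F : R -> R) :
  (forall x, `|f x| <= 1) -> continuous f ->
  (forall x : R, is_derive x (1 : R) F (f x)) -> F (2 * pi) = F 0 ->
  Rintegral circle setT f = 0.
Proof.
move=> f1 cf dF F0.
have mf : measurable_fun setT f by exact: continuous_measurable_fun.
have ci : circle.-integrable setT (EFin \o f).
  apply/integrableP; split; first exact/measurable_EFinP.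
  apply: (@le_lt_trans _ _ (\int[circle]_x (cst 1%E x))%E).
    apply: ge0_le_integral => //; first by apply: measurableT_comp => //; exact/measurable_EFinP.
    by move=> x _; rewrite /= lee_fin.
  by rewrite integral_cst// mul1e (@le_lt_trans _ _ 1%E) ?ltry// probability_le1.
have h : (\int[circle]_x (1 + f x)%:E = 1)%E.
  rewrite integral_uniform; last 2 first.
  - by apply/measurable_EFinP; apply: measurable_funD.
  - move=> x; rewrite lee_fin -lerBlDl sub0r.
    by have := f1 x; rewrite ler_norml => /andP[].
  have dG x : is_derive x (1 : R) (fun y => y + F y) (1 + f x) by apply: is_deriveD.
  have cG x : {for x, continuous (fun y => y + F y)}.
    by apply: differentiable_continuous; apply/derivable1_diffP; exact: ex_derive.
  rewrite (@continuous_FTC2 _ _ (fun y => y + F y)).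
  - rewrite -EFinB -EFinM F0 subr0 opprD addrACA subrr addr0 subr0 mulVf//.
    by rewrite gt_eqF// two_pi_gt0.
  - exact: two_pi_gt0.
  - apply: continuous_subspaceT => x; apply: continuousD; [exact: cvg_cst|exact: cf].
  - split.
    + move=> x _; exact: ex_derive.
    + by apply: cvg_at_right_filter; exact: cG.
    + by apply: cvg_at_left_filter; exact: cG.
  - by move=> x _; rewrite derive1E; exact: derive_val.
have : Rintegral circle setT (fun x => 1 + f x) = 1 by rewrite /Rintegral h.
rewrite RintegralD//; last first.
  apply/integrableP; split; first exact/measurable_EFinP.
  rewrite (eq_integral (cst 1%E)); last by move=> x _; rewrite /= normr1.
  by rewrite integral_cst// mul1e (@le_lt_trans _ _ 1%E) ?ltry// probability_le1.
rewrite Rintegral_cst//= probability_setT mulr1 => h1.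
by apply: (addrI 1); rewrite h1 addr0.
Qed.

Lemma cis_2pi (n : int) : cis (n%:~R * (2 * pi)) = 1 :> C.
Proof.
have h (m : nat) : cis (m%:R * (2 * pi)) = 1 :> C.
  elim: m => [|m IH]; first by rewrite mul0r cis0.
  rewrite -natr1 mulrDl cisD IH !mul1r /cis mulr_natl cos2pi sin2pi.
  by [].
case: n => n; first exact: h.
by rewrite NegzE rmorphN /= mulNr -conj_cis h conjc1.
Qed.

Lemma circle_char (n : int) : n != 0 -> cint circle (fun x => cis (n%:~R * x) : C) = 0.
Proof.
move=> n0; have n0' : n%:~R != 0 :> R by rewrite intr_eq0.
have dn x : is_derive x (1 : R) (fun y : R => n%:~R * y) n%:~R.
  have := is_deriveZ (n%:~R : R) (is_derive_id x (1 : R)).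
  by rewrite /GRing.scale /= mulr1.
have cn : continuous (fun y : R => n%:~R * y).
  by move=> x; apply: continuousM => //; exact: cvg_cst.
have /(congr1 (@complex.Re _)) /= c2 := cis_2pi n.
have /(congr1 (@complex.Im _)) /= s2 := cis_2pi n.
apply: complex_ext => /=.
- apply: (@integral_circle_FTC _ (fun x => (n%:~R)^-1 * sin (n%:~R * x))).
  + by move=> x; rewrite ler_norml cos_geN1 cos_le1.
  + by move=> x; apply: continuous_comp; [exact: cn|exact: continuous_cos].
  + move=> x.
    have h := @is_derive1_comp R (@sin R) (fun y => n%:~R * y) x _ _ (is_derive_sin _) (dn x).
    have := is_deriveZ (n%:~R^-1 : R) h.
    by rewrite /GRing.scale /= mulrCA mulVf// mulr1.
  + by rewrite s2 !mulr0 sin0 mulr0.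
- apply: (@integral_circle_FTC _ (fun x => - (n%:~R)^-1 * cos (n%:~R * x))).
  + by move=> x; rewrite ler_norml sin_geN1 sin_le1.
  + by move=> x; apply: continuous_comp; [exact: cn|exact: continuous_sin].
  + move=> x.
    have h := @is_derive1_comp R (@cos R) (fun y => n%:~R * y) x _ _ (is_derive_cos _) (dn x).
    have := is_deriveZ (- n%:~R^-1 : R) h.
    by rewrite /GRing.scale /= mulrCA [- _ * n%:~R]mulNr mulVf// mulrNN mulr1.
  + by rewrite c2 mulr0 cos0.
Qed.

Lemma cintegrable_circle_cis (n : int) : cintegrable circle (fun x => cis (n%:~R * x) : C).
Proof.
apply: (@cintegrable_le _ _ _ _ _ (fun=> 1)) => //.
- by apply: cmeas_cis; apply: measurable_funM.
- by move=> x; rewrite cnorm_cis.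
- by rewrite integral_cst//= probability_setT mule1 ltry.
Qed.

Lemma circle_int (n : int) :
  cint circle (fun x => cis (n%:~R * x) : C) = if n == 0 then 1 else 0.
Proof.
case: eqP => [->|/eqP/circle_char//].
rewrite (_ : (fun x => _) = fun=> 1); last by apply/funext => x; rewrite mul0r cis0.
by apply: complex_ext => /=; rewrite Rintegral_cst//= probability_setT ?mulr1 ?mul0r.
Qed.

(** Orthogonality of the characters, from the one-dimensional case by
    Fubini's theorem. *)
Lemma torus_char (k : freq) : cint mu (expo k) = if k == 0 then 1 else 0.
Proof.
have ci : cintegrable (circle \x circle)%E (expo k).
  apply: (@cintegrable_bounded _ 1); first exact: cmeas_expo.
  by move=> x; rewrite cnorm_expo.
have e1 x : (fun y : measurableTypeR R => expo k (x, y)) = (fun y => cis (k.1%:~R * x) * cis (k.2%:~R * y)).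
  by apply/funext => y; rewrite -cisD.
have e2 y : (fun x : measurableTypeR R => expo k (x, y)) = (fun x => cis (k.2%:~R * y) * cis (k.1%:~R * x)).
  by apply/funext => x; rewrite -cisD addrC.
have [<- _] := @cint_Fubini R _ _ _ _ circle circle (expo k) ci
  (fun x => eq_ind_r _ (cintegrableZ _ (cintegrable_circle_cis _)) (e1 x))
  (fun x => eq_ind_r _ (cintegrableZ _ (cintegrable_circle_cis _)) (e2 x)).
have h1 x : cint circle (fun y : measurableTypeR R => expo k (x, y)) =
    cint circle (fun y => cis (k.2%:~R * y)) * cis (k.1%:~R * x).
  rewrite e1 [RHS]mulrC.
  exact: (cintZ (cis (k.1%:~R * x)) (cintegrable_circle_cis k.2)).
have -> : (fun x => cint circle (fun y : measurableTypeR R => expo k (x, y))) =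
    (fun x => cint circle (fun y => cis (k.2%:~R * y)) * cis (k.1%:~R * x)).
  exact/funext.
have -> := cintZ (cint circle (fun y => cis (k.2%:~R * y))) (cintegrable_circle_cis k.1).
rewrite !circle_int; case: k {ci e1 e2 h1} => k1 k2 /=.
rewrite (_ : ((k1, k2) == 0 :> freq) = (k1 == 0) && (k2 == 0)); last by [].
by case: (k1 == 0); case: (k2 == 0); rewrite /= ?mulr1 ?mulr0.
Qed.

End Torus.

(** * Uniqueness of Fourier coefficients *)

Section PowerLimits.
Context {R : realType}.
Implicit Types (t y : R).

Lemma exp_1m_ge t N : 0 <= t <= 1 -> 1 - N%:R * t <= (1 - t) ^+ N.
Proof.
move=> /andP[t0 t1]; elim: N => [|N IH]; first by rewrite mul0r subr0 expr0.
have h : 0 <= 1 - t by lra.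
have := ler_wpM2l h IH; rewrite -exprS; apply: le_trans.
rewrite -natr1; have := mulr_ge0 (ler0n R N) (sqr_ge0 t); nra.
Qed.

(** Equivalent to [(1 + N t) (1 - t)^N <= 1], by induction on [N]. *)
Lemma exp_1m_le t N : 0 <= t <= 1 -> (1 - t) ^+ N <= (1 + N%:R * t)^-1.
Proof.
move=> /andP[t0 t1]; have pos M : 0 < 1 + M%:R * t by rewrite ltr_pwDl// mulr_ge0.
rewrite -[leRHS]mul1r ler_pdivlMr//.
elim: N => [|N IH]; first by rewrite mul0r addr0 expr0 mulr1.
rewrite exprS -natr1; apply: le_trans IH.
have h : 0 <= (1 - t) ^+ N by rewrite exprn_ge0//; lra.
rewrite mulrAC mulrC; apply: ler_wpM2l => //.
have := mulr_ge0 (ler0n R N) (sqr_ge0 t); nra.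
Qed.

(** With [s = sqrt r], the sequence [(n + 1) s^n] is bounded by Bernoulli's
    inequality, and the other factor [s^n] tends to 0. *)
Lemma cvg_succ_geometric r : 0 <= r -> r < 1 -> (fun n => n.+1%:R * r ^+ n) @ \oo --> (0 : R).
Proof.
move=> r0 r1; have [->|rn0] := eqVneq r 0.
  apply: cvg_near_cst; near=> n.
  by rewrite expr0n gtn_eqF ?mulr0//; near: n; exact: nbhs_infty_gt.
pose s := Num.sqrt r.
have rpos : 0 < r by rewrite lt0r rn0.
have s0 : 0 < s by rewrite sqrtr_gt0.
have s1 : s < 1 by rewrite -sqrtr1 ltr_sqrt.
pose B := 1 + (1 - s)^-1.
have B0 : 0 <= B by rewrite addr_ge0// invr_ge0; lra.
have hs n : n.+1%:R * s ^+ n <= B.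
  have := @exp_1m_le (1 - s) n; rewrite subKr => /(_ _)/wrap[|h]; first by lra.
  have pos : 0 < 1 + n%:R * (1 - s) by rewrite ltr_pwDl// mulr_ge0//; lra.
  apply: le_trans (ler_wpM2l (ler0n R _) h) _.
  rewrite ler_pdivrMr// /B mulrDl mul1r -natr1.
  have d0 : 0 < 1 - s by lra.
  have -> : (1 - s)^-1 * (1 + n%:R * (1 - s)) = (1 - s)^-1 + n%:R.
    by rewrite mulrDr mulr1 mulrCA mulVf ?gt_eqF// mulr1.
  have : 0 <= (1 - s)^-1 by rewrite invr_ge0 ltW.
  have := mulr_ge0 (ler0n R n) (ltW d0); lra.
apply: (@squeeze_cvgr _ _ _ _ (fun=> 0) (fun n => B * s ^+ n)).
- apply: nearW => n; rewrite mulr_ge0 ?exprn_ge0//=.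
  have -> : r ^+ n = s ^+ n * s ^+ n by rewrite -exprMn -expr2 sqr_sqrtr.
  by rewrite mulrA ler_wpM2r// exprn_ge0// ltW.
- exact: cvg_cst.
- rewrite -[X in _ --> X](mulr0 B); apply: cvgM; first exact: cvg_cst.
  by apply: cvg_expr; rewrite ger0_norm// ltW.
Unshelve. all: by end_near.
Qed.

(** Polynomials that converge on [[0, 1]] to the indicator function of [[0,
    1/2)]: the exponent times [y^n] is [(n + 1) (2 y)^n], which tends to 0
    below 1/2 and to infinity from 1/2 on. *)
Definition step_poly n y : R := (1 - y ^+ n) ^+ (n.+1 * 2 ^ n).

Lemma step_poly01 n y : 0 <= y <= 1 -> 0 <= step_poly n y <= 1.
Proof.
move=> /andP[y0 y1]; have h : 0 <= y ^+ n <= 1 by rewrite exprn_ge0// exprn_ile1.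
by rewrite exprn_ge0 ?exprn_ile1//; lra.
Qed.

Lemma cvg_step_poly y : 0 <= y <= 1 ->
  step_poly^~ y @ \oo --> (if y < 2^-1 then 1 else 0 : R).
Proof.
move=> /andP[y0 y1]; have h n : 0 <= y ^+ n <= 1 by rewrite exprn_ge0// exprn_ile1.
have e n : (n.+1 * 2 ^ n)%:R * y ^+ n = n.+1%:R * (2 * y) ^+ n :> R.
  by rewrite natrM natrX exprMn mulrA.
case: ltP => y2.
- apply: (@squeeze_cvgr _ _ _ _ (fun n => 1 - n.+1%:R * (2 * y) ^+ n) (fun=> 1)).
  + apply: nearW => n; rewrite -e exp_1m_ge//=.
    by have /andP[] : 0 <= step_poly n y <= 1 by apply: step_poly01; rewrite y0.
  + rewrite -[X in _ --> X]subr0; apply: cvgB; first exact: cvg_cst.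
    by apply: cvg_succ_geometric; [rewrite mulr_ge0|lra].
  + exact: cvg_cst.
- apply: (@squeeze_cvgr _ _ _ _ (fun=> 0) (fun n => n.+1%:R^-1)).
  + apply: nearW => n; have /andP[-> _] : 0 <= step_poly n y <= 1 by apply: step_poly01; rewrite y0.
    apply: le_trans (exp_1m_le _ (h n)) _; rewrite lef_pV2 ?posrE ?ltr0n//; last first.
      by rewrite ltr_pwDl// mulr_ge0//; have /andP[] := h n.
    rewrite e -[leLHS]mulr1; apply: le_trans (_ : n.+1%:R * (2 * y) ^+ n <= _); last by rewrite lerDr.
    rewrite ler_wpM2l// exprn_ege1//; lra.
  + exact: cvg_cst.
  + exact: cvg_harmonic.
Qed.

End PowerLimits.

Section Uniqueness.
Context {R : realType}.
Local Notation C := R[i].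
Local Notation circle := (uniform_prob (@two_pi_gt0 R)).
Local Notation mu := (torus_measure R).
Local Notation TT := (measurableTypeR R * measurableTypeR R)%type.
Implicit Types (g : TT -> R) (f : TT -> C).

(** Uniqueness is proved by enlarging the class of bounded functions [g] for
    which [fourier f = 0] implies [fourier (g f) = 0]. This class contains
    the trigonometric polynomials, is an algebra, and is closed under
    bounded pointwise limits; the sets with indicator function in it then
    form a sigma-algebra. *)
Definition fnull f := cintegrable mu f /\ forall k : freq, fourier f k = 0.

Definition fmult g := [/\ measurable_fun setT g, exists M, forall x, `|g x| <= M &
  forall f, fnull f -> fnull (fun x => (g x)%:C * f x)].

Lemma fnull_bdM g (M : R) f : measurable_fun setT g -> (forall x, `|g x| <= M) ->
  cintegrable mu f -> cintegrable mu (fun x => (g x)%:C * f x).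
Proof.
move=> mg gM hf.
apply: (cintegrable_bdM hf (cmeas_real mg) (M := M)) => x.
by rewrite cnormR.
Qed.

Lemma cintegrable_expo k f : cintegrable mu f -> cintegrable mu (fun x => f x * expo k x).
Proof.
move=> hf; under eq_fun do rewrite mulrC.
apply: (cintegrable_bdM hf (cmeas_expo k) (M := 1)) => x.
by rewrite cnorm_expo.
Qed.

Lemma fourierD f1 f2 k : cintegrable mu f1 -> cintegrable mu f2 ->
  fourier (fun x => f1 x + f2 x) k = fourier f1 k + fourier f2 k.
Proof.
move=> h1 h2; rewrite !fourierE -cintD; try exact: cintegrable_expo.
by congr cint; apply/funext => x; rewrite mulrDl.
Qed.

Lemma fourierZ c f k : cintegrable mu f ->
  fourier (fun x => c * f x) k = c * fourier f k.
Proof.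
move=> h; rewrite !fourierE -cintZ; try exact: cintegrable_expo.
by congr cint; apply/funext => x; rewrite mulrA.
Qed.

Lemma fourier_shift f (j k : freq) :
  fourier (fun x => expo j x * f x) k = fourier f (k - j).
Proof.
rewrite !fourierE; congr cint; apply/funext => x.
by rewrite opprB expoD mulrA [expo j x * _]mulrC.
Qed.

Lemma fmult_cst c : fmult (fun=> c).
Proof.
split => [//||f [hf f0]]; first by exists `|c|.
split; first by apply: cintegrableZ.
by move=> k; rewrite fourierZ// f0 mulr0.
Qed.

Lemma fmultD g1 g2 : fmult g1 -> fmult g2 -> fmult (fun x => g1 x + g2 x).
Proof.
move=> [m1 [M1 b1] h1] [m2 [M2 b2] h2]; split.
- exact: measurable_funD.
- by exists (M1 + M2) => x; apply: le_trans (ler_normD _ _) (lerD _ _).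
- move=> f hf; have [i1 z1] := h1 f hf; have [i2 z2] := h2 f hf.
  rewrite (_ : (fun x => _) = (fun x => (g1 x)%:C * f x + (g2 x)%:C * f x)); last first.
    by apply/funext => x; rewrite rmorphD/= mulrDl.
  split; first exact: cintegrableD.
  by move=> k; rewrite fourierD// z1 z2 addr0.
Qed.

Lemma fmultM g1 g2 : fmult g1 -> fmult g2 -> fmult (fun x => g1 x * g2 x).
Proof.
move=> [m1 [M1 b1] h1] [m2 [M2 b2] h2]; split.
- exact: measurable_funM.
- by exists (M1 * M2) => x; rewrite normrM ler_pM.
- move=> f hf; rewrite (_ : (fun x => _) = (fun x => (g1 x)%:C * ((g2 x)%:C * f x))).
    by apply: h1; exact: h2.
  by apply/funext => x; rewrite rmorphM/= mulrA.
Qed.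

Lemma fmultX g n : fmult g -> fmult (fun x => g x ^+ n).
Proof.
move=> hg; elim: n => [|n IH]; first by under eq_fun do rewrite expr0; exact: fmult_cst.
by under eq_fun do rewrite exprS; exact: fmultM.
Qed.

Lemma fmult_ae g g' (M : R) : fmult g -> measurable_fun setT g' ->
  (forall x, `|g' x| <= M) -> {ae mu, forall x, g x = g' x} -> fmult g'.
Proof.
move=> [mg [M1 b1] h1] mg' b' gg'; split => //; first by exists M.
move=> f [hf f0]; have [i1 z1] := h1 f (conj hf f0).
split; first exact: (fnull_bdM _ b').
move=> k; rewrite -(z1 k) !fourierE; apply: ae_eq_cint.
- by apply: (cintegrable_expo _ _).1; exact: (fnull_bdM _ b').
- by apply: (cintegrable_expo _ _).1.
- by apply: filterS gg' => x ->.
Qed.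

Lemma fmult_lim (g_ : nat -> TT -> R) g (M : R) : (forall n, fmult (g_ n)) ->
  measurable_fun setT g -> (forall n x, `|g_ n x| <= M) ->
  (forall x, (fun n => g_ n x) @ \oo --> g x) -> fmult g.
Proof.
move=> hg mg gM gc.
have bg x : `|g x| <= M.
  rewrite ler_norml; apply/andP; split.
    apply: ler_cvg_to (cvg_cst (- M)) (gc x) _.
    by apply: nearW => n; have := gM n x; rewrite ler_norml => /andP[].
  apply: ler_cvg_to (gc x) (cvg_cst M) _.
  by apply: nearW => n; have := gM n x; rewrite ler_norml => /andP[].
split => //; first by exists M.
move=> f [hf f0]; have hgf := fnull_bdM mg bg hf.
split => // k; rewrite fourierE.
have mk : cmeas (fun x => f x * expo (- k) x) := (cintegrable_expo (- k) hf).1.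
have cR (u : nat -> R) (l : R) (z : C) : u @ \oo --> l ->
    (fun n => complex.Re ((u n)%:C * z)) @ \oo --> complex.Re (l%:C * z).
  move=> ul; under eq_fun do rewrite RecM /= mul0r subr0.
  by rewrite RecM /= mul0r subr0; apply: cvgM => //; exact: cvg_cst.
have cI (u : nat -> R) (l : R) (z : C) : u @ \oo --> l ->
    (fun n => complex.Im ((u n)%:C * z)) @ \oo --> complex.Im (l%:C * z).
  move=> ul; under eq_fun do rewrite ImcM /= mul0r addr0.
  by rewrite ImcM /= mul0r addr0; apply: cvgM => //; exact: cvg_cst.
have mm : measurable_fun setT (fun x => `|M| * cnorm (f x)).
  by apply: measurable_funM => //; apply: measurable_cnorm; exact: hf.1.
apply: (@cint_dominated _ _ _ mu (fun n x => (g_ n x)%:C * f x * expo (- k) x)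
   _ (fun x => `|M| * cnorm (f x))).
- move=> n; have [m1 [M1 b1] _] := hg n.
  by apply: (cintegrable_expo _ _).1; exact: fnull_bdM b1 hf.
- by apply: (cintegrable_expo _ _).1.
- by move=> x; under eq_fun do rewrite -mulrA; rewrite -mulrA; exact: cR.
- by move=> x; under eq_fun do rewrite -mulrA; rewrite -mulrA; exact: cI.
- exact: mm.
- under eq_integral do rewrite EFinM.
  rewrite ge0_integralZl_EFin//.
  + by rewrite lte_mul_pinfty// ?lee_fin//; exact: hf.2.
  + by move=> x _; rewrite lee_fin cnorm_ge0.
  + by apply/measurable_EFinP; apply: measurable_cnorm; exact: hf.1.
- move=> n x; rewrite !cnormM cnorm_expo mulr1 cnormR ler_wpM2r ?cnorm_ge0//.
  exact: le_trans (gM n x) (ler_norm M).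
- move=> n; have [_ _ h] := hg n; have [_ z] := h f (conj hf f0).
  by have := z k; rewrite fourierE.
Qed.

(** Multiplication by a character shifts the Fourier coefficients. *)
Lemma fmult_cos (k : freq) (c : R) :
  fmult (fun x => cos (k.1%:~R * x.1 + k.2%:~R * x.2 - c)).
Proof.
have mc : measurable_fun setT (fun x : TT => cos (k.1%:~R * x.1 + k.2%:~R * x.2 - c)).
  apply: (measurableT_comp (continuous_measurable_fun (@continuous_cos R))).
  by apply: measurable_funB => //; apply: measurable_funD; apply: measurable_funM.
have bc x : `|cos (k.1%:~R * x.1 + k.2%:~R * x.2 - c)| <= (1 : R).
  by rewrite ler_norml cos_geN1 cos_le1.
split => //; first by exists 1.
move=> f [hf f0]; split; first exact: (fnull_bdM mc (M := 1)).
have e x : (cos (k.1%:~R * x.1 + k.2%:~R * x.2 - c))%:C * f x =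
    (2^-1 * cis (- c)) * (expo k x * f x) + (2^-1 * cis c) * (expo (- k) x * f x).
  rewrite !mulrA -mulrDl; congr (_ * _).
  rewrite expoN -(@mulrA _ _ (cis (- c))) -(@mulrA _ _ (cis c)) -mulrDr.
  have -> : cis c * conjc (expo k x) = conjc (cis (- c) * expo k x).
    by rewrite conjM conj_cis opprK.
  have -> : cis (- c) * expo k x = cis (k.1%:~R * x.1 + k.2%:~R * x.2 - c).
    by rewrite -cisD addrC.
  set t := _ - c; rewrite (_ : cis t + _ = 2 * (cos t)%:C).
    by rewrite mulrA mulVf ?mul1r// pnatr_eq0.
  by rewrite mulr_natl mulr2n; apply: complex_ext; rewrite ?RecD ?ImcD /= ?subrr ?addr0.
under eq_fun do rewrite e.
have i1 : cintegrable mu (fun x => expo k x * f x).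
  by under eq_fun do rewrite mulrC; exact: cintegrable_expo.
have i2 : cintegrable mu (fun x => expo (- k) x * f x).
  by under eq_fun do rewrite mulrC; exact: cintegrable_expo.
move=> j; rewrite fourierD; try exact: cintegrableZ.
by rewrite !fourierZ// !fourier_shift !f0 !mulr0 addr0.
Qed.

(** The indicator function is the limit of the polynomials [step_poly n] of
    [g]. *)
Lemma fmult_lt_half g : fmult g -> (forall x, 0 <= g x <= 1) ->
  fmult (\1_[set x | g x < 2^-1]).
Proof.
move=> hg g01; have [mg _ _] := hg.
have ind x : \1_[set x | g x < 2^-1] x = (if g x < 2^-1 then 1 else 0) :> R.
  rewrite indicE; case: ifPn => h; first by rewrite mem_set.
  by rewrite memNset//=; apply/negP.
apply: (@fmult_lim (fun n x => step_poly n (g x)) _ 1).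
- move=> n; apply: fmultX; apply: fmultD; first exact: fmult_cst.
  under eq_fun do rewrite -mulN1r.
  by apply: fmultM; [exact: fmult_cst|exact: fmultX].
- apply: measurable_indic; rewrite -[X in measurable X]setTI.
  rewrite (_ : [set x | _] = g @^-1` `]-oo, 2^-1[); first exact: mg.
  by apply/seteqP; split => x /=; rewrite in_itv.
- by move=> n x; have /andP[a b] := step_poly01 n (g01 x); rewrite ger0_norm.
- by move=> x; rewrite ind; exact: cvg_step_poly.
Qed.

Definition fset_ok (A : set TT) := measurable A /\ fmult (\1_A).

Lemma fset_ok_sigma : sigma_algebra setT fset_ok.
Proof.
have okC A : fset_ok A -> fset_ok (~` A).
  move=> [mA hA]; split; first exact: measurableC.
  rewrite (_ : \1_(~` A) = fun x => 1 + (-1) * \1_A x).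
    by apply: fmultD; [exact: fmult_cst|apply: fmultM => //; exact: fmult_cst].
  by apply/funext => x; rewrite !indicE in_setC; case: (x \in A); rewrite /= ?mulr1 ?subrr ?mulr0 ?addr0.
have okI A B : fset_ok A -> fset_ok B -> fset_ok (A `&` B).
  move=> [mA hA] [mB hB]; split; first exact: measurableI.
  rewrite (_ : \1_(A `&` B) = fun x => \1_A x * \1_B x); first exact: fmultM.
  by apply/funext => x; rewrite !indicE in_setI; case: (x \in A); case: (x \in B);
    rewrite /= ?mulr1 ?mulr0 ?mul0r.
have ok0 : fset_ok set0.
  split; first exact: measurable0.
  rewrite (_ : \1_set0 = fun=> 0); first exact: fmult_cst.
  by apply/funext => x; rewrite indicE in_set0.
have okU A B : fset_ok A -> fset_ok B -> fset_ok (A `|` B).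
  by move=> hA hB; rewrite -[A]setCK -[B]setCK -setCI; apply/okC/okI; exact: okC.
split => //.
- by move=> A hA; rewrite setTD; exact: okC.
- move=> A hA.
  have hU n : fset_ok (\big[setU/set0]_(i < n) A i).
    elim: n => [|n IH]; first by rewrite big_ord0.
    by rewrite big_ord_recr/=; exact: okU.
  have mU : measurable (\bigcup_k A k) by apply: bigcupT_measurable => k; exact: (hA k).1.
  split => //.
  apply: (@fmult_lim (fun n => \1_(\big[setU/set0]_(i < n) A i)) _ 1).
  + by move=> n; exact: (hU n).2.
  + exact: measurable_indic.
  + by move=> n x; rewrite indicE; case: (_ \in _); rewrite ?normr1 ?normr0.
  + move=> x; have [[k _ Akx]|nAx] := pselect ((\bigcup_k A k) x).
      apply: cvg_near_cst; near=> n; rewrite !indicE !mem_set//; first by exists k.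
      by rewrite -bigcup_mkord; exists k => //=; near: n; exact: nbhs_infty_gt.
    apply: cvg_near_cst; apply: nearW => n; rewrite !indicE !memNset//.
    by rewrite -bigcup_mkord => -[k _ Akx]; apply: nAx; exists k.
Unshelve. all: by end_near.
Qed.

Lemma ae_circle : {ae circle, forall t : R, 0 < t < 2 * pi}.
Proof.
have /null_content_dominatesP dom := dominates_uniform_prob (@two_pi_gt0 R).
have null1 (t : R) : circle.-negligible [set t].
  exists [set t]; split => //.
  by apply: dom; [exact: measurable_set1|exact: lebesgue_measure_set1].
have n0 := null1 0; have n1 := null1 (2 * pi).
have n2 : circle.-negligible (~` `[0, 2 * pi]).
  exists (~` `[0, 2 * pi]); split => //; first exact: measurableC.
  by rewrite /uniform_prob integral_uniform_pdf setICl integral_set0.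
apply: negligibleS (negligibleU (negligibleU n0 n1) n2) => t /= ht.
have [h|h] := pselect (0 <= t <= 2 * pi); last by right; rewrite /= in_itv.
left; move/negP: ht; rewrite negb_and -!leNgt => /orP[h'|h'].
- by left; apply/eqP; rewrite eq_le h' ; case/andP: h.
- by right; apply/eqP; rewrite eq_le h' andbT; case/andP: h.
Qed.

(** The boundary of the square must be removed, because [cos_half_lt] fails
    there. *)
Lemma ae_torus : {ae mu, forall x : TT, 0 < x.1 < 2 * pi /\ 0 < x.2 < 2 * pi}.
Proof.
have [N [mN N0 hN]] := ae_circle.
have m1 : mu (N `*` setT) = 0%E.
  transitivity (circle N * circle setT)%E; first exact: product_measure1E.
  by rewrite N0 mul0e.
have m2 : mu (setT `*` N) = 0%E.
  transitivity (circle setT * circle N)%E; first exact: product_measure1E.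
  by rewrite N0 mule0.
exists (N `*` setT `|` setT `*` N); split.
- by apply: measurableU; exact: measurableX.
- by apply: null_set_setU => //; exact: measurableX.
- move=> x /=; rewrite not_andE => -[h|h]; [left|right]; split => //; exact: hN.
Qed.

(** The difference [cos (x - q/2) - cos (q/2)] equals [2 sin (x/2) sin ((q -
    x)/2)], and on [(0, 2 pi)] its sign is that of [q - x]. Thus half-spaces
    are cut out by trigonometric polynomials, up to a null set. *)
Lemma cos_half_lt (q x : R) : 0 < q < 2 * pi -> 0 < x < 2 * pi ->
  (cos (q / 2) < cos (x - q / 2)) = (x < q).
Proof.
move=> /andP[q0 q2] /andP[x0 x2].
have e : cos (x - q / 2) - cos (q / 2) = 2 * sin (x / 2) * sin ((q - x) / 2).
  rewrite (_ : x - q / 2 = x / 2 - (q - x) / 2); last by lra.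
  rewrite (_ : q / 2 = x / 2 + (q - x) / 2); last by lra.
  by rewrite cosB cosD; ring.
have s0 : 0 < sin (x / 2) by apply: sin_gt0_pi; apply/andP; split; lra.
rewrite -subr_gt0 e pmulr_rgt0; last by rewrite mulr_gt0.
case: (ltrgtP x q) => h.
- by apply: sin_gt0_pi; apply/andP; split; lra.
- apply/negbTE; rewrite -leNgt -oppr_ge0 -sinN ltW//.
  by apply: sin_gt0_pi; apply/andP; split; lra.
- by rewrite h subrr mul0r sin0 ltxx.
Qed.

Lemma fset_ok_ae A (B : set TT) : measurable A -> fset_ok B ->
  {ae mu, forall x, B x <-> A x} -> fset_ok A.
Proof.
move=> mA [mB hB] AB; split => //; apply: (@fmult_ae _ _ 1 hB).
- exact: measurable_indic.
- by move=> x; rewrite indicE; case: (_ \in _); rewrite ?normr1 ?normr0.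
- apply: filterS AB => x BA; rewrite !indicE.
  suff -> : (x \in B) = (x \in A) by [].
  by apply/idP/idP; rewrite !inE => /BA.
Qed.

(** The hypothesis makes [k] one of the two coordinate frequencies; both
    coordinates are treated at once. *)
Lemma fset_ok_ray (k : freq) (q : R) :
  (forall x : TT, k.1%:~R * x.1 + k.2%:~R * x.2 = x.1) \/
  (forall x : TT, k.1%:~R * x.1 + k.2%:~R * x.2 = x.2) ->
  fset_ok [set x | k.1%:~R * x.1 + k.2%:~R * x.2 < q].
Proof.
move=> hk; set l := fun x : TT => k.1%:~R * x.1 + k.2%:~R * x.2.
have ml : measurable_fun setT l.
  by apply: measurable_funD; apply: measurable_funM.
have mray (v : R) : measurable [set x | l x < v].
  rewrite -[X in measurable X]setTI (_ : [set x | _] = l @^-1` `]-oo, v[); first exact: ml.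
  by apply/seteqP; split => x /=; rewrite in_itv.
have ael : {ae mu, forall x, 0 < l x < 2 * pi}.
  by apply: filterS ae_torus => x [h1 h2]; case: hk => hk; rewrite /l hk.
have [sT0 sTC sTU] := fset_ok_sigma.
have [q0|q0] := leP q 0.
  apply: (@fset_ok_ae _ set0 (mray q)) => //; apply: filterS ael => x /andP[h _].
  split => //= h'; have := lt_le_trans h' q0; have := h; rewrite /l; lra.
have [q2|q2] := leP (2 * pi) q.
  apply: (@fset_ok_ae _ setT (mray q)) => //.
    by rewrite -[setT]setD0; exact: sTC.
  apply: filterS ael => x /andP[_ h]; split => //= _; exact: lt_le_trans q2.
(* An affine image of the cosine with values in [[0, 1]], which is below 1/2
   exactly where [l x < q]. *)
pose g (x : TT) := 2^-1 + (- 4^-1) * (cos (l x - q / 2) - cos (q / 2)).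
have hg : fmult g.
  apply: fmultD; first exact: fmult_cst.
  apply: fmultM; first exact: fmult_cst.
  by apply: fmultD; [exact: fmult_cos|exact: fmult_cst].
have g01 x : 0 <= g x <= 1.
  have := cos_le1 (l x - q / 2); have := cos_geN1 (l x - q / 2).
  have := cos_le1 (q / 2); have := cos_geN1 (q / 2); rewrite /g.
  by move=> *; apply/andP; split; lra.
have [mg _ _] := hg.
apply: (@fset_ok_ae _ [set x | g x < 2^-1] (mray q)).
  split; last exact: fmult_lt_half.
  rewrite -[X in measurable X]setTI (_ : [set x | _] = g @^-1` `]-oo, 2^-1[); first exact: mg.
  by apply/seteqP; split => x /=; rewrite in_itv.
apply: filterS ael => x hx /=.
have h : (l x < q) = (g x < 2^-1).
  have hq : 0 < q < 2 * pi by rewrite q0.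
  by rewrite -(cos_half_lt hq hx) /g; apply/idP/idP; lra.
by rewrite -/(l x) h.
Qed.

Lemma fset_ok_measurable (A : set TT) : measurable A -> fset_ok A.
Proof.
move=> mA.
have gen (p : TT -> R) : (forall q, fset_ok [set x | p x < q]) ->
    forall B : set (measurableTypeR R), measurable B -> fset_ok (p @^-1` B).
  move=> hp.
  suff h : <<s @RGenInftyO.G R >> `<=` [set B : set R | fset_ok (p @^-1` B)].
    by move=> B mB; apply: h; move: mB; rewrite RGenInftyO.measurableE.
  apply: smallest_sub.
    have [s0 sC sU] := fset_ok_sigma; split => //.
    + by move=> B' hB'; exact: (sC _ hB').
    + by move=> F hF; rewrite /= preimage_bigcup; exact: sU.
  by move=> _ [q ->]; have := hp q; congr fset_ok; apply/seteqP; split => x /=; rewrite in_itv.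
apply: (smallest_sub fset_ok_sigma _ mA) => _ [[B mB <-]|[B mB <-]]; rewrite setTI.
- apply: (gen fst) => // q.
  have := @fset_ok_ray (1, 0) q; rewrite /=.
  have e x : 1%:~R * x.1 + 0%:~R * x.2 = x.1 :> R by rewrite mul1r mul0r addr0.
  by move=> /(_ (or_introl e)); congr fset_ok; apply/seteqP; split => x /=; rewrite e.
- apply: (gen snd) => // q.
  have := @fset_ok_ray (0, 1) q; rewrite /=.
  have e x : 0%:~R * x.1 + 1%:~R * x.2 = x.2 :> R by rewrite mul1r mul0r add0r.
  by move=> /(_ (or_intror e)); congr fset_ok; apply/seteqP; split => x /=; rewrite e.
Qed.

(** By [fset_ok_measurable] the integral of [f] over every Borel set
    vanishes. *)
Theorem fourier_unique f : cintegrable mu f -> (forall k : freq, fourier f k = 0) ->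
  {ae mu, forall x, f x = 0}.
Proof.
move=> hf f0.
have h A : measurable A -> cint mu (fun x => (\1_A x)%:C * f x) = 0.
  move=> /fset_ok_measurable[_ [_ _ h]]; have [_ /(_ 0)] := h f (conj hf f0).
  rewrite fourierE => <-; congr cint; apply/funext => x.
  by rewrite oppr0 expo0 mulr1.
have h2 (p : TT -> R) : mu.-integrable setT (EFin \o p) ->
    (forall A, measurable A -> Rintegral mu setT (fun x => \1_A x * p x) = 0) ->
    {ae mu, forall x, p x = 0}.
  move=> ip hp.
  have : ae_eq mu setT (EFin \o p) (cst 0%E).
    apply: integral_ae_eq => //.
    move=> E _ mE; rewrite integral0 integral_mkcond.
    rewrite (eq_integral (fun x => (\1_E x * p x)%:E)); last first.
      by move=> x _; rewrite patchE indicE; case: ifPn; rewrite ?mul1r ?mul0r.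
    rewrite -[LHS]fineK; first by have := hp E mE; rewrite /Rintegral => ->.
    apply: integrable_fin_num => //.
    rewrite (_ : (fun x => _) = (EFin \o p) \_ E).
      by apply/(integrable_mkcond (EFin \o p) mE); apply: (integrableS measurableT mE (@subsetT _ E) ip).
    by apply/funext => x; rewrite patchE indicE; case: ifPn; rewrite ?mul1r ?mul0r.
  by apply: filterS => x /(_ I) [].
have r0 : {ae mu, forall x, complex.Re (f x) = 0}.
  apply: h2; first exact: cintegrable_Re.
  move=> A /h/(congr1 (@complex.Re _)) /= e; apply: etrans e; congr Rintegral.
  by apply/funext => x; rewrite RecM /= mul0r subr0.
have i0 : {ae mu, forall x, complex.Im (f x) = 0}.
  apply: h2; first exact: cintegrable_Im.
  move=> A /h/(congr1 (@complex.Im _)) /= e; apply: etrans e; congr Rintegral.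
  by apply/funext => x; rewrite ImcM /= mul0r addr0.
by apply: filterS2 r0 i0 => x a b; exact: complex_ext.
Qed.

End Uniqueness.

(** * The ring of Fourier series of class H^{3/2} *)

Section Sequences.
Context {R : realType}.
Local Notation C := R[i].
Local Notation nu := (@freq_counting R).
Implicit Types (a b : freq -> C) (f g x : freq -> R) (A B : R).

(** The weight [jb ^ {3/2}] of the Sobolev space [H^{3/2}]. *)
Definition wH (k : freq) : R := jb k * Num.sqrt (jb k).

Lemma wH_ge1 k : 1 <= wH k.
Proof.
have h := @jb_ge1 R k; rewrite /wH -[1]mulr1 ler_pM//.
by rewrite -sqrtr1 ler_wsqrtr.
Qed.

Lemma wH_gt0 k : 0 < wH k. Proof. exact: lt_le_trans ltr01 (wH_ge1 k). Qed.
Lemma wH_ge0 k : 0 <= wH k. Proof. exact: ltW (wH_gt0 k). Qed.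

Lemma sqr_wH k : wH k ^+ 2 = jb k ^+ 3.
Proof. by rewrite exprMn [Num.sqrt (jb k) ^+ 2]sqr_sqrtr ?jb_ge0//; ring. Qed.

Lemma wHN k : wH (- k) = wH k.
Proof. by rewrite /wH jbN. Qed.

(** The larger of the two brackets carries the sum. *)
Lemma wHD k m : wH (k + m) <= 3 * (wH k + wH m).
Proof.
wlog mk : k m / jb m <= jb k :> R => [hw|].
  have [/hw//|/ltW/hw] := leP (jb m : R) (jb k).
  by rewrite addrC [wH m + _]addrC.
have h : jb (k + m) <= 2 * jb k :> R by have := @jbD R k m; lra.
have hs : Num.sqrt (jb (k + m)) <= (3 / 2) * Num.sqrt (jb k) :> R.
  rewrite -(@ler_pXn2r _ 2)// ?nnegrE ?mulr_ge0 ?sqrtr_ge0//.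
  rewrite exprMn !sqr_sqrtr ?jb_ge0//; have := @jb_ge0 R k; nra.
have -> : 3 * (wH k + wH m) = (2 * jb k) * ((3 / 2) * Num.sqrt (jb k)) + 3 * wH m.
  by rewrite /wH; field.
apply: ler_wpDr; first by rewrite mulr_ge0 ?wH_ge0.
by rewrite {1}/wH; apply: ler_pM; rewrite ?jb_ge0 ?sqrtr_ge0.
Qed.

Definition nrm2 f : R := Num.sqrt (fine (\int[nu]_k (f k ^+ 2)%:E)).

Lemma sum_sqr_ge0 f : (0 <= \int[nu]_k (f k ^+ 2)%:E)%E.
Proof. by apply: sum_ge0 => k; rewrite lee_fin sqr_ge0. Qed.

Lemma nrm2P f A : l2le f A -> l2le f (nrm2 f).
Proof.
move=> [A0 fA]; split; first exact: sqrtr_ge0.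
have fin : (\int[nu]_k (f k ^+ 2)%:E)%E \is a fin_num.
  by rewrite ge0_fin_numE ?sum_sqr_ge0//; exact: le_lt_trans fA (ltry _).
by rewrite sqr_sqrtr ?fine_ge0 ?sum_sqr_ge0// fineK.
Qed.

Lemma nrm2_le f A : l2le f A -> nrm2 f <= A.
Proof.
move=> [A0 fA]; rewrite -[leRHS]ger0_norm// -sqrtr_sqr ler_wsqrtr//.
rewrite -lee_fin fineK// ge0_fin_numE ?sum_sqr_ge0//; exact: le_lt_trans fA (ltry _).
Qed.

Definition habs a k : R := wH k * cnorm (a k).

Lemma habs_ge0 a k : 0 <= habs a k.
Proof. by rewrite mulr_ge0 ?wH_ge0 ?cnorm_ge0. Qed.

Definition Hfin a : Prop := exists A, l2le (habs a) A.

Lemma HfinP a : Hfin a <-> (\int[nu]_k (habs a k ^+ 2)%:E < +oo)%E.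
Proof.
split=> [[A [_ h]]|h]; first exact: le_lt_trans h (ltry _).
exists (nrm2 (habs a)); split; first exact: sqrtr_ge0.
rewrite sqr_sqrtr ?fine_ge0 ?sum_sqr_ge0// fineK//.
by rewrite ge0_fin_numE ?sum_sqr_ge0.
Qed.

Lemma cnorm_le_habs a k : cnorm (a k) <= habs a k.
Proof. by rewrite /habs ler_peMl ?cnorm_ge0// wH_ge1. Qed.

Lemma Hfin_l2 a A : l2le (habs a) A -> l2le (fun k => cnorm (a k)) A.
Proof. by apply: l2le_mono => // k; rewrite cnorm_ge0 cnorm_le_habs. Qed.

(** The space dimension is 2 and 3/2 > 1: the inverse weights are square
    summable by [sum_jb3]. *)
Lemma Hfin_l1 : exists2 C1, 1 <= C1 & forall a A,
  l2le (habs a) A -> l1le (fun k => cnorm (a k)) (C1 * A).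
Proof.
have [M M0 hM] := @sum_jb3 R.
exists (1 + Num.sqrt M); first by rewrite lerDl sqrtr_ge0.
move=> a A hA; have A0 := hA.1.
split; first by rewrite mulr_ge0// addr_ge0// sqrtr_ge0.
apply: (@le_trans _ _ (Num.sqrt M * A)%:E); last first.
  by rewrite lee_fin ler_wpM2r// lerDr.
have hw : l2le (fun k => (wH k)^-1) (Num.sqrt M).
  split; first exact: sqrtr_ge0.
  rewrite sqr_sqrtr//; apply: le_trans hM; apply: le_sum => k.
    by rewrite lee_fin sqr_ge0.
  by rewrite !exprVn sqr_wH.
have := sum_CS _ (habs_ge0 a) hw hA; move=> /(_ _)/wrap[k|]; first by rewrite invr_ge0 wH_ge0.
apply: le_trans; apply: le_sum => k; rewrite lee_fin ?cnorm_ge0//.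
by rewrite /habs mulKf// gt_eqF// wH_gt0.
Qed.

Lemma nconv_fin f g A B k : (forall k, 0 <= f k) -> (forall k, 0 <= g k) ->
  l2le f A -> l2le g B -> (nconv f g k <= (A * B)%:E)%E.
Proof.
move=> f0 g0 lf lg; rewrite /nconv; apply: (sum_CS (f := fun m => f (k - m))) => //.
case: lf => A0 h; split => //; apply: le_trans h.
rewrite -[leRHS](sum_reindex (subl_bij k)); last by move=> m; rewrite lee_fin sqr_ge0.
by apply: le_sum => m; rewrite lee_fin ?sqr_ge0.
Qed.

Definition cconv a b (k : freq) : C := cint nu (fun m => a (k - m) * b m).

Lemma cconv_integrable a b A B k : l2le (habs a) A -> l2le (habs b) B ->
  cintegrable nu (fun m => a (k - m) * b m).
Proof.
move=> /Hfin_l2 ha /Hfin_l2 hb; split => //.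
apply: le_lt_trans (ltry (A * B)).
apply: le_trans (nconv_fin k _ _ ha hb); try by move=> ?; rewrite cnorm_ge0.
by apply: le_sum => m; rewrite lee_fin ?cnorm_ge0// cnormM.
Qed.

Lemma cnorm_cconv a b A B k : l2le (habs a) A -> l2le (habs b) B ->
  ((cnorm (cconv a b k))%:E <=
    nconv (fun m => cnorm (a m)) (fun m => cnorm (b m)) k)%E.
Proof.
move=> ha hb; apply: le_trans (cnorm_cint_le (cconv_integrable k ha hb)) _.
by apply: le_sum => m; rewrite lee_fin ?cnorm_ge0// cnormM.
Qed.

Lemma l1_cconv a b A B P Q : l2le (habs a) P -> l2le (habs b) Q ->
  l1le (fun k => cnorm (a k)) A -> l1le (fun k => cnorm (b k)) B ->
  l1le (fun k => cnorm (cconv a b k)) (A * B).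
Proof.
move=> ha hb la lb; split; first by rewrite mulr_ge0 ?la.1 ?lb.1.
apply: le_trans (nconv_l1 _ _ la lb); try by move=> ?; rewrite cnorm_ge0.
by apply: le_sum => k; rewrite ?lee_fin ?cnorm_ge0//; exact: cnorm_cconv ha hb.
Qed.

Lemma l2_cconv a b A B P Q : l2le (habs a) P -> l2le (habs b) Q ->
  l1le (fun k => cnorm (a k)) A -> l2le (fun k => cnorm (b k)) B ->
  l2le (fun k => cnorm (cconv a b k)) (A * B).
Proof.
move=> ha hb la lb.
apply: (nconv_l2 _ _ la lb); try by move=> ?; rewrite cnorm_ge0.
by move=> k; rewrite cnorm_ge0; split => //; exact: cnorm_cconv ha hb.
Qed.

(** The tame product estimate: [wHD] moves the weight onto one factor, and
    the other one is measured by the sum of its coefficients. The bound is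
    linear in the two [H^{3/2}] norms, which is what makes the growth of the
    numerical solution geometric. *)
Lemma H_cconv a b A B P Q : l2le (habs a) P -> l2le (habs b) Q ->
  l1le (fun k => cnorm (a k)) A -> l1le (fun k => cnorm (b k)) B ->
  l2le (habs (cconv a b)) (3 * (A * Q + B * P)).
Proof.
move=> ha hb la lb.
have c0 (u : freq -> C) k : 0 <= cnorm (u k) by exact: cnorm_ge0.
pose y1 k := fine (nconv (fun m => cnorm (a m)) (habs b) k).
pose y2 k := fine (nconv (fun m => cnorm (b m)) (habs a) k).
have fin1 k : nconv (fun m => cnorm (a m)) (habs b) k \is a fin_num.
  rewrite ge0_fin_numE; last exact: nconv_ge0 (c0 a) (habs_ge0 b).
  exact: le_lt_trans (nconv_fin k (c0 a) (habs_ge0 b) (Hfin_l2 ha) hb) (ltry _).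
have fin2 k : nconv (fun m => cnorm (b m)) (habs a) k \is a fin_num.
  rewrite ge0_fin_numE; last exact: nconv_ge0 (c0 b) (habs_ge0 a).
  exact: le_lt_trans (nconv_fin k (c0 b) (habs_ge0 a) (Hfin_l2 hb) ha) (ltry _).
have p1 k : 0 <= y1 k by apply: fine_ge0; exact: nconv_ge0 (c0 a) (habs_ge0 b).
have p2 k : 0 <= y2 k by apply: fine_ge0; exact: nconv_ge0 (c0 b) (habs_ge0 a).
have l1 : l2le y1 (A * Q).
  by apply: (nconv_l2 (c0 a) (habs_ge0 b) la hb) => k; rewrite fineK.
have l2 : l2le y2 (B * P).
  by apply: (nconv_l2 (c0 b) (habs_ge0 a) lb ha) => k; rewrite fineK.
apply: l2le_mono (lexx _) (l2le_scale _ (l2le_add p1 p2 l1 l2)) => // k.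
rewrite habs_ge0 /= -lee_fin [leRHS]EFinM [(_ + y2 k)%:E]EFinD /y1 /y2 !fineK//.
rewrite [nconv (fun m => cnorm (b m)) _]nconvC; [|exact: c0|exact: habs_ge0].
apply: le_trans (_ : ((wH k)%:E * nconv (fun m => cnorm (a m)) (fun m => cnorm (b m)) k <= _)%E).
  by rewrite EFinM; apply: lee_wpmul2l; [rewrite lee_fin wH_ge0|exact: cnorm_cconv ha hb].
rewrite /nconv -sum_scale ?wH_ge0//; last by move=> m; rewrite lee_fin mulr_ge0.
rewrite -sum_add; last 2 first.
- by move=> m; rewrite lee_fin mulr_ge0// habs_ge0.
- by move=> m; rewrite lee_fin mulr_ge0// habs_ge0.
rewrite -sum_scale//; last first.
  by move=> m; rewrite -EFinD lee_fin addr_ge0 // mulr_ge0 ?c0 ?habs_ge0.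
apply: le_sum => m.
  rewrite -EFinM lee_fin; apply: mulr_ge0; first exact: wH_ge0.
  by apply: mulr_ge0; exact: c0.
rewrite -EFinD -!EFinM lee_fin /habs.
have := wHD (k - m) m; rewrite subrK => h.
have h0 : 0 <= cnorm (a (k - m)) * cnorm (b m) by rewrite mulr_ge0.
apply: le_trans (ler_wpM2r h0 h) _.
by rewrite le_eqVlt; apply/orP; left; apply/eqP; ring.
Qed.

End Sequences.

Section SpectralType.
Context {R : realType}.
Local Notation C := R[i].
Local Notation nu := (@freq_counting R).

Definition spec_pred : {pred freq -> C} := fun a => `[< Hfin a >].

Lemma spec_predP a : reflect (Hfin a) (a \in spec_pred).
Proof. exact: asboolP. Qed.

Lemma spec_zmod_closed : zmod_closed spec_pred.
Proof.
split=> [|a b /spec_predP[A hA] /spec_predP[B hB]].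
  apply/spec_predP; exists 0; apply: l2le_mono (lexx _) (@l2le0 R) => k.
  by rewrite habs_ge0 /habs (_ : (0 : freq -> C) k = 0)// cnorm0 mulr0 /=.
apply/spec_predP; exists (A + B).
apply: l2le_mono (lexx _) (l2le_add (habs_ge0 a) (habs_ge0 b) hA hB) => k.
rewrite habs_ge0 /= /habs -mulrDr ler_wpM2l ?wH_ge0//.
exact: cnormB.
Qed.

HB.instance Definition _ := GRing.isZmodClosed.Build (freq -> C) spec_pred
  spec_zmod_closed.

(** Functions of class [H^{3/2}] on the torus, given by their Fourier
    coefficients. *)
Record spec := Spec { spec_val :> freq -> C; specP : spec_val \in spec_pred }.

HB.instance Definition _ := [isSub for spec_val].
HB.instance Definition _ := [Choice of spec by <:].
HB.instance Definition _ := [SubChoice_isSubZmodule of spec by <:].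

Implicit Types a b c : spec.

Lemma spec_ext a b : (forall k, a k = b k) -> a = b.
Proof. by move=> h; apply: val_inj; apply/funext. Qed.

Lemma spec_addE a b k : (a + b) k = a k + b k. Proof. by []. Qed.
Lemma spec_oppE a k : (- a) k = - a k. Proof. by []. Qed.
Lemma spec_subE a b k : (a - b) k = a k - b k. Proof. by []. Qed.
Lemma spec_0E k : (0 : spec) k = 0. Proof. by []. Qed.

(** The norms of [H^{3/2}], of [L^2], and of the Wiener algebra of
    absolutely convergent Fourier series. *)
Definition nH a : R := nrm2 (habs a).
Definition n2 a : R := nrm2 (fun k => cnorm (a k)).
Definition n1 a : R := fine (\int[nu]_k (cnorm (a k))%:E)%E.

Lemma nHP a : l2le (habs a) (nH a).
Proof. by have /spec_predP[A hA] := specP a; exact: nrm2P hA. Qed.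

Lemma n2P a : l2le (fun k => cnorm (a k)) (n2 a).
Proof. exact: nrm2P (Hfin_l2 (nHP a)). Qed.

Lemma n1P a : l1le (fun k => cnorm (a k)) (n1 a).
Proof.
have [C1 _ /(_ _ _ (nHP a)) [_ h]] := @Hfin_l1 R.
have g0 : (0 <= \int[nu]_k (cnorm (a k))%:E)%E by apply: sum_ge0 => k; rewrite lee_fin cnorm_ge0.
split; first exact: fine_ge0.
by rewrite fineK// ge0_fin_numE//; exact: le_lt_trans h (ltry _).
Qed.

Lemma n1_le a A : l1le (fun k => cnorm (a k)) A -> n1 a <= A.
Proof.
move=> [A0 h]; rewrite -lee_fin fineK// ge0_fin_numE.
  exact: le_lt_trans h (ltry _).
by apply: sum_ge0 => k; rewrite lee_fin cnorm_ge0.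
Qed.

Lemma n2_le a A : l2le (fun k => cnorm (a k)) A -> n2 a <= A.
Proof. exact: nrm2_le. Qed.

Lemma nH_le a A : l2le (habs a) A -> nH a <= A.
Proof. exact: nrm2_le. Qed.

Lemma n1_ge0 a : 0 <= n1 a. Proof. exact: (n1P a).1. Qed.
Lemma n2_ge0 a : 0 <= n2 a. Proof. exact: (n2P a).1. Qed.
Lemma nH_ge0 a : 0 <= nH a. Proof. exact: (nHP a).1. Qed.

(** By [Hfin_l1]; the Wiener norm is the one that multiplies, as the
    supremum norm does for functions. *)
Lemma n1_emb : exists2 C1, 1 <= C1 & forall a, n1 a <= C1 * nH a.
Proof.
have [C1 C11 h] := @Hfin_l1 R; exists C1 => // a.
exact: n1_le (h _ _ (nHP a)).
Qed.

Lemma cnorm_le_n1 a k : cnorm (a k) <= n1 a.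
Proof.
have [_ h] := n1P a; rewrite -lee_fin; apply: le_trans h.
by apply: (@le_term_sum R (fun k => (cnorm (a k))%:E)) => m; rewrite lee_fin cnorm_ge0.
Qed.

Lemma n2_le_n1 a : n2 a <= n1 a.
Proof.
apply: n2_le; split; first exact: n1_ge0.
rewrite expr2 EFinM; apply: le_trans (lee_wpmul2l _ (n1P a).2); last by rewrite lee_fin n1_ge0.
rewrite -sum_scale ?n1_ge0//; last by move=> k; rewrite lee_fin cnorm_ge0.
apply: le_sum => k; rewrite ?lee_fin ?sqr_ge0// expr2.
by rewrite ler_wpM2r ?cnorm_ge0// cnorm_le_n1.
Qed.

Lemma n1_mono a b : (forall k, cnorm (a k) <= cnorm (b k)) -> n1 a <= n1 b.
Proof.
move=> h; apply: n1_le; split; first exact: n1_ge0.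
apply: le_trans (n1P b).2; apply: le_sum => k; by rewrite lee_fin ?cnorm_ge0.
Qed.

Lemma n2_mono a b : (forall k, cnorm (a k) <= cnorm (b k)) -> n2 a <= n2 b.
Proof.
move=> h; apply: n2_le; apply: l2le_mono (lexx _) (n2P b) => k.
by rewrite cnorm_ge0 h.
Qed.

Lemma nH_mono a b : (forall k, cnorm (a k) <= cnorm (b k)) -> nH a <= nH b.
Proof.
move=> h; apply: nH_le; apply: l2le_mono (lexx _) (nHP b) => k.
by rewrite habs_ge0 /habs ler_wpM2l ?wH_ge0.
Qed.

Lemma n1D a b : n1 (a + b) <= n1 a + n1 b.
Proof.
apply: n1_le; split; first by rewrite addr_ge0 ?n1_ge0.
rewrite EFinD; apply: le_trans (leeD (n1P a).2 (n1P b).2).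
rewrite -sum_add; try by move=> k; rewrite lee_fin cnorm_ge0.
by apply: le_sum => k; rewrite ?lee_fin ?cnorm_ge0 ?cnormD.
Qed.

Lemma n2D a b : n2 (a + b) <= n2 a + n2 b.
Proof.
apply: n2_le.
apply: l2le_mono (lexx _) (l2le_add _ _ (n2P a) (n2P b)); try by move=> k; rewrite cnorm_ge0.
by move=> k; rewrite cnorm_ge0 cnormD.
Qed.

Lemma nHD a b : nH (a + b) <= nH a + nH b.
Proof.
apply: nH_le.
apply: l2le_mono (lexx _) (l2le_add (habs_ge0 a) (habs_ge0 b) (nHP a) (nHP b)) => k.
by rewrite habs_ge0 /habs -mulrDr ler_wpM2l ?wH_ge0// cnormD.
Qed.

Lemma n1N a : n1 (- a) = n1 a.
Proof. by apply/le_anti/andP; split; apply: n1_mono => k; rewrite spec_oppE cnormN. Qed.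
Lemma n2N a : n2 (- a) = n2 a.
Proof. by apply/le_anti/andP; split; apply: n2_mono => k; rewrite spec_oppE cnormN. Qed.
Lemma nHN a : nH (- a) = nH a.
Proof. by apply/le_anti/andP; split; apply: nH_mono => k; rewrite spec_oppE cnormN. Qed.

Definition spec_mul_subproof a b : cconv a b \in spec_pred.
Proof.
by apply/spec_predP; eexists; exact: H_cconv (nHP a) (nHP b) (n1P a) (n1P b).
Qed.
Definition spec_mul a b : spec := Spec (spec_mul_subproof a b).

Definition spec_delta_subproof (z : C) : (fun k : freq => if k == 0 then z else 0) \in spec_pred.
Proof.
apply/spec_predP/HfinP.
rewrite (@eq_sum R _ (fun k => ((if k == 0 then wH 0 * cnorm z else 0) ^+ 2)%:E)); last first.
  by move=> k; rewrite /habs; case: eqP => [->//|_]; rewrite cnorm0 mulr0.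
rewrite sum_esum; last by move=> k; rewrite lee_fin sqr_ge0.
rewrite (esumID [set 0 : freq]); last by move=> k _; rewrite lee_fin sqr_ge0.
rewrite !setTI esum_set1 ?lee_fin ?sqr_ge0// esum1 ?adde0 ?ltry//.
by move=> k /= /eqP/negbTE ->; rewrite expr0n.
Qed.
Definition spec_cst (z : C) : spec := Spec (spec_delta_subproof z).

Local Notation TT := (measurableTypeR R * measurableTypeR R)%type.
Local Notation mu := (torus_measure R).

(** The series converges absolutely for sequences in [spec], so this is an
    everywhere defined function. *)
Definition synth a : torus_fun R := fun x => cint nu (fun k => a k * expo k x).

Lemma cintegrable_synth a x : cintegrable nu (fun k => a k * expo k x).
Proof.
split => //; apply: le_lt_trans (ltry (n1 a)).
apply: le_trans (n1P a).2; apply: le_sum => k; rewrite lee_fin ?cnorm_ge0//.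
by rewrite cnormM cnorm_expo mulr1.
Qed.

Lemma cnorm_synth a x : cnorm (synth a x) <= n1 a.
Proof.
rewrite -lee_fin; apply: le_trans (cnorm_cint_le (cintegrable_synth a x)) _.
apply: le_trans (n1P a).2; apply: le_sum => k; rewrite lee_fin ?cnorm_ge0//.
by rewrite cnormM cnorm_expo mulr1.
Qed.

(** Convolution of sequences is multiplication of functions. Through the
    injectivity of [synth] it also gives the ring axioms of [spec], which
    would be tedious to check on sequences. *)
Lemma synthM a b x : synth (spec_mul a b) x = synth a x * synth b x.
Proof.
pose F (z : freq * freq) : C := a (z.1 - z.2) * b z.2 * expo z.1 x.
have nF k m : cnorm (F (k, m)) = cnorm (a (k - m)) * cnorm (b m).
  by rewrite /F /= !cnormM cnorm_expo mulr1.
have iF : cintegrable (nu \x nu)%E F.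
  apply: cintegrable_prod; first by split; exact: measurable_prod_freq.
  rewrite (@eq_sum R _ (nconv (fun m => cnorm (a m)) (fun m => cnorm (b m)))); last first.
    by move=> k; apply: eq_sum => m; rewrite nF.
  apply: le_lt_trans (ltry (n1 a * n1 b)).
  by apply: nconv_l1 (n1P a) (n1P b) => k; exact: cnorm_ge0.
have i2 k : cintegrable nu (fun m => F (k, m)).
  have := cintegrableZ (expo k x) (cconv_integrable k (nHP a) (nHP b)).
  by congr cintegrable; apply/funext => m; rewrite mulrC.
have e1 m : (fun k => F (k, m)) = (fun k => (b m * expo m x) * (a (k - m) * expo (k - m) x)).
  apply/funext => k; rewrite /F /=.
  have -> : expo k x = expo (k - m) x * expo m x by rewrite -expoD subrK.
  by ring.
have ish m : cintegrable nu (fun k => a (k - m) * expo (k - m) x).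
  split => //; rewrite (@sum_reindex R (fun k => k - m) (fun k => (cnorm (a k * expo k x))%:E)).
  - exact: (cintegrable_synth a x).2.
  - exact: subr_bij.
  - by move=> k; rewrite lee_fin cnorm_ge0.
have i1 m : cintegrable nu (fun k => F (k, m)).
  by rewrite e1; exact: cintegrableZ.
have [h1 h2] := cint_Fubini iF i2 i1.
transitivity (cint nu (fun k => cint nu (fun m => F (k, m)))).
  congr cint; apply/funext => k.
  rewrite /= /cconv mulrC -cintZ; last exact: cconv_integrable (nHP a) (nHP b).
  by congr cint; apply/funext => m; rewrite /F mulrC.
rewrite h1 -h2.
transitivity (cint nu (fun m => synth a x * (b m * expo m x))).
  congr cint; apply/funext => m; rewrite e1 cintZ//.
  rewrite (@csum_reindex R (fun k => k - m) (fun k => a k * expo k x) (subr_bij m)).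
  by rewrite mulrC.
by rewrite cintZ//; exact: cintegrable_synth.
Qed.

Lemma synthD a b x : synth (a + b) x = synth a x + synth b x.
Proof.
rewrite /synth -cintD; try exact: cintegrable_synth.
by congr cint; apply/funext => k; rewrite spec_addE mulrDl.
Qed.

Lemma synth_cst z x : synth (spec_cst z) x = z.
Proof.
rewrite /synth (@csum_delta R _ 0).
  by rewrite /= ?eqxx expo0 mulr1.
by move=> k /negbTE /= ->; rewrite mul0r.
Qed.

Lemma cintegrable_synth_prod (f : TT -> C) (M : R) a : cmeas f ->
  (forall x, cnorm (f x) <= M) ->
  cintegrable (mu \x nu)%E (fun z : TT * freq => f z.1 * (a z.2 * expo z.2 z.1)).
Proof.
move=> mf fM.
have h k : cmeas (fun x : TT => f x * (a k * expo k x)).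
  by apply: cmeasM => //; apply: cmeasM; [exact: cmeas_cst|exact: cmeas_expo].
apply: cintegrable_prod.
  by split; apply: measurable_prod_freq => k; [exact: (h k).1|exact: (h k).2].
apply: (@le_lt_trans _ _ (\int[mu]_x (cst (`|M| * n1 a)%:E x))%E); last first.
  by rewrite integral_cst// (_ : _ [set: _] = 1%E) ?mule1 ?ltry//; exact: torus_measureT.
have g0 x : (0 <= \int[nu]_k (cnorm (f x * (a k * expo k x)))%:E)%E.
  by apply: sum_ge0 => k; rewrite lee_fin cnorm_ge0.
have le_g x : (\int[nu]_k (cnorm (f x * (a k * expo k x)))%:E <= (`|M| * n1 a)%:E)%E.
  rewrite EFinM; apply: le_trans (lee_wpmul2l _ (n1P a).2); last by rewrite lee_fin.
  rewrite -sum_scale//; last by move=> k; rewrite lee_fin cnorm_ge0.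
  apply: le_sum => k; rewrite ?lee_fin ?cnorm_ge0//.
  rewrite !cnormM cnorm_expo mulr1 ler_wpM2r ?cnorm_ge0//.
  exact: le_trans (fM x) (ler_norm M).
have mF : measurable_fun setT (fun z : TT * freq => (cnorm (f z.1 * (a z.2 * expo z.2 z.1)))%:E).
  apply/measurable_EFinP; apply: measurable_prod_freq => k; exact: measurable_cnorm (h k).
apply: ge0_le_integral => //.
- by move=> x _; exact: g0.
- have := @measurable_fun_fubini_tonelli_F _ _ _ _ R nu _ mF; apply.
  by move=> z; rewrite lee_fin cnorm_ge0.
- by move=> x _; exact: le_g.
Qed.

Lemma cmeas_synth a : cmeas (synth a).
Proof.
have iF := @cintegrable_synth_prod (fun=> 1) 1 a (cmeas_cst 1).
have e x : (fun k => 1 * (a k * expo k x)) = (fun k => a k * expo k x).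
  by apply/funext => k; rewrite mul1r.
have := cmeas_cint (iF _); move=> /(_ _)/wrap[x|]; first by rewrite cnorm1.
move=> /(_ _)/wrap[x /=|]; first by rewrite e; exact: cintegrable_synth.
by congr cmeas; apply/funext => x /=; rewrite e.
Qed.

(** Summation and integration are exchanged by Fubini's theorem, and the
    characters are orthogonal. *)
Lemma fourier_synth a (j : freq) : fourier (synth a) j = a j.
Proof.
rewrite fourierE.
pose F (z : TT * freq) : C := expo (- j) z.1 * (a z.2 * expo z.2 z.1).
have iF : cintegrable (mu \x nu)%E F.
  apply: (@cintegrable_synth_prod _ 1); first exact: cmeas_expo.
  by move=> x; rewrite cnorm_expo.
have i2 x : cintegrable nu (fun k => F (x, k)).
  exact: (cintegrableZ (expo (- j) x) (cintegrable_synth a x)).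
have i1 k : cintegrable mu (fun x => F (x, k)).
  apply: (@cintegrable_bounded _ _ (cnorm (a k))).
    exact: (cmeasM (cmeas_expo (- j)) (cmeasM (cmeas_cst (a k)) (cmeas_expo k))).
  by move=> x; rewrite /F /= !cnormM !cnorm_expo mul1r mulr1.
have [h1 h2] := cint_Fubini iF i2 i1.
transitivity (cint mu (fun x => cint nu (fun k => F (x, k)))).
  congr cint; apply/funext => x.
  rewrite mulrC /synth -cintZ//; exact: cintegrable_synth.
rewrite h1 -h2.
have e k : cint mu (fun x => F (x, k)) = if k == j then a k else 0.
  transitivity (a k * cint mu (expo (k - j))).
    rewrite -cintZ.
      by congr cint; apply/funext => x; rewrite /F /= mulrCA expoD [expo k x * _]mulrC.
    apply: (@cintegrable_bounded _ _ 1); first exact: cmeas_expo.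
    by move=> x; rewrite cnorm_expo.
  by rewrite torus_char subr_eq0; case: ifP; rewrite ?mulr1 ?mulr0.
rewrite (@csum_delta R _ j); first by rewrite e eqxx.
by move=> k kj; rewrite e (negbTE kj).
Qed.

Lemma synth_inj a b : (forall x, synth a x = synth b x) -> a = b.
Proof.
move=> h; have e : synth a = synth b by apply/funext => x; exact: h.
by apply: spec_ext => k; rewrite -[LHS]fourier_synth e fourier_synth.
Qed.

Lemma spec_mulA : associative spec_mul.
Proof. by move=> a b c; apply: synth_inj => x; rewrite !synthM mulrA. Qed.

Lemma spec_mulC : commutative spec_mul.
Proof. by move=> a b; apply: synth_inj => x; rewrite !synthM mulrC. Qed.

Lemma spec_mul1 : left_id (spec_cst 1) spec_mul.
Proof. by move=> a; apply: synth_inj => x; rewrite synthM synth_cst mul1r. Qed.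

Lemma spec_mulDl : left_distributive spec_mul +%R.
Proof.
by move=> a b c; apply: synth_inj => x; rewrite synthM !synthD !synthM mulrDl.
Qed.

Lemma spec_1neq0 : spec_cst 1 != 0.
Proof.
apply/eqP => /(congr1 (fun a => spec_val a 0)); rewrite spec_0E /= ?eqxx.
by move/eqP; rewrite oner_eq0.
Qed.

HB.instance Definition _ := GRing.Zmodule_isComNzRing.Build spec
  spec_mulA spec_mulC spec_mul1 spec_mulDl spec_1neq0.

Lemma spec_mulE a b k : (a * b) k = cconv a b k. Proof. by []. Qed.

Lemma synthMr a b x : synth (a * b) x = synth a x * synth b x.
Proof. exact: synthM. Qed.

Lemma n1M a b : n1 (a * b) <= n1 a * n1 b.
Proof. exact: (@n1_le (spec_mul a b) _ (l1_cconv (nHP a) (nHP b) (n1P a) (n1P b))). Qed.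

Lemma n2M a b : n2 (a * b) <= n1 a * n2 b.
Proof. exact: (@n2_le (spec_mul a b) _ (l2_cconv (nHP a) (nHP b) (n1P a) (n2P b))). Qed.

Lemma nHM a b : nH (a * b) <= 3 * (n1 a * nH b + n1 b * nH a).
Proof. exact: (@nH_le (spec_mul a b) _ (H_cconv (nHP a) (nHP b) (n1P a) (n1P b))). Qed.

Lemma cstME z a k : (spec_cst z * a) k = z * a k.
Proof.
rewrite mulrC spec_mulE /cconv (@csum_delta R _ 0) /= ?eqxx ?subr0 1?mulrC//.
by move=> m /negbTE ->; rewrite mulr0.
Qed.

Lemma spec_cst_zmod : zmod_morphism spec_cst.
Proof.
move=> z w; apply: spec_ext => k; rewrite spec_subE /=.
by case: eqP; rewrite ?subrr.
Qed.

Lemma spec_cst_monoid : monoid_morphism spec_cst.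
Proof.
split => // z w; apply: spec_ext => k; rewrite cstME /=.
by case: eqP; rewrite ?mulr0.
Qed.

HB.instance Definition _ := GRing.isZmodMorphism.Build C spec spec_cst spec_cst_zmod.
HB.instance Definition _ := GRing.isMonoidMorphism.Build C spec spec_cst spec_cst_monoid.

End SpectralType.
Arguments spec R : clear implicits.

(** * Fourier multipliers and conjugation on Fourier series *)

Section Operators.
Context {R : realType}.
Local Notation C := R[i].
Implicit Types (a b c : spec R) (m : freq -> C).

(** The default value 0 is taken when [m * a] leaves [spec], which does not
    happen for bounded symbols. *)
Definition bmult m a : spec R := insubd (0 : spec R) (fun k => m k * a k).

Lemma bmultE m (M : R) a k : (forall k, cnorm (m k) <= M) -> bmult m a k = m k * a k.
Proof.
move=> mM; rewrite /bmult val_insubd; case: ifPn => // /spec_predP[].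
exists (`|M| * nH a); apply: l2le_mono (lexx _) (l2le_scale (normr_ge0 M) (nHP a)) => j.
rewrite habs_ge0 /= {1}/habs cnormM mulrCA -/(habs a j) ler_wpM2r ?habs_ge0//.
exact: le_trans (mM j) (ler_norm M).
Qed.

Section Bounded.
Variables (m : freq -> C) (M : R).
Hypothesis mM : forall k, cnorm (m k) <= M.

Lemma bmultD a b : bmult m (a + b) = bmult m a + bmult m b.
Proof.
by apply: spec_ext => k; rewrite spec_addE !(bmultE _ _ mM) spec_addE mulrDr.
Qed.

Lemma bmultN a : bmult m (- a) = - bmult m a.
Proof. by apply: spec_ext => k; rewrite spec_oppE !(bmultE _ _ mM) spec_oppE mulrN. Qed.

Lemma bmultB a b : bmult m (a - b) = bmult m a - bmult m b.
Proof. by rewrite bmultD bmultN. Qed.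

Lemma bmultZ z a : bmult m (spec_cst z * a) = spec_cst z * bmult m a.
Proof. by apply: spec_ext => k; rewrite cstME !(bmultE _ _ mM) cstME mulrCA. Qed.

Lemma n2_bmult a : n2 (bmult m a) <= `|M| * n2 a.
Proof.
apply: n2_le; apply: l2le_mono (lexx _) (l2le_scale (normr_ge0 M) (n2P a)) => j.
rewrite (bmultE _ _ mM) cnorm_ge0 /= cnormM ler_wpM2r ?cnorm_ge0//.
exact: le_trans (mM j) (ler_norm M).
Qed.

Lemma n1_bmult a : n1 (bmult m a) <= `|M| * n1 a.
Proof.
apply: n1_le; split; first by rewrite mulr_ge0 ?n1_ge0.
rewrite EFinM; apply: le_trans (lee_wpmul2l _ (n1P a).2); last by rewrite lee_fin.
rewrite -sum_scale//; last by move=> k; rewrite lee_fin cnorm_ge0.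
apply: le_sum => k; rewrite ?lee_fin ?cnorm_ge0//.
rewrite (bmultE _ _ mM) cnormM ler_wpM2r ?cnorm_ge0//.
exact: le_trans (mM k) (ler_norm M).
Qed.

Lemma nH_bmult a : nH (bmult m a) <= `|M| * nH a.
Proof.
apply: nH_le; apply: l2le_mono (lexx _) (l2le_scale (normr_ge0 M) (nHP a)) => j.
rewrite habs_ge0 /= {1}/habs (bmultE _ _ mM) cnormM mulrCA -/(habs a j).
rewrite ler_wpM2r ?habs_ge0//.
exact: le_trans (mM j) (ler_norm M).
Qed.

End Bounded.

(** The weight is even. *)
Lemma conjs_subproof a : (fun k => conjc (a (- k))) \in @spec_pred R.
Proof.
apply/spec_predP; exists (nH a); have [h0 h] := nHP a; split => //.
apply: le_trans h; rewrite -[leRHS](sum_reindex oppr_bij).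
  by apply: le_sum => k; rewrite lee_fin ?sqr_ge0// /habs wHN cnormC.
by move=> k; rewrite lee_fin sqr_ge0.
Qed.
(** The Fourier coefficients of the complex conjugate function. *)
Definition conjs a : spec R := Spec (conjs_subproof a).

Lemma conjsE a k : conjs a k = conjc (a (- k)). Proof. by []. Qed.

Lemma conjsK : involutive conjs.
Proof. by move=> a; apply: spec_ext => k; rewrite !conjsE opprK conjcK. Qed.

Lemma conjsD a b : conjs (a + b) = conjs a + conjs b.
Proof. by apply: spec_ext => k; rewrite spec_addE !conjsE spec_addE conjD. Qed.

Lemma conjsN a : conjs (- a) = - conjs a.
Proof.
apply: spec_ext => k; rewrite spec_oppE !conjsE spec_oppE.
by case: (a (- k)) => u v.
Qed.

Lemma conjsB a b : conjs (a - b) = conjs a - conjs b.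
Proof. by rewrite conjsD conjsN. Qed.

Let nH_conjs_le a : nH (conjs a) <= nH a.
Proof.
apply: nH_le; have [h0 h] := nHP a; split => //.
apply: le_trans h; rewrite -[leRHS](sum_reindex oppr_bij).
  by apply: le_sum => k; rewrite lee_fin ?sqr_ge0// /habs wHN cnormC.
by move=> k; rewrite lee_fin sqr_ge0.
Qed.

Let n2_conjs_le a : n2 (conjs a) <= n2 a.
Proof.
apply: n2_le; have [h0 h] := n2P a; split => //.
apply: le_trans h; rewrite -[leRHS](sum_reindex oppr_bij).
  by apply: le_sum => k; rewrite lee_fin ?sqr_ge0// cnormC.
by move=> k; rewrite lee_fin sqr_ge0.
Qed.

Let n1_conjs_le a : n1 (conjs a) <= n1 a.
Proof.
apply: n1_le; have [h0 h] := n1P a; split => //.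
apply: le_trans h; rewrite -[leRHS](sum_reindex oppr_bij).
  by apply: le_sum => k; rewrite lee_fin ?cnorm_ge0// cnormC.
by move=> k; rewrite lee_fin cnorm_ge0.
Qed.

Lemma nH_conjs a : nH (conjs a) = nH a.
Proof. by apply/le_anti/andP; split => //; rewrite -{1}(conjsK a). Qed.
Lemma n2_conjs a : n2 (conjs a) = n2 a.
Proof. by apply/le_anti/andP; split => //; rewrite -{1}(conjsK a). Qed.
Lemma n1_conjs a : n1 (conjs a) = n1 a.
Proof. by apply/le_anti/andP; split => //; rewrite -{1}(conjsK a). Qed.

Lemma synth_conjs a x : synth (conjs a) x = conjc (synth a x).
Proof.
rewrite /synth -(csum_reindex _ oppr_bij).
rewrite (_ : (fun k => _) = fun k => conjc (a k * expo k x)); last first.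
  by apply/funext => k; rewrite conjsE opprK expoN conjM.
have hi := cintegrable_Im (cintegrable_synth a x).
apply: complex_ext => /=.
  by apply: eq_Rintegral => k _; rewrite Rec_conj.
rewrite -mulN1r -RintegralZl//.
by apply: eq_Rintegral => k _; rewrite Imc_conj mulN1r.
Qed.

Lemma conjsM a b : conjs (a * b) = conjs a * conjs b.
Proof.
by apply: synth_inj => x; rewrite synthMr !synth_conjs synthMr conjM.
Qed.

Lemma conjs_cst z : conjs (spec_cst z) = spec_cst (conjc z).
Proof. by apply: synth_inj => x; rewrite synth_conjs !synth_cst. Qed.

Lemma n1_cst z a : n1 (spec_cst z * a) <= cnorm z * n1 a.
Proof.
have -> : spec_cst z * a = bmult (fun=> z) a.
  by apply: spec_ext => k; rewrite cstME (@bmultE _ (cnorm z)).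
by rewrite -(ger0_norm (cnorm_ge0 z)); apply: n1_bmult.
Qed.

Lemma n2_cst z a : n2 (spec_cst z * a) <= cnorm z * n2 a.
Proof.
have -> : spec_cst z * a = bmult (fun=> z) a.
  by apply: spec_ext => k; rewrite cstME (@bmultE _ (cnorm z)).
by rewrite -(ger0_norm (cnorm_ge0 z)); apply: n2_bmult.
Qed.

Lemma nH_cst z a : nH (spec_cst z * a) <= cnorm z * nH a.
Proof.
have -> : spec_cst z * a = bmult (fun=> z) a.
  by apply: spec_ext => k; rewrite cstME (@bmultE _ (cnorm z)).
by rewrite -(ger0_norm (cnorm_ge0 z)); apply: nH_bmult.
Qed.

End Operators.

Section Bridge.
Context {R : realType}.
Local Notation C := R[i].
Local Notation TT := (measurableTypeR R * measurableTypeR R)%type.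
Local Notation mu := (torus_measure R).
Local Notation nu := (@freq_counting R).
Implicit Types (a b c : spec R) (f g : torus_fun R).

(** Equality up to null sets with an absolutely convergent series, which is
    an everywhere defined bounded function: products are compatible with
    this relation without any integrability condition. *)
Definition repr f a := cmeas f /\ {ae mu, forall x, f x = synth a x}.

Lemma muT_fin : mu [set: TT] \is a fin_num.
Proof. by rewrite torus_measureT. Qed.

Lemma Lfun2P (p : TT -> R) : p \in Lfun mu 2%:E <->
  measurable_fun setT p /\ (\int[mu]_x (p x ^+ 2)%:E < +oo)%E.
Proof.
split=> [hp|[mp hp]].
  have := Lfun2_integrable_sqr hp => /integrableP[_ h2].
  move: hp; rewrite inE => /andP[/[!inE]/= mp _]; split => //.
  by apply: le_lt_trans h2; apply: ge0_le_integral => //;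
    [by move=> x _; rewrite lee_fin sqr_ge0|
     apply/measurable_EFinP; exact: measurable_funX|
     apply: measurableT_comp => //; apply/measurable_EFinP; exact: measurable_funX|
     by move=> x _; rewrite /= lee_fin ler_norm].
rewrite inE; apply/andP; split; rewrite inE//=.
rewrite /finite_norm unlock; apply: poweR_lty.
by under eq_integral do rewrite /= powR_mulrn// real_normK ?num_real//.
Qed.

Lemma repr_in_L2 f a : repr f a -> in_L2 f.
Proof.
move=> [mf fa]; have [mr mi] := mf.
have h (p : TT -> R) : measurable_fun setT p ->
    {ae mu, forall x, `|p x| <= n1 a} -> p \in Lfun mu 2%:E.
  move=> mp pa; apply/Lfun2P; split => //.
  apply: (@le_lt_trans _ _ (\int[mu]_x (cst ((n1 a) ^+ 2)%:E x))%E).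
    apply: ae_ge0_le_integral => //.
    - by move=> x _; rewrite lee_fin sqr_ge0.
    - by apply/measurable_EFinP; exact: measurable_funX.
    - by move=> x _; rewrite /= lee_fin sqr_ge0.
    - apply: filterS pa => x px _; rewrite /= lee_fin -real_normK ?num_real//.
      by rewrite lerXn2r ?nnegrE ?n1_ge0.
  by rewrite integral_cst// (_ : _ [set: _] = 1%E) ?mule1 ?ltry//; exact: torus_measureT.
split.
- by apply: h => //; apply: filterS fa => x ->; exact: le_trans (Re_le_cnorm _) (cnorm_synth _ _).
- by apply: h => //; apply: filterS fa => x ->; exact: le_trans (Im_le_cnorm _) (cnorm_synth _ _).
Qed.

Lemma in_L2_cintegrable f : in_L2 f -> cintegrable mu f.
Proof.
move=> [hr hi].
have mr : measurable_fun setT (fun x => complex.Re (f x)) by have /Lfun2P[] := hr.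
have mi : measurable_fun setT (fun x => complex.Im (f x)) by have /Lfun2P[] := hi.
have /Lfun1_integrable/integrableP[_ ir] := Lfun_subset12 muT_fin hr.
have /Lfun1_integrable/integrableP[_ ii] := Lfun_subset12 muT_fin hi.
apply: (@cintegrable_le _ _ _ _ _ (fun x => `|complex.Re (f x)| + `|complex.Im (f x)|)).
- by split.
- by apply: measurable_funD; exact: measurableT_comp.
- by move=> x; exact: cnorm_le.
- under eq_integral do rewrite EFinD.
  rewrite ge0_integralD//; try by apply/measurable_EFinP; exact: measurableT_comp.
  exact: lte_add_pinfty.
Qed.

Lemma repr_fourier f a (k : freq) : repr f a -> fourier f k = a k.
Proof.
move=> [mf fa]; rewrite -fourier_synth !fourierE; apply: ae_eq_cint.
- by apply: cmeasM => //; exact: cmeas_expo.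
- by apply: cmeasM; [exact: cmeas_synth|exact: cmeas_expo].
- by apply: filterS fa => x ->.
Qed.

Lemma repr_synth a : repr (synth a) a.
Proof. by split; [exact: cmeas_synth|exact: aeW]. Qed.

(** Both functions are integrable and have the same Fourier coefficients, so
    [fourier_unique] applies. *)
Lemma in_L2_repr f a : in_L2 f -> (forall k : freq, fourier f k = a k) -> repr f a.
Proof.
move=> hf fa; have hi := in_L2_cintegrable hf.
have hs : cintegrable mu (synth a).
  apply: (@cintegrable_bounded _ _ (n1 a)); first exact: cmeas_synth.
  exact: cnorm_synth.
split; first exact: hi.1.
have : {ae mu, forall x, f x - synth a x = 0}.
  apply: fourier_unique; first exact: cintegrableB.
  move=> k; rewrite fourierE.
  rewrite (_ : (fun x => _) = (fun x => f x * expo (- k) x - synth a x * expo (- k) x)).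
    rewrite cintB; try exact: cintegrable_expo.
    by rewrite -!fourierE fa fourier_synth subrr.
  by apply/funext => x; rewrite mulrBl.
by apply: filterS => x /eqP; rewrite subr_eq0 => /eqP.
Qed.

Lemma repr_ext f g a : (forall x, f x = g x) -> repr f a -> repr g a.
Proof. by move=> /funext ->. Qed.

Lemma repr_ae f g a : cmeas g -> {ae mu, forall x, g x = f x} -> repr f a -> repr g a.
Proof. by move=> mg gf [mf fa]; split => //; apply: filterS2 gf fa => x -> ->. Qed.

Lemma reprD f g a b : repr f a -> repr g b -> repr (fun x => f x + g x) (a + b).
Proof.
move=> [mf fa] [mg gb]; split; first exact: cmeasD.
by apply: filterS2 fa gb => x -> ->; rewrite synthD.
Qed.

Lemma reprM f g a b : repr f a -> repr g b -> repr (fun x => f x * g x) (a * b).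
Proof.
move=> [mf fa] [mg gb]; split; first exact: cmeasM.
by apply: filterS2 fa gb => x -> ->; rewrite synthMr.
Qed.

Lemma repr_cst z : repr (fun=> z) (spec_cst z).
Proof.
split; first exact: cmeas_cst.
by apply: aeW => x; rewrite synth_cst.
Qed.

Lemma reprZ z f a : repr f a -> repr (fun x => z * f x) (spec_cst z * a).
Proof. by move=> h; exact: (reprM (repr_cst z) h). Qed.

Lemma reprN f a : repr f a -> repr (fun x => - f x) (- a).
Proof.
move=> /(reprZ (-1)); rewrite rmorphN rmorph1 mulN1r.
by apply: repr_ext => x; rewrite mulN1r.
Qed.

Lemma reprB f g a b : repr f a -> repr g b -> repr (fun x => f x - g x) (a - b).
Proof. by move=> hf hg; exact: (reprD hf (reprN hg)). Qed.

Lemma repr_conj f a : repr f a -> repr (fconj f) (conjs a).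
Proof.
move=> [mf fa]; split; first exact: cmeas_conj.
by apply: filterS fa => x; rewrite /fconj => ->; rewrite synth_conjs.
Qed.

Lemma reprX f a n : repr f a -> repr (fun x => f x ^+ n) (a ^+ n).
Proof.
move=> h; elim: n => [|n IH].
  by rewrite expr0 -(rmorph1 (@spec_cst R)); apply: repr_ext (repr_cst 1) => x; rewrite expr0.
by rewrite exprS; apply: repr_ext (reprM h IH) => x; rewrite exprS.
Qed.

(** The defining property of [fourier_multiplier] is met by [synth (bmult m
    a)], and determines its value up to null sets. *)
Lemma repr_multiplier m (M : R) f a : (forall k, cnorm (m k) <= M) -> repr f a ->
  repr (fourier_multiplier m f) (bmult m a).
Proof.
move=> mM hf; rewrite /fourier_multiplier.
set P := [set g | _].
have [h1 h2] : P (xget (fun=> 0) P).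
  apply: xgetPex; exists (synth (bmult m a)); split.
    exact: (repr_in_L2 (repr_synth (bmult m a))).
  by move=> k; rewrite fourier_synth (bmultE _ _ mM) (repr_fourier k hf).
apply: in_L2_repr => // k.
by rewrite h2 (bmultE _ _ mM) (repr_fourier k hf).
Qed.

(** Parseval's identity is the equality of the coefficients of frequency 0
    of [f * conj f] computed in two ways. *)
Lemma sum_sqr_synth a : (\int[mu]_x (cnorm (synth a x) ^+ 2)%:E = ((n2 a) ^+ 2)%:E)%E.
Proof.
have mS := measurable_cnorm (cmeas_synth a).
have h0 : fourier (synth (a * conjs a)) 0 = cint nu (fun m => a (0 - m) * conjs a m).
  by rewrite fourier_synth.
rewrite fourierE in h0.
have e1 : (fun x => synth (a * conjs a) x * expo (- 0) x) =
    (fun x => (cnorm (synth a x) ^+ 2)%:C).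
  by apply/funext => x; rewrite oppr0 expo0 mulr1 synthMr synth_conjs mul_conj.
have e2 : (fun m => a (0 - m) * conjs a m) = (fun m => (cnorm (a (- m)) ^+ 2)%:C).
  by apply/funext => m; rewrite conjsE sub0r mul_conj.
move: h0; rewrite e1 e2 => /(congr1 (@complex.Re _)) /=.
rewrite /Rintegral => h0.
rewrite -[LHS]fineK; last first.
  rewrite ge0_fin_numE; last by apply: integral_ge0 => x _; rewrite lee_fin sqr_ge0.
  apply: (@le_lt_trans _ _ (\int[mu]_x (cst ((n1 a) ^+ 2)%:E x))%E).
    apply: ge0_le_integral => //.
    - by apply/measurable_EFinP; exact: measurable_funX.
    - by move=> x _; rewrite /= lee_fin lerXn2r ?nnegrE ?cnorm_ge0 ?n1_ge0 ?cnorm_synth.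
  by rewrite integral_cst// (_ : _ [set: _] = 1%E) ?mule1 ?ltry//; exact: torus_measureT.
rewrite h0; congr EFin; rewrite sqr_sqrtr; last first.
  by apply: fine_ge0; exact: sum_sqr_ge0.
congr fine.
apply: (@sum_reindex R (fun k => - k) (fun k => (cnorm (a k) ^+ 2)%:E) oppr_bij).
by move=> k; rewrite lee_fin sqr_ge0.
Qed.

Lemma repr_L2norm f a : repr f a -> L2norm f = (n2 a)%:E.
Proof.
have mS := measurable_cnorm (cmeas_synth a).
move=> [mf fa]; rewrite /L2norm unlock /=.
rewrite (_ : (\int[_]_x _ = ((n2 a) ^+ 2)%:E)%E).
  by rewrite poweR_EFin -powR_mulrn ?n2_ge0// -powRrM divff ?powRr1 ?n2_ge0 ?pnatr_eq0.
rewrite -sum_sqr_synth; apply: ae_eq_integral => //.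
- apply/measurable_EFinP; under eq_fun do rewrite powR_mulrn ?normr_ge0//.
  by apply: measurable_funX; apply: measurableT_comp => //; exact: measurable_cnorm.
- by apply/measurable_EFinP; exact: measurable_funX.
- by apply: filterS fa => x -> _; rewrite /= powR_mulrn ?normr_ge0// ger0_norm ?cnorm_ge0.
Qed.

End Bridge.

(** * The functions phi1 and phi2 on the imaginary axis *)

Section PhiFunctions.
Context {R : realType}.
Local Notation C := R[i].
Implicit Types (s h w y : R).

Lemma i_neq0 : ('i : C) != 0.
Proof. by apply/eqP => -[/eqP]; rewrite oner_eq0. Qed.

Lemma ir_neq0 y : y != 0 -> 'i * y%:C != 0 :> C.
Proof.
move=> y0; rewrite mulf_neq0 ?i_neq0//.
by apply/eqP => -[/eqP]; apply/negP.
Qed.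

Lemma mul_ii : 'i * 'i = -1 :> C.
Proof. by apply: complex_ext => /=; ring. Qed.

Lemma phi1_im y : y != 0 -> phi1 ('i * y%:C) = (cis y - 1) / ('i * y%:C).
Proof. by move=> y0; rewrite /phi1 (negbTE (ir_neq0 y0)) cexp_iR. Qed.

Lemma phi2_im y : y != 0 ->
  phi2 ('i * y%:C) = (cis y - phi1 ('i * y%:C)) / ('i * y%:C).
Proof. by move=> y0; rewrite /phi2 (negbTE (ir_neq0 y0)) cexp_iR. Qed.

Lemma cnorm_ir y : cnorm ('i * y%:C : C) = `|y|.
Proof. by rewrite cnormM cnorm_i mul1r cnormR. Qed.

Lemma phi_im0 : phi1 ('i * (0 : R)%:C) = 1 /\ phi2 ('i * (0 : R)%:C) = 2^-1 :> C.
Proof. by rewrite mulr0 /phi1 /phi2 eqxx. Qed.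

Lemma cnorm_phi1 y : cnorm (phi1 ('i * y%:C)) <= 1.
Proof.
have [->|y0] := eqVneq y 0; first by rewrite phi_im0.1 cnorm1.
rewrite phi1_im// cnormM cnormV cnorm_ir ler_pdivrMr ?normr_gt0// mul1r.
exact: cis_sub1_le.
Qed.

Lemma cnorm_phi2 y : cnorm (phi2 ('i * y%:C)) <= 2.
Proof.
have [->|y0] := eqVneq y 0.
  rewrite phi_im0.2 cnormV (_ : 2 = (2 : R)%:C :> C); last by rewrite rmorph_nat.
  by rewrite cnormR ger0_norm//; lra.
have z0 := ir_neq0 y0; rewrite phi2_im// phi1_im//.
have -> : (cis y - (cis y - 1) / ('i * y%:C)) / ('i * y%:C) =
    - cis y * (cis (- y) - 1 - 'i * (- y)%:C) / (y ^+ 2)%:C.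
  have e : (y ^+ 2)%:C = - ('i * y%:C) ^+ 2 :> C.
    by rewrite exprMn ['i ^+ 2]expr2 mul_ii mulN1r opprK rmorphXn.
  have c : cis y * cis (- y) = 1 :> C by rewrite -cisD subrr cis0.
  have -> : - cis y * (cis (- y) - 1 - 'i * (- y)%:C) =
      - (cis y * cis (- y)) + cis y - cis y * ('i * y%:C).
    by rewrite rmorphN /=; ring.
  rewrite c e; set z := 'i * y%:C in z0 *; field.
  exact: z0.
rewrite !cnormM !cnormN cnorm_cis mul1r cnormV cnormR.
rewrite ger0_norm ?sqr_ge0// ler_pdivrMr ?exprn_even_gt0//.
by have := cis_sub1i_le (- y); rewrite sqrrN.
Qed.

Lemma phi_sub1_le (z : R) : z != 0 ->
  cnorm ((cis z - 1) / ('i * z%:C) - 1) <= 2 * `|z|.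
Proof.
move=> z0.
have -> : (cis z - 1) / ('i * z%:C) - 1 = (cis z - 1 - 'i * z%:C) / ('i * z%:C).
  by rewrite [RHS]mulrBl divff// ir_neq0.
rewrite cnormM cnormV cnorm_ir ler_pdivrMr ?normr_gt0//.
apply: le_trans (cis_sub1i_le z) _.
by rewrite -mulrA -expr2 real_normK ?num_real.
Qed.

(** The primitives vanishing at 0 of [exp (i w s)] and of [s exp (i w s)],
    which is how [phi1] and [phi2] enter the scheme. Writing them with
    [phi1] and [phi2] makes sense at [w = 0] too. *)
Definition prim1 w s : C := s%:C * phi1 ('i * (w * s)%:C).
Definition prim2 w s : C := (s ^+ 2)%:C * phi2 ('i * (w * s)%:C).

Lemma prim1_neq0 w s : w != 0 -> prim1 w s = (cis (w * s) - 1) / ('i * w%:C).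
Proof.
move=> w0; rewrite /prim1; have [->|s0] := eqVneq s 0.
  by rewrite mulr0 mul0r cis0 subrr mul0r.
rewrite phi1_im ?mulf_neq0// rmorphM /=.
have h1 := ir_neq0 w0; have h2 : s%:C != 0 :> C by apply/eqP => -[/eqP]; apply/negP.
have w0' : w%:C != 0 :> C by apply/eqP => -[/eqP]; apply/negP.
by field; rewrite h2 w0' i_neq0.
Qed.

Lemma prim2_neq0 w s : w != 0 ->
  prim2 w s = (s%:C * cis (w * s) - prim1 w s) / ('i * w%:C).
Proof.
move=> w0; rewrite /prim2; have [->|s0] := eqVneq s 0.
  by rewrite expr0n /prim1 !mul0r subrr mul0r.
rewrite phi2_im ?mulf_neq0// /prim1 [(w * s)%:C]rmorphM [(s ^+ 2)%:C]rmorphXn /=.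
have h1 := ir_neq0 w0; have h2 : s%:C != 0 :> C by apply/eqP => -[/eqP]; apply/negP.
have w0' : w%:C != 0 :> C by apply/eqP => -[/eqP]; apply/negP.
by field; rewrite h2 w0' i_neq0.
Qed.

Lemma prim_w0 s : prim1 0 s = s%:C /\ prim2 0 s = (s ^+ 2 / 2)%:C.
Proof.
rewrite /prim1 /prim2 mul0r phi_im0.1 phi_im0.2 mulr1; split => //.
rewrite [RHS](_ : _ = (s ^+ 2)%:C * (2^-1 : R)%:C); last by rewrite -rmorphM.
by rewrite fmorphV rmorph_nat.
Qed.

Lemma cnorm_prim1 w s : 0 <= s -> cnorm (prim1 w s) <= s.
Proof.
by move=> s0; rewrite cnormM cnormR ger0_norm// ler_piMr// cnorm_phi1.
Qed.

Lemma cnorm_prim2 w s : cnorm (prim2 w s) <= 2 * s ^+ 2.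
Proof.
rewrite cnormM cnormR ger0_norm ?sqr_ge0// mulrC ler_wpM2r ?sqr_ge0//.
exact: cnorm_phi2.
Qed.

(** Derivatives are stated as increments with a quadratic remainder, because
    that is the form in which [n2_mean_value] uses them; the remainders may
    grow with [w], the frequency, since they disappear there. *)
Lemma prim1_deriv w s h : cnorm (prim1 w (s + h) - prim1 w s - h%:C * cis (w * s)) <=
  2 * `|w| * h ^+ 2.
Proof.
have [->|w0] := eqVneq w 0.
  rewrite !(prim_w0 _).1 mul0r cis0 mulr1.
  have -> : (s + h)%:C - s%:C - h%:C = 0 :> C by rewrite rmorphD; ring.
  by rewrite cnorm0 normr0 mulr0 mul0r.
have [->|h0] := eqVneq h 0.
  by rewrite addr0 subrr mul0r subrr cnorm0 mulr_ge0 ?sqr_ge0// mulr_ge0.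
rewrite !prim1_neq0// mulrDr cisD.
have wh0 : w * h != 0 by rewrite mulf_neq0.
have -> : (cis (w * s) * cis (w * h) - 1) / ('i * w%:C) - (cis (w * s) - 1) / ('i * w%:C)
    - h%:C * cis (w * s) =
    cis (w * s) * h%:C * ((cis (w * h) - 1) / ('i * (w * h)%:C) - 1).
  have w0' : w%:C != 0 :> C by apply/eqP => -[/eqP]; apply/negP.
  have h0' : h%:C != 0 :> C by apply/eqP => -[/eqP]; apply/negP.
  by rewrite rmorphM /=; field; rewrite w0' h0' i_neq0.
rewrite !cnormM cnorm_cis mul1r cnormR.
apply: le_trans (ler_wpM2l (normr_ge0 h) (phi_sub1_le wh0)) _.
by rewrite normrM -[h ^+ 2]real_normK ?num_real// expr2; lra.
Qed.

Lemma prim2_deriv w s h : 0 <= s ->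
  cnorm (prim2 w (s + h) - prim2 w s - (h * s)%:C * cis (w * s)) <=
  2 * h ^+ 2 * (1 + s * `|w|).
Proof.
move=> s0; have [->|w0] := eqVneq w 0.
  rewrite !(prim_w0 _).2 mul0r cis0 mulr1 -!rmorphB.
  rewrite (_ : _ - _ - _ = h ^+ 2 / 2); last by field.
  rewrite cnormR ger0_norm ?divr_ge0 ?sqr_ge0// normr0 mulr0 addr0 mulr1.
  by have := sqr_ge0 h; lra.
have [->|h0] := eqVneq h 0.
  rewrite addr0 subrr mul0r mul0r subrr cnorm0 mulr_ge0 ?addr_ge0 ?mulr_ge0//.
have -> : prim2 w (s + h) - prim2 w s - (h * s)%:C * cis (w * s) =
    cis (w * s) * (prim2 w h) +
    s%:C * (prim1 w (s + h) - prim1 w s - h%:C * cis (w * s)).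
  rewrite !prim2_neq0// !prim1_neq0// mulrDr cisD rmorphM rmorphD /=.
  have w0' : w%:C != 0 :> C by apply/eqP => -[/eqP]; apply/negP.
  by field; rewrite w0' i_neq0.
apply: le_trans (cnormD _ _) _.
rewrite [cnorm (cis _ * _)]cnormM [cnorm (s%:C * _)]cnormM cnorm_cis mul1r.
have h1 := cnorm_prim2 w h; have h2 := prim1_deriv w s h.
have h3 := ler_wpM2l s0 h2; rewrite cnormR (ger0_norm s0).
by lra.
Qed.

End PhiFunctions.

(** * The resonance defect and its linear interpolation *)

Section Resonance.
Context {R : realType}.
Implicit Types (k m n : freq).

(** With [p, q, r] the lengths of the three vectors, [K] that of their sum
    and [d = p + q + r - K >= 0], one has [d ^+ 2 <= d * (p + q + r + K) =
    (p + q + r) ^+ 2 - K ^+ 2], and the difference of squares contains only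
    the products of two distinct lengths and the inner products. *)
Lemma defect_sqr k m n : (knorm (k + m + n) - knorm k - knorm m - knorm n) ^+ 2 <=
  4 * (knorm k * knorm m + knorm k * knorm n + knorm m * knorm n) :> R.
Proof.
set p := knorm k; set q := knorm m; set r := knorm n.
set K := knorm (k + m + n).
have p0 : 0 <= p := @knorm_ge0 R k; have q0 : 0 <= q := @knorm_ge0 R m.
have r0 : 0 <= r := @knorm_ge0 R n; have K0 : 0 <= K := @knorm_ge0 R _.
have hK : K <= p + q + r.
  apply: le_trans (@knormD R (k + m) n) _; rewrite lerD2r; exact: knormD.
have K2 : K ^+ 2 = p ^+ 2 + q ^+ 2 + r ^+ 2
    + 2 * (k.1%:~R * m.1%:~R + k.2%:~R * m.2%:~R)
    + 2 * (k.1%:~R * n.1%:~R + k.2%:~R * n.2%:~R)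
    + 2 * (m.1%:~R * n.1%:~R + m.2%:~R * n.2%:~R).
  by rewrite !sqr_knorm /= !rmorphD /=; ring.
have := @dot_le_knorm R k m; rewrite ler_norml => /andP[+ _]; rewrite -/p -/q.
have := @dot_le_knorm R k n; rewrite ler_norml => /andP[+ _]; rewrite -/p -/r.
have := @dot_le_knorm R m n; rewrite ler_norml => /andP[+ _]; rewrite -/q -/r.
move=> hc hb ha.
have h1 : (K - p - q - r) ^+ 2 <= (p + q + r) ^+ 2 - K ^+ 2.
  have -> : (p + q + r) ^+ 2 - K ^+ 2 = (p + q + r - K) * (p + q + r + K) by ring.
  have -> : (K - p - q - r) ^+ 2 = (p + q + r - K) * (p + q + r - K) by ring.
  by apply: ler_wpM2l; lra.
by apply: le_trans h1 _; rewrite K2; lra.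
Qed.

End Resonance.

(** The group generated by [i |nabla|]. Locked, like the other multipliers
    below, so that unification does not unfold one Fourier multiplier while
    looking for another. *)
HB.lock Definition flow {R : realType} (t : R) (a : spec R) : spec R :=
  bmult (fun k => cis (t * knorm k)) a.

(** The trilinear term in the moving frame, apart from the conjugate factor
    [w], which carries its own oscillation [exp (- 2 i s |nabla|)]. *)
HB.lock Definition twist {R : realType} (t : R) (a w : spec R) : spec R :=
  flow (- t) (flow t a * flow t a * flow t w).

Section Trilinear.
Context {R : realType}.
Local Notation C := R[i].
Local Notation nu := (@freq_counting R).
Implicit Types (f g x : freq -> R) (a b c w : spec R).

Definition trip f1 f2 f3 k : \bar R :=
  (\int[nu]_m \int[nu]_n (f1 (k - m - n) * f2 n * f3 m)%:E)%E.

Lemma trip_ge0 f1 f2 f3 k : (forall k, 0 <= f1 k) -> (forall k, 0 <= f2 k) ->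
  (forall k, 0 <= f3 k) -> (0 <= trip f1 f2 f3 k)%E.
Proof.
by move=> h1 h2 h3; apply: sum_ge0 => m; apply: sum_ge0 => n; rewrite lee_fin !mulr_ge0.
Qed.

Lemma trip_perm12 f1 f2 f3 : (forall k, 0 <= f1 k) -> (forall k, 0 <= f2 k) ->
  (forall k, 0 <= f3 k) -> trip f1 f2 f3 = trip f2 f1 f3.
Proof.
move=> h1 h2 h3; apply/funext => k; apply: eq_sum => m.
rewrite -[RHS](sum_reindex (subl_bij (k - m))); last by move=> n; rewrite lee_fin !mulr_ge0.
by apply: eq_sum => n; rewrite subKr [f2 _ * _]mulrC.
Qed.

Lemma trip_perm23 f1 f2 f3 : (forall k, 0 <= f1 k) -> (forall k, 0 <= f2 k) ->
  (forall k, 0 <= f3 k) -> trip f1 f2 f3 = trip f1 f3 f2.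
Proof.
move=> h1 h2 h3; apply/funext => k; rewrite /trip sum_swap; last first.
  by move=> m n; rewrite lee_fin !mulr_ge0.
by apply: eq_sum => n; apply: eq_sum => m; rewrite addrAC mulrAC.
Qed.

(** Two of the factors are combined by [nconv_half], and the result is
    convolved with a summable sequence. *)
Lemma trip_l2 : exists2 C0 : R, 0 <= C0 &
  forall (f1 f2 f3 : freq -> R) (P Q A : R),
  (forall k, 0 <= f1 k) -> (forall k, 0 <= f2 k) -> (forall k, 0 <= f3 k) ->
  l2le (fun k => Num.sqrt (jb k) * f1 k) P -> l2le (fun k => Num.sqrt (jb k) * f2 k) Q ->
  l1le f3 A ->
  (forall k, trip f1 f2 f3 k \is a fin_num) /\
  l2le (fun k => fine (trip f1 f2 f3 k)) (C0 * P * Q * A).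
Proof.
have [C0 C00 hC] := @nconv_half R; exists C0 => //.
move=> f1 f2 f3 P Q A h1 h2 h3 l1 l2 l3.
have le_sq (u : freq -> R) m : (forall k, 0 <= u k) -> u m <= Num.sqrt (jb m) * u m.
  by move=> u0; rewrite ler_peMl// -sqrtr1 ler_wsqrtr// jb_ge1.
have lP : l2le f1 P by apply: l2le_mono l1 => // k; rewrite h1 le_sq.
have lQ : l2le f2 Q by apply: l2le_mono l2 => // k; rewrite h2 le_sq.
have fin k : nconv f1 f2 k \is a fin_num.
  rewrite ge0_fin_numE; last exact: nconv_ge0.
  exact: le_lt_trans (nconv_fin k h1 h2 lP lQ) (ltry _).
pose g k := fine (nconv f1 f2 k).
have g0 k : 0 <= g k by apply: fine_ge0; exact: nconv_ge0.
have lg : l2le g (C0 * P * Q) by apply: (hC f1 f2) => // k; rewrite fineK.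
have e k : trip f1 f2 f3 k = nconv f3 g k.
  rewrite (nconvC h3 g0); apply: eq_sum => m.
  rewrite EFinM fineK// muleC /nconv -sum_scale//; last by move=> n; rewrite lee_fin mulr_ge0.
  by apply: eq_sum => n; rewrite -EFinM mulrC.
have fin3 k : nconv f3 g k \is a fin_num.
  rewrite ge0_fin_numE; last exact: nconv_ge0.
  have l3' : l2le f3 A.
    have A0 := l3.1; split => //.
    rewrite expr2 EFinM; apply: le_trans (lee_wpmul2l _ l3.2); last by rewrite lee_fin.
    rewrite -sum_scale//.
    apply: le_sum => j; first by rewrite lee_fin sqr_ge0.
    rewrite lee_fin expr2 ler_wpM2r// -lee_fin; apply: le_trans l3.2.
    by apply: (@le_term_sum R (fun k => (f3 k)%:E)) => i; rewrite lee_fin.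
  exact: le_lt_trans (nconv_fin k h3 g0 l3' lg) (ltry _).
split=> [k|]; first by rewrite e.
rewrite mulrC; apply: (nconv_l2 h3 g0 l3 lg) => k.
by rewrite e fine_ge0 ?nconv_ge0// fineK.
Qed.

Lemma flow_sym_le (t : R) k : cnorm (cis (t * knorm k) : C) <= 1.
Proof. by rewrite cnorm_cis. Qed.

Lemma flowE t a k : flow t a k = cis (t * knorm k) * a k.
Proof. by rewrite flow.unlock; exact: bmultE (flow_sym_le t). Qed.

Lemma cnorm_flow t a k : cnorm (flow t a k) = cnorm (a k).
Proof. by rewrite flowE cnormM cnorm_cis mul1r. Qed.

(** The frequencies of the three factors are [k - m - n], [n] and [m]. *)
Definition defect k m n : R := knorm k - knorm (k - m - n) - knorm n - knorm m.

Lemma mul3_integrable a b w k m :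
  cintegrable nu (fun n => a (k - m - n) * b n * w m).
Proof.
have := cintegrableZ (w m) (cconv_integrable (k - m) (nHP a) (nHP b)).
by congr cintegrable; apply/funext => n; rewrite mulrC.
Qed.

Lemma cis_integrable (F : freq -> C) (t : freq -> R) :
  cintegrable nu F -> cintegrable nu (fun n => cis (t n) * F n).
Proof.
move=> h; apply: (cintegrable_bdM h (M := 1)); first by split.
by move=> n; rewrite cnorm_cis.
Qed.

Lemma twistE t a w k : twist t a w k =
  cint nu (fun m => cint nu (fun n =>
    cis (- t * defect k m n) * (a (k - m - n) * a n * w m))).
Proof.
rewrite twist.unlock flowE spec_mulE /cconv -cintZ; last exact: cconv_integrable (nHP _) (nHP _).
congr cint; apply/funext => m.
rewrite spec_mulE /cconv [flow t w m]flowE.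
transitivity (cis (- t * knorm k) * (cis (t * knorm m) * w m) *
    cint nu (fun n => flow t a (k - m - n) * flow t a n)).
  by rewrite -mulrA; congr (_ * _); rewrite mulrC.
rewrite -cintZ; last exact: cconv_integrable (nHP _) (nHP _).
congr cint; apply/funext => n; rewrite !flowE /defect.
rewrite (_ : - t * (knorm k - knorm (k - m - n) - knorm n - knorm m) = - t * knorm k + t * knorm (k - m - n) + t * knorm n + t * knorm m); last by ring.
by rewrite !cisD; ring.
Qed.

Lemma inner_integrable (F : freq -> freq -> C) k (a b w : spec R) :
  (forall m n, cnorm (F m n) <= cnorm (a (k - m - n) * b n * w m)) ->
  cintegrable nu (fun m => cint nu (F m)).
Proof.
move=> h; split => //.
apply: (@le_lt_trans _ _ (nconv (fun m => fine (nconv (fun n => cnorm (a n)) (fun n => cnorm (b n)) m)) (fun m => cnorm (w m)) k)).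
  have fin j : nconv (fun n => cnorm (a n)) (fun n => cnorm (b n)) j \is a fin_num.
    rewrite ge0_fin_numE; last by apply: nconv_ge0 => ?; exact: cnorm_ge0.
    by apply: le_lt_trans (nconv_fin j _ _ (n2P a) (n2P b)) (ltry _) => ?; exact: cnorm_ge0.
  apply: le_sum => m; first by rewrite lee_fin cnorm_ge0.
  have iF : cintegrable nu (F m).
    split => //; apply: le_lt_trans (mul3_integrable a b w k m).2.
    by apply: le_sum => n; rewrite lee_fin ?cnorm_ge0.
  apply: le_trans (cnorm_cint_le iF) _.
  rewrite EFinM fineK// muleC /nconv -sum_scale ?cnorm_ge0//; last first.
    by move=> n; rewrite lee_fin mulr_ge0 ?cnorm_ge0.
  apply: le_sum => n; first by rewrite lee_fin cnorm_ge0.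
  by rewrite -EFinM lee_fin; apply: le_trans (h m n) _; rewrite !cnormM mulrC.
have l1 : l1le (fun m => fine (nconv (fun n => cnorm (a n)) (fun n => cnorm (b n)) m)) (n1 a * n1 b).
  split; first by rewrite mulr_ge0 ?n1_ge0.
  rewrite (@eq_sum R _ (nconv (fun n => cnorm (a n)) (fun n => cnorm (b n)))).
    by apply: nconv_l1 (n1P a) (n1P b) => ?; exact: cnorm_ge0.
  move=> j; rewrite fineK// ge0_fin_numE; last by apply: nconv_ge0 => ?; exact: cnorm_ge0.
  by apply: le_lt_trans (nconv_fin j _ _ (n2P a) (n2P b)) (ltry _) => ?; exact: cnorm_ge0.
apply: le_lt_trans (ltry (n1 a * n1 b * n1 w)).
have g0 j : 0 <= fine (nconv (fun n => cnorm (a n)) (fun n => cnorm (b n)) j).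
  by apply: fine_ge0; apply: nconv_ge0 => ?; exact: cnorm_ge0.
apply: le_trans (nconv_l1 _ _ l1 (n1P w)); [|exact: g0|by move=> ?; exact: cnorm_ge0].
apply: (@le_term_sum R (nconv _ _)) => j; apply: nconv_ge0 => // ?; exact: cnorm_ge0.
Qed.

Lemma cint_lin (z : C) (f g h : freq -> C) :
  cintegrable nu f -> cintegrable nu g -> cintegrable nu h ->
  cint nu (fun m => f m - g m - z * (h m - g m)) = cint nu f - cint nu g - z * (cint nu h - cint nu g).
Proof.
move=> hf hg hh.
rewrite (cintB (cintegrableB hf hg) (cintegrableZ z (cintegrableB hh hg))).
by rewrite (cintZ z (cintegrableB hh hg)) (cintB hf hg) (cintB hh hg).
Qed.

Lemma cint2_le_trip (G : freq -> freq -> C) k (c0 : R) f1 f2 f3 f4 : 0 <= c0 ->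
  (forall k, 0 <= f1 k) -> (forall k, 0 <= f2 k) -> (forall k, 0 <= f3 k) ->
  (forall k, 0 <= f4 k) ->
  (forall m, cintegrable nu (G m)) -> cintegrable nu (fun m => cint nu (G m)) ->
  (forall m n, cnorm (G m n) <= c0 * (f1 (k - m - n) * f1 n * f2 m
    + f1 (k - m - n) * f3 n * f4 m + f3 (k - m - n) * f1 n * f4 m)) ->
  ((cnorm (cint nu (fun m => cint nu (G m))))%:E <=
    c0%:E * (trip f1 f1 f2 k + trip f1 f3 f4 k + trip f3 f1 f4 k))%E.
Proof.
move=> c00 h1 h2 h3 h4 iG oG hG; apply: le_trans (cnorm_cint_le oG) _.
have p f g h m n : (forall k, 0 <= f k) -> (forall k, 0 <= g k) -> (forall k, 0 <= h k) ->
    (0 <= (f (k - m - n) * g n * h m)%:E :> \bar R)%E.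
  by move=> f0 g0 h0; rewrite lee_fin !mulr_ge0.
have q f g h m : (forall k, 0 <= f k) -> (forall k, 0 <= g k) -> (forall k, 0 <= h k) ->
    (0 <= \int[nu]_n (f (k - m - n) * g n * h m)%:E :> \bar R)%E.
  by move=> f0 g0 h0; apply: sum_ge0 => n; exact: p.
rewrite /trip -sum_add; [|by move=> m; exact: q..].
rewrite -sum_add; [|by move=> m; rewrite adde_ge0 ?q|by move=> m; exact: q].
rewrite -(sum_scale c00 (fun m =>
  adde_ge0 (adde_ge0 (q _ _ _ m h1 h1 h2) (q _ _ _ m h1 h3 h4)) (q _ _ _ m h3 h1 h4))).
apply: le_sum => m; first by rewrite lee_fin cnorm_ge0.
apply: le_trans (cnorm_cint_le (iG m)) _.
rewrite -sum_add; [|by move=> n; exact: p..].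
rewrite -sum_add; [|by move=> n; rewrite adde_ge0 ?p|by move=> n; exact: p].
rewrite -(sum_scale c00 (fun n =>
  adde_ge0 (adde_ge0 (p _ _ _ m n h1 h1 h2) (p _ _ _ m n h1 h3 h4)) (p _ _ _ m n h3 h1 h4))).
by apply: le_sum => n; rewrite lee_fin ?cnorm_ge0 ?hG.
Qed.

(** The remainder at time [s] of the linear interpolation of [exp (- i s
    th)] between the times 0 and [tau]. *)
Definition interp_sym (s tau th : R) : C :=
  cis (- s * th) - 1 - (s / tau)%:C * (cis (- tau * th) - 1).

(** The linear parts of the two exponentials cancel, and each one differs
    from its linear part by at most twice the square of its phase. *)
Lemma interp_sym_le s tau th : 0 <= s <= tau -> 0 < tau ->
  cnorm (interp_sym s tau th) <= 4 * tau ^+ 2 * th ^+ 2.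
Proof.
move=> /andP[s0 st] t0.
have -> : interp_sym s tau th =
    (cis (- s * th) - 1 - 'i * (- s * th)%:C)
    - (s / tau)%:C * (cis (- tau * th) - 1 - 'i * (- tau * th)%:C).
  have e : 'i * (- s * th)%:C = (s / tau)%:C * ('i * (- tau * th)%:C) :> C.
    rewrite mulrCA -rmorphM; congr (_ * (_)%:C).
    by rewrite !mulNr !mulrN mulrA divfK ?gt_eqF.
  by rewrite /interp_sym e; ring.
apply: le_trans (cnormB _ _) _; rewrite cnormM cnormR ger0_norm ?divr_ge0 ?(ltW t0)//.
have h1 := cis_sub1i_le (- s * th); have h2 := cis_sub1i_le (- tau * th).
have st1 : s / tau <= 1 by rewrite ler_pdivrMr// mul1r.
have h3 : s / tau * cnorm (cis (- tau * th) - 1 - 'i * (- tau * th)%:C) <=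
    2 * (- tau * th) ^+ 2.
  by rewrite -[leRHS]mul1r ler_pM ?divr_ge0 ?cnorm_ge0// ltW.
have h4 : (- s * th) ^+ 2 <= tau ^+ 2 * th ^+ 2.
  rewrite exprMn sqrrN ler_wpM2r ?sqr_ge0// lerXn2r ?nnegrE//; exact: ltW.
have h5 : (- tau * th) ^+ 2 = tau ^+ 2 * th ^+ 2 by rewrite exprMn sqrrN.
apply: le_trans (lerD h1 h3) _; rewrite h5.
have := ler_wpM2l (ler0n _ 2) h4; set y := tau ^+ 2 * th ^+ 2.
by rewrite -mulrA -/y => h6; apply: le_trans (lerD h6 (lexx _)) _; lra.
Qed.

(** The defect of the linear interpolation gains two powers of the step; by
    [defect_sqr] they cost one full derivative on each of two of the three
    factors, which [trip_l2] can afford when these are in [H^{3/2}]. *)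
Lemma twist_interp : exists2 C0 : R, 0 <= C0 & forall s tau a w, 0 <= s <= tau -> 0 < tau ->
  n2 (twist s a w - twist 0 a w - spec_cst (s / tau)%:C * (twist tau a w - twist 0 a w))
    <= C0 * tau ^+ 2 * (nH a * nH a * n1 w + 2 * (nH a * nH w * n1 a)).
Proof.
have [C0 C00 hC] := trip_l2.
exists (16 * C0) => [|s tau a w st t0]; first by rewrite mulr_ge0.
set X := (X in n2 X).
pose da k := jb k * cnorm (a k); pose dw k := jb k * cnorm (w k).
pose na k := cnorm (a k); pose nw k := cnorm (w k).
have da0 k : 0 <= da k by rewrite mulr_ge0 ?jb_ge0 ?cnorm_ge0.
have dw0 k : 0 <= dw k by rewrite mulr_ge0 ?jb_ge0 ?cnorm_ge0.
have na0 k : 0 <= na k by exact: cnorm_ge0.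
have nw0 k : 0 <= nw k by exact: cnorm_ge0.
have lda : l2le (fun k => Num.sqrt (jb k) * da k) (nH a).
  by apply: l2le_mono (lexx _) (nHP a) => k; rewrite mulr_ge0 ?sqrtr_ge0//= /da /habs /wH mulrA [_ * jb k]mulrC.
have ldw : l2le (fun k => Num.sqrt (jb k) * dw k) (nH w).
  by apply: l2le_mono (lexx _) (nHP w) => k; rewrite mulr_ge0 ?sqrtr_ge0//= /dw /habs /wH mulrA [_ * jb k]mulrC.
have [f12 l12] := hC da da nw _ _ _ da0 da0 nw0 lda lda (n1P w).
have [f13 l13] := hC da dw na _ _ _ da0 dw0 na0 lda ldw (n1P a).
pose G m n k : C := interp_sym s tau (defect k m n) * (a (k - m - n) * a n * w m).
have XE k : X k = cint nu (fun m => cint nu (fun n => G m n k)).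
  have ic (v : R) m : cintegrable nu (fun n => cis (- v * defect k m n) * (a (k - m - n) * a n * w m)).
    by apply: cis_integrable; exact: mul3_integrable.
  have oc (v : R) : cintegrable nu (fun m => cint nu (fun n => cis (- v * defect k m n) * (a (k - m - n) * a n * w m))).
    by apply: (@inner_integrable _ k a a w) => m n; rewrite cnormM cnorm_cis mul1r.
  pose z : C := (s / tau)%:C.
  pose J (v : R) m := cint nu (fun n => cis (- v * defect k m n) * (a (k - m - n) * a n * w m)).
  have oJ (v : R) : cintegrable nu (J v) by exact: oc.
  have e (p q r : spec R) j : (p - q - spec_cst z * (r - q)) j = p j - q j - z * (r j - q j).
    by rewrite [LHS]spec_subE [(p - q) j]spec_subE cstME [(r - q) j]spec_subE.
  have tJ v : twist v a w k = cint nu (J v) by exact: twistE.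
  transitivity (twist s a w k - twist 0 a w k - z * (twist tau a w k - twist 0 a w k)).
    exact: e.
  transitivity (cint nu (J s) - cint nu (J 0) - z * (cint nu (J tau) - cint nu (J 0))).
    by congr (_ - _ - z * (_ - _)); exact: tJ.
  rewrite -(cint_lin z (oJ s) (oJ 0) (oJ tau)).
  congr cint; apply/funext => m; rewrite /J.
  transitivity (cint nu (fun n =>
      cis (- s * defect k m n) * (a (k - m - n) * a n * w m)
      - cis (- 0 * defect k m n) * (a (k - m - n) * a n * w m)
      - z * (cis (- tau * defect k m n) * (a (k - m - n) * a n * w m)
      - cis (- 0 * defect k m n) * (a (k - m - n) * a n * w m)))).
    exact: (esym (cint_lin z (ic s m) (ic 0 m) (ic tau m))).
  congr cint; apply/funext => n; rewrite /G /interp_sym -/z oppr0 mul0r cis0; ring.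
have Gle m n k : cnorm (G m n k) <= 16 * tau ^+ 2 *
    (da (k - m - n) * da n * nw m + da (k - m - n) * na n * dw m + na (k - m - n) * da n * dw m).
  rewrite /G cnormM; have h1 := interp_sym_le (defect k m n) st t0.
  have h2 := @defect_sqr R (k - m - n) n m; rewrite !subrK in h2.
  have h2' : defect k m n ^+ 2 <= 4 * (jb (k - m - n) * jb n + jb (k - m - n) * jb m + jb n * jb m).
    apply: le_trans h2 _; rewrite ler_wpM2l//.
    by rewrite !lerD// ler_pM ?knorm_ge0 ?knorm_le_jb.
  have q0 : 0 <= cnorm (a (k - m - n) * a n * w m) by exact: cnorm_ge0.
  apply: le_trans (ler_wpM2r q0 h1) _.
  have t2 : 0 <= 4 * tau ^+ 2 by rewrite mulr_ge0 ?sqr_ge0.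
  apply: le_trans (ler_wpM2r q0 (ler_wpM2l t2 h2')) _.
  rewrite !cnormM /da /dw /na /nw le_eqVlt; apply/orP; left; apply/eqP; ring.
pose Y k := 16 * tau ^+ 2 * (fine (trip da da nw k) + fine (trip da dw na k) + fine (trip da dw na k)).
have t16 : 0 <= 16 * tau ^+ 2 by rewrite mulr_ge0 ?sqr_ge0.
have y1 k : 0 <= fine (trip da da nw k) by apply: fine_ge0; exact: trip_ge0.
have y2 k : 0 <= fine (trip da dw na k) by apply: fine_ge0; exact: trip_ge0.
have y12 k : 0 <= fine (trip da da nw k) + fine (trip da dw na k) by rewrite addr_ge0.
have lY : l2le Y (16 * tau ^+ 2 * (C0 * nH a * nH a * n1 w + C0 * nH a * nH w * n1 a + C0 * nH a * nH w * n1 a)).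
  by apply: l2le_scale => //; apply: l2le_add => //; exact: l2le_add.
have XY k : cnorm (X k) <= Y k.
  (* This cruder bound does not grow with the frequency, hence gives integrability. *)
  have i4 th : cnorm (interp_sym s tau th) <= 4.
    have [s0 st1] : 0 <= s / tau /\ s / tau <= 1.
      by case/andP: st => s0 s1; rewrite divr_ge0 ?(ltW t0)// ler_pdivrMr// mul1r.
    have h (y : R) : cnorm (cis y - 1 : C) <= 2.
      by apply: le_trans (cnormB _ _) _; rewrite cnorm_cis cnorm1; lra.
    apply: le_trans (cnormB _ _) _; rewrite cnormM cnormR ger0_norm//.
    have h1 := h (- s * th); have h2 := h (- tau * th).
    have := ler_pM s0 (cnorm_ge0 _) st1 h2; rewrite mul1r => h3.
    by apply: le_trans (lerD h1 h3) _; lra.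
  have Ga m n : cnorm (G m n k) <= cnorm (a (k - m - n) * (spec_cst 4 * a) n * w m).
    rewrite /G cnormM cstME [a (k - m - n) * (4 * _)]mulrCA -[4 * _ * w m]mulrA [leRHS]cnormM.
    rewrite (_ : cnorm 4 = 4); last first.
      by rewrite (_ : 4 = (4 : R)%:C :> C) ?cnormR ?ger0_norm ?rmorph_nat.
    by rewrite ler_wpM2r ?cnorm_ge0.
  have iG m : cintegrable nu (fun n => G m n k).
    split => //; apply: le_lt_trans (mul3_integrable a (spec_cst 4 * a) w k m).2.
    by apply: le_sum => n; rewrite lee_fin ?cnorm_ge0.
  have oG := inner_integrable Ga.
  rewrite XE -lee_fin /Y EFinM !EFinD !fineK//.
  rewrite -{2}(trip_perm23 da0 na0 dw0) (trip_perm12 da0 na0 dw0).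
  rewrite -(trip_perm23 da0 na0 dw0).
  by apply: (cint2_le_trip t16 da0 nw0 na0 dw0 iG oG) => m n; exact: Gle.
apply: n2_le; apply: l2le_mono lY => [k|]; first by rewrite cnorm_ge0 XY.
by rewrite le_eqVlt; apply/orP; left; apply/eqP; ring.
Qed.

End Trilinear.

(** * Interpolation of the Wiener norm *)

Section Interpolation.
Context {R : realType}.
Local Notation C := R[i].
Local Notation nu := (@freq_counting R).
Implicit Types (a b c w : spec R).

(** The tails of a convergent sum are small; convergence of the truncated
    sums is monotone convergence. *)
Lemma sum_jb3_tail (e : R) : 0 < e -> exists M : nat,
  (\int[nu]_k (if (jb k <= M%:R :> R)%R then 0 else (jb k)^-1 ^+ 3)%:E <= e%:E)%E.
Proof.
move=> e0; have [S S0 hS] := @sum_jb3 R.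
pose f (k : freq) := (jb k)^-1 ^+ 3 : R.
have f0 k : 0 <= f k by rewrite exprn_ge0// invr_ge0 jb_ge0.
pose g (M : nat) (k : freq) : \bar R := (if jb k <= M%:R :> R then f k else 0)%:E.
have g0 M k : (0 <= g M k)%E by rewrite /g; case: ifP => _; rewrite lee_fin.
have lim_g k : limn (g ^~ k) = (f k)%:E.
  apply/cvg_lim => //; apply: cvg_near_cst.
  near=> M; rewrite /g ifT//; near: M; exact: nbhs_infty_ger.
have mcv : (\int[nu]_k g M k)%E @[M --> \oo] --> (\int[nu]_k (f k)%:E)%E.
  rewrite (@eq_sum R _ (fun k => limn (g ^~ k))); last by move=> k; rewrite lim_g.
  apply: cvg_monotone_convergence => // k _ M N MN.
  rewrite /g; case: ifP => kM; last by case: ifP => _; rewrite lee_fin.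
  by rewrite ifT// (le_trans kM)// ler_nat.
move: mcv; set I := (\int[nu]_k (f k)%:E)%E.
have Ioo : (I < +oo)%E by exact: le_lt_trans hS (ltry _).
have fI : I \is a fin_num.
  by rewrite ge0_fin_numE//; apply: sum_ge0 => k; rewrite lee_fin.
rewrite -(fineK fI) => /fine_cvgP[_ /cvgrPdist_le /(_ e e0)] [M _ /(_ M (leqnn _))] /= hM.
exists M.
have gle : (\int[nu]_k g M k <= I)%E.
  by apply: le_sum => // k; rewrite /g lee_fin; case: ifP.
have gf : (\int[nu]_k g M k)%E \is a fin_num.
  by rewrite ge0_fin_numE; [exact: le_lt_trans gle Ioo|exact: sum_ge0].
pose r (k : freq) : \bar R := (if jb k <= M%:R :> R then 0 else f k)%:E.
have r0 k : (0 <= r k)%E by rewrite /r; case: ifP => _; rewrite lee_fin.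
rewrite -/(\int[nu]_k r k)%E; set J := (\int[nu]_k _)%E.
have eI : I = (\int[nu]_k g M k + J)%E.
  rewrite -(sum_add (g0 M) r0).
  by apply: eq_sum => k; rewrite /g /r; case: ifP => _; rewrite ?adde0 ?add0e.
have J0 : (0 <= J)%E by exact: sum_ge0.
have JI : (J <= I)%E by rewrite eI leeDr// sum_ge0.
have Jf : J \is a fin_num.
  by rewrite ge0_fin_numE//; exact: le_lt_trans JI Ioo.
rewrite -(fineK Jf) lee_fin.
have eF : fine I = fine (\int[nu]_k g M k)%E + fine J by rewrite -fineD// -eI.
move: hM; rewrite eF addrC addKr; exact: le_trans (ler_norm _).
Unshelve. all: end_near. Qed.

(** Low frequencies are finitely many up to the weight and are controlled by
    the [L^2] norm; on high frequencies the embedding constant of [n1_emb]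
    is small. *)
Lemma n1_interp (e : R) : 0 < e -> exists2 Ce, 0 <= Ce &
  forall a, n1 a <= Ce * n2 a + e * nH a.
Proof.
move=> e0; have [S S0 hS] := @sum_jb3 R.
have e20 : 0 < e ^+ 2 by rewrite exprn_gt0.
have [M hM] := sum_jb3_tail e20.
pose p (k : freq) : R := if jb k <= M%:R :> R then 0 else (wH k)^-1.
have p0 k : 0 <= p k by rewrite /p; case: ifP => // _; rewrite invr_ge0 wH_ge0.
exists (M%:R ^+ 2 * Num.sqrt S) => [|a]; first by rewrite mulr_ge0 ?sqrtr_ge0 ?sqr_ge0.
have lp : l2le p e.
  split; first exact: ltW.
  apply: le_trans hM; apply: le_sum => k; first by rewrite lee_fin sqr_ge0.
  by rewrite lee_fin /p; case: ifP => _; rewrite ?expr0n// !exprVn sqr_wH.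
have lw : l2le (fun k => (wH k)^-1 : R) (Num.sqrt S).
  split; first exact: sqrtr_ge0.
  rewrite sqr_sqrtr//; apply: le_trans hS; apply: le_sum => k.
    by rewrite lee_fin sqr_ge0.
  by rewrite !exprVn sqr_wH.
have w0 k : 0 <= (wH k)^-1 :> R by rewrite invr_ge0 wH_ge0.
have h1 := sum_CS p0 (habs_ge0 a) lp (nHP a).
have h2 := sum_CS w0 (fun k => cnorm_ge0 (a k)) lw (n2P a).
have M20 : 0 <= M%:R ^+ 2 :> R by exact: sqr_ge0.
apply: n1_le; split; first by rewrite addr_ge0 ?mulr_ge0 ?sqrtr_ge0 ?n2_ge0 ?nH_ge0// ltW.
have n0 k : (0 <= ((wH k)^-1 * cnorm (a k))%:E)%E by rewrite lee_fin mulr_ge0 ?cnorm_ge0.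
have h2' : ((M%:R ^+ 2)%:E * \int[nu]_k ((wH k)^-1 * cnorm (a k))%:E <=
    (M%:R ^+ 2 * Num.sqrt S * n2 a)%:E)%E.
  by rewrite -mulrA [leRHS]EFinM; apply: lee_wpmul2l; rewrite ?lee_fin.
rewrite EFinD; apply: le_trans (leeD h2' h1).
have a1 k : (0 <= (M%:R ^+ 2)%:E * ((wH k)^-1 * cnorm (a k))%:E)%E by rewrite mule_ge0.
have a2 k : (0 <= (p k * habs a k)%:E)%E by rewrite lee_fin mulr_ge0// habs_ge0.
rewrite -(sum_scale M20 n0) -(sum_add a1 a2).
apply: le_sum => k; first by rewrite lee_fin cnorm_ge0.
rewrite -EFinM -EFinD lee_fin /p; case: ifP => kM.
  rewrite mul0r addr0 mulrA ler_peMl ?cnorm_ge0//.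
  rewrite ler_pdivlMr ?wH_gt0// mul1r.
  have j1 := @jb_ge1 R k.
  have M1 : 1 <= M%:R :> R by exact: le_trans kM.
  apply: le_trans (_ : jb k * jb k <= _).
    rewrite /wH ler_wpM2l ?jb_ge0// -{2}(ger0_norm (@jb_ge0 R k)) -sqrtr_sqr.
    by rewrite ler_wsqrtr// expr2 ler_peMl ?jb_ge0.
  by rewrite expr2 ler_pM ?jb_ge0.
rewrite /habs mulKf; last by rewrite gt_eqF// wH_gt0.
by rewrite lerDr -lee_fin; exact: a1.
Qed.

End Interpolation.

(** * The half-wave group and product estimates *)

Section Flow.
Context {R : realType}.
Local Notation C := R[i].
Implicit Types (a b c w : spec R) (s t h : R).

Lemma n2_le_pt (d : R) a b : 0 <= d -> (forall k, cnorm (a k) <= d * cnorm (b k)) ->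
  n2 a <= d * n2 b.
Proof.
move=> d0 ab; apply: n2_le; apply: l2le_mono (lexx _) (l2le_scale d0 (n2P b)) => k.
by rewrite cnorm_ge0 ab.
Qed.

(** A symbol of size [jb] costs one derivative, and one and a half are
    available. *)
Lemma n2_le_jb (d : R) a b : 0 <= d -> (forall k, cnorm (a k) <= d * jb k * cnorm (b k)) ->
  n2 a <= d * nH b.
Proof.
move=> d0 ab; apply: n2_le; apply: l2le_mono (lexx _) (l2le_scale d0 (nHP b)) => k.
rewrite cnorm_ge0; apply: le_trans (ab k) _.
rewrite /habs mulrA ler_wpM2r ?cnorm_ge0// ler_wpM2l// /wH ler_peMr ?jb_ge0//.
by rewrite -sqrtr1 ler_wsqrtr// jb_ge1.
Qed.

Lemma n1_flow t a : n1 (flow t a) = n1 a.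
Proof. by apply/le_anti/andP; split; apply: n1_mono => k; rewrite cnorm_flow. Qed.

Lemma n2_flow t a : n2 (flow t a) = n2 a.
Proof. by apply/le_anti/andP; split; apply: n2_mono => k; rewrite cnorm_flow. Qed.

Lemma nH_flow t a : nH (flow t a) = nH a.
Proof. by apply/le_anti/andP; split; apply: nH_mono => k; rewrite cnorm_flow. Qed.

Lemma flowD t a b : flow t (a + b) = flow t a + flow t b.
Proof. rewrite flow.unlock; exact: (bmultD (flow_sym_le t)). Qed.

Lemma flowN t a : flow t (- a) = - flow t a.
Proof. rewrite flow.unlock; exact: (bmultN (flow_sym_le t)). Qed.

Lemma flowB t a b : flow t (a - b) = flow t a - flow t b.
Proof. rewrite flow.unlock; exact: (bmultB (flow_sym_le t)). Qed.

Lemma flowZ t z a : flow t (spec_cst z * a) = spec_cst z * flow t a.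
Proof. rewrite flow.unlock; exact: (bmultZ (flow_sym_le t)). Qed.

Lemma flow_flow s t a : flow s (flow t a) = flow (s + t) a.
Proof. by apply: spec_ext => k; rewrite !flowE mulrA -cisD mulrDl. Qed.

Lemma flow0 a : flow 0 a = a.
Proof. by apply: spec_ext => k; rewrite flowE mul0r cis0 mul1r. Qed.

Lemma flowK t a : flow t (flow (- t) a) = a.
Proof. by rewrite flow_flow subrr flow0. Qed.

Lemma flowNK t a : flow (- t) (flow t a) = a.
Proof. by rewrite flow_flow addNr flow0. Qed.

Lemma conjs_flow t a : conjs (flow t a) = flow (- t) (conjs a).
Proof.
by apply: spec_ext => k; rewrite conjsE !flowE conjM conj_cis knormN mulNr conjsE.
Qed.

(** One derivative buys one power of [t]. *)
Lemma flow_sub_le t a : 0 <= t -> n2 (flow t a - a) <= t * nH a.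
Proof.
move=> t0; apply: n2_le_jb => // k.
rewrite spec_subE flowE -{2}[a k]mul1r -mulrBl cnormM ler_wpM2r ?cnorm_ge0//.
apply: le_trans (cis_sub1_le _) _.
by rewrite ger0_norm ?mulr_ge0 ?knorm_ge0// ler_wpM2l// knorm_le_jb.
Qed.

(** The nonlinearity [|a|^2 a] and the second-order term [|a|^4 a]. *)
Definition cubic a := a * a * conjs a.
Definition quintic a := a * a * a * (conjs a * conjs a).

(** In this and the following lemmas the norms are replaced by given upper
    bounds, so that estimates of polynomial expressions compose without
    intermediate inequalities. *)
Lemma n2_mul (P Q : R) a b : n1 a <= P -> n2 b <= Q -> n2 (a * b) <= P * Q.
Proof. by move=> h1 h2; apply: le_trans (n2M _ _) _; rewrite ler_pM ?n1_ge0 ?n2_ge0. Qed.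

Lemma n1_mul (P Q : R) a b : n1 a <= P -> n1 b <= Q -> n1 (a * b) <= P * Q.
Proof. by move=> h1 h2; apply: le_trans (n1M _ _) _; rewrite ler_pM ?n1_ge0. Qed.

Lemma nH_mul (P Q S T : R) a b : n1 a <= P -> n1 b <= Q -> nH a <= S -> nH b <= T ->
  nH (a * b) <= 3 * (P * T + Q * S).
Proof.
move=> h1 h2 h3 h4; apply: le_trans (nHM _ _) _.
by rewrite ler_wpM2l// lerD// ler_pM ?n1_ge0 ?nH_ge0.
Qed.

Lemma n1_add (P Q : R) a b : n1 a <= P -> n1 b <= Q -> n1 (a + b) <= P + Q.
Proof. by move=> h1 h2; apply: le_trans (n1D _ _) _; rewrite lerD. Qed.

Lemma n2_add (P Q : R) a b : n2 a <= P -> n2 b <= Q -> n2 (a + b) <= P + Q.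
Proof. by move=> h1 h2; apply: le_trans (n2D _ _) _; rewrite lerD. Qed.

Lemma nH_add (P Q : R) a b : nH a <= P -> nH b <= Q -> nH (a + b) <= P + Q.
Proof. by move=> h1 h2; apply: le_trans (nHD _ _) _; rewrite lerD. Qed.

Lemma n1_sub (P Q : R) a b : n1 a <= P -> n1 b <= Q -> n1 (a - b) <= P + Q.
Proof. by move=> h1 h2; apply: n1_add; rewrite ?n1N. Qed.

Lemma n2_sub (P Q : R) a b : n2 a <= P -> n2 b <= Q -> n2 (a - b) <= P + Q.
Proof. by move=> h1 h2; apply: n2_add; rewrite ?n2N. Qed.

Lemma nH_sub (P Q : R) a b : nH a <= P -> nH b <= Q -> nH (a - b) <= P + Q.
Proof. by move=> h1 h2; apply: nH_add; rewrite ?nHN. Qed.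

Lemma n2_scal (z : C) (c Q : R) a : cnorm z <= c -> n2 a <= Q -> n2 (spec_cst z * a) <= c * Q.
Proof.
by move=> h1 h2; apply: le_trans (n2_cst _ _) _; rewrite ler_pM ?cnorm_ge0 ?n2_ge0.
Qed.

Lemma n1_scal (z : C) (c Q : R) a : cnorm z <= c -> n1 a <= Q -> n1 (spec_cst z * a) <= c * Q.
Proof.
by move=> h1 h2; apply: le_trans (n1_cst _ _) _; rewrite ler_pM ?cnorm_ge0 ?n1_ge0.
Qed.

Lemma nH_scal (z : C) (c Q : R) a : cnorm z <= c -> nH a <= Q -> nH (spec_cst z * a) <= c * Q.
Proof.
by move=> h1 h2; apply: le_trans (nH_cst _ _) _; rewrite ler_pM ?cnorm_ge0 ?nH_ge0.
Qed.

Lemma n1_cubic (A : R) a : n1 a <= A -> n1 (cubic a) <= A * A * A.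
Proof. by move=> h; apply: (n1_mul (n1_mul h h)); rewrite n1_conjs. Qed.

Lemma nH_cubic (A : R) a : n1 a <= A -> nH a <= A -> nH (cubic a) <= 21 * (A * A * A).
Proof.
move=> h h'.
have h2 := nH_mul h h h' h'.
have := nH_mul (n1_mul h h) (_ : n1 (conjs a) <= A) h2 (_ : nH (conjs a) <= A).
rewrite n1_conjs nH_conjs => /(_ h h') h3; apply: le_trans h3 _.
by rewrite le_eqVlt; apply/orP; left; apply/eqP; ring.
Qed.

Lemma nH_quintic (A B : R) a : n1 a <= A -> nH a <= B ->
  nH (quintic a) <= 81 * (A * A * A * A * B).
Proof.
move=> h h'.
have h2 := nH_mul h h h' h'.
have h3 := nH_mul (n1_mul h h) h h2 h'.
have hc : n1 (conjs a) <= A by rewrite n1_conjs.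
have hc' : nH (conjs a) <= B by rewrite nH_conjs.
have h4 := nH_mul hc hc hc' hc'.
have h5 := nH_mul (n1_mul (n1_mul h h) h) (n1_mul hc hc) h3 h4.
apply: le_trans h5 _.
have A0 : 0 <= A := le_trans (n1_ge0 _) h; have B0 : 0 <= B := le_trans (nH_ge0 _) h'.
have : 0 <= A * A * A * A * B by rewrite !mulr_ge0.
set X := A * A * A * A * B => X0.
have -> : 3 * (A * A * A * (3 * (A * B + A * B))
   + A * A * (3 * (A * A * B + A * (3 * (A * B + A * B))))) = 81 * X.
  by rewrite /X; ring.
by [].
Qed.

Lemma cubic_lip (A : R) a b : n1 a <= A -> n1 b <= A ->
  n2 (cubic a - cubic b) <= 3 * (A * A) * n2 (a - b).
Proof.
move=> ha hb.
have -> : cubic a - cubic b =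
    (a * conjs a + b * conjs a) * (a - b) + b * b * conjs (a - b).
  by rewrite /cubic conjsB; ring.
have hca : n1 (conjs a) <= A by rewrite n1_conjs.
have h1 := n2_mul (n1_add (n1_mul ha hca) (n1_mul hb hca)) (lexx (n2 (a - b))).
have h2 := n2_mul (n1_mul hb hb) (lexx (n2 (conjs (a - b)))).
have h3 := n2_add h1 h2; rewrite n2_conjs in h3.
apply: le_trans h3 _.
by rewrite le_eqVlt; apply/orP; left; apply/eqP; ring.
Qed.

End Flow.

(** * Duhamel expansion of the solution to second order *)

Section Increments.
Context {R : realType}.
Implicit Types (D : R -> spec R).

Lemma n2_0 : n2 (0 : spec R) = 0.
Proof.
apply/le_anti; rewrite n2_ge0 andbT; apply: le_trans (_ : cnorm (0 : R[i]) * n2 (0 : spec R) <= _).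
  by rewrite -{1}(mulr0 (spec_cst 0)); exact: n2_cst.
by rewrite cnorm0 mul0r.
Qed.

(** Mean value inequality: increments that are small up to a quadratic
    remainder add up, and the remainder disappears with the mesh. The
    constant [K] may therefore be arbitrarily bad, for instance depend on
    [tau]. *)
Lemma n2_mean_value D (tau M K : R) : 0 <= tau -> 0 <= K ->
  (forall s h, 0 <= s -> 0 <= h -> s + h <= tau -> n2 (D (s + h) - D s) <= h * M + K * h ^+ 2) ->
  n2 (D tau - D 0) <= tau * M.
Proof.
move=> t0 K0 hD; apply/ler_addgt0Pr => e e0.
(* The remainders of [N] equal steps add up to [K * tau ^+ 2 / N]. *)
have [N hN] : exists N : nat, K * tau ^+ 2 / e < N.+1%:R.
  exists (Num.truncn (K * tau ^+ 2 / e)); apply: truncnS_gt.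
have N0 : 0 < N.+1%:R :> R by rewrite ltr0n.
pose h := tau / N.+1%:R; have h0 : 0 <= h by rewrite divr_ge0// ltW.
have step i : (i <= N.+1)%N -> n2 (D (i%:R * h) - D 0) <= i%:R * (h * M + K * h ^+ 2).
  elim: i => [_|i IH iN]; first by rewrite !mul0r subrr n2_0.
  have -> : D (i.+1%:R * h) - D 0 = (D (i%:R * h + h) - D (i%:R * h)) + (D (i%:R * h) - D 0).
    by rewrite -natr1 mulrDl mul1r addrA subrK.
  apply: le_trans (n2D _ _) _; rewrite -natr1 [leRHS]mulrDl mul1r [leRHS]addrC lerD ?IH 1?ltnW//.
  apply: hD => //; first by rewrite mulr_ge0.
  have -> : i%:R * h + h = i.+1%:R * h by rewrite -natr1 mulrDl mul1r.
  by rewrite /h mulrCA ler_piMr// ler_pdivrMr// mul1r ler_nat.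
have := step N.+1 (leqnn _); rewrite [N.+1%:R * h]mulrC divfK ?gt_eqF//.
move=> le1; apply: le_trans le1 _.
have -> : N.+1%:R * (h * M + K * h ^+ 2) = tau * M + K * tau ^+ 2 / N.+1%:R.
  by rewrite /h; field; rewrite gt_eqF.
by rewrite lerD2l ler_pdivrMr// [leRHS]mulrC -ler_pdivrMr// ltW.
Qed.

End Increments.

Section LocalError.
Context {R : realType}.
Local Notation C := R[i].
Implicit Types (a b c w : spec R) (sg s t h tau T A : R).

(** The factor [i] with the sign of the nonlinearity. *)
Definition sig sg : spec R := spec_cst (sg%:C * 'i).

Lemma sig_sqr sg : sg * sg = 1 -> sig sg * sig sg = -1.
Proof.
move=> h; rewrite /sig -rmorphM.
have -> : sg%:C * 'i * (sg%:C * 'i) = -1 :> C by rewrite mulrACA mul_ii -rmorphM h mul1r.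
by rewrite rmorphN rmorph1.
Qed.

Lemma cnorm_sig sg : sg * sg = 1 -> cnorm (sg%:C * 'i : C) = 1.
Proof.
move=> h; rewrite cnormM cnorm_i mulr1 cnormR.
by apply/eqP; rewrite -(@eqrXn2 _ 2) ?normr_ge0// expr1n real_normK ?num_real// expr2 h.
Qed.

Lemma conjs_sig sg : conjs (sig sg) = - sig sg.
Proof.
rewrite /sig conjs_cst -rmorphN; congr spec_cst.
by apply: complex_ext => /=; ring.
Qed.

(** All that the error analysis uses of a mild solution. The last two
    conditions express Duhamel's formula between two times without an
    integral: an integral is [h w] up to [h L] if the integrand stays within
    [L] of [w] in [L^2], and at most [h L] if the integrand is at most [L]
    in the Wiener norm. *)
Definition mild_path sg T A (U : R -> spec R) : Prop :=
  [/\ 0 <= A,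
      forall t, 0 <= t <= T -> n1 (U t) <= A /\ nH (U t) <= A,
      forall t1 t2 w L, 0 <= t1 -> t1 <= t2 -> t2 <= T ->
        (forall x, t1 <= x <= t2 -> n2 (flow (t2 - x) (cubic (U x)) - w) <= L) ->
        n2 (U t2 - flow (t2 - t1) (U t1) + sig sg * spec_cst (t2 - t1)%:C * w) <= (t2 - t1) * L &
      forall t1 t2 L, 0 <= t1 -> t1 <= t2 -> t2 <= T ->
        (forall x, t1 <= x <= t2 -> n1 (cubic (U x)) <= L) ->
        n1 (U t2 - flow (t2 - t1) (U t1)) <= (t2 - t1) * L].

(** Expansion of the cubic nonlinearity at [b + r], where [r = p - i s |a|^2
    a] and [p] is a remainder. The first-order terms in [- i s |a|^2 a],
    taken at [a] instead of [b], add up to [- i * i] times [s |a|^4 a]; the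
    last line of the identity is what separates this from [s |a|^4 a], and
    vanishes for [i * i = - 1]. *)
Lemma second_order_identity (i s a Ja b Jb p Jp : spec R) :
  let n := a * a * Ja in let Jn := Ja * Ja * a in
  let r := p - i * s * n in let Jr := Jp + i * s * Jn in
  i * ((b + r) * (b + r) * (Jb + Jr) - b * b * Jb) - s * (a * a * a * (Ja * Ja)) =
  i * ((b * Jb + b * Jb) * p + b * b * Jp)
  + i * ((b * Jr + b * Jr + Jb * r + r * Jr) * r)
  - (i * i * s) * ((b * Jb - a * Ja) * n + (b * Jb - a * Ja) * n - (b * b - a * a) * Jn)
  - (i * i + 1) * s * (a * a * a * (Ja * Ja)).
Proof. by move=> n Jn r Jr; rewrite /r /Jr /n /Jn; ring. Qed.

(** The bounds of [path_duhamel] and [path_second_order], for a solution of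
    size [A]. *)
Definition duhamel_cst A := 3 * (A * A) * (A * A * A + A) + 21 * (A * A * A).

Definition second_cst A := 3 * (A * A) * (duhamel_cst A + 21 * (A * A * A))
  + 5 * A * (A * A * A) * (A * A * A) + 6 * (A * A) * (A * A * A).

Section Path.
Variables (sg T A : R) (U : R -> spec R).
Hypotheses (sg1 : sg * sg = 1) (hU : mild_path sg T A U).

Let A0 : 0 <= A. Proof. by case: hU. Qed.
Let hn1 t : 0 <= t -> t <= T -> n1 (U t) <= A.
Proof. by move=> t0 tT; case: hU => _ /(_ t) + _ _; rewrite t0 tT => /(_ isT)[]. Qed.
Let hnH t : 0 <= t -> t <= T -> nH (U t) <= A.
Proof. by move=> t0 tT; case: hU => _ /(_ t) + _ _; rewrite t0 tT => /(_ isT)[]. Qed.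
Let hn2 t : 0 <= t -> t <= T -> n2 (U t) <= A.
Proof. by move=> t0 tT; apply: le_trans (n2_le_n1 _) (hn1 t0 tT). Qed.

Lemma path_diff1 t h : 0 <= t -> 0 <= h -> t + h <= T ->
  n1 (U (t + h) - flow h (U t)) <= h * (A * A * A).
Proof.
have e : t + h - t = h by ring.
move=> t0 h0 tT; case: hU => _ _ _ /(_ t (t + h) (A * A * A) t0); rewrite lerDl e.
apply=> // x /andP[tx xt]; apply: n1_cubic; apply: hn1; first exact: le_trans tx.
exact: le_trans xt tT.
Qed.

Lemma path_diff2 t h : 0 <= t -> 0 <= h -> t + h <= T ->
  n2 (U (t + h) - flow h (U t)) <= h * (A * A * A).
Proof. by move=> *; apply: le_trans (n2_le_n1 _) (path_diff1 _ _ _). Qed.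

(** Duhamel's integrand differs from its initial value by [O(h)]: the
    nonlinearity is Lipschitz in [L^2], and the group moves [U t] and [cubic
    (U t)] by [O(h)] because they are in [H^{3/2}]. *)
Lemma path_duhamel t h : 0 <= t -> 0 <= h -> t + h <= T ->
  n2 (U (t + h) - flow h (U t) + sig sg * spec_cst h%:C * flow h (cubic (U t))) <= h * (h * duhamel_cst A).
Proof.
have e : t + h - t = h by ring.
move=> t0 h0 tT; case: hU => _ _ + _.
move=> /(_ t (t + h) (flow h (cubic (U t))) (h * duhamel_cst A) t0); rewrite lerDl e.
apply=> // x /andP[tx xt].
pose d := x - t; have d0 : 0 <= d by rewrite subr_ge0.
have dh : d <= h by rewrite lerBlDl.
have ex : x = t + d by rewrite /d addrC subrK.
have xT : t + d <= T by rewrite -ex; exact: le_trans xt tT.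
have tT' : t <= T by apply: le_trans tT; rewrite lerDl.
have -> : t + h - x = h - d by rewrite ex; ring.
have -> : flow h (cubic (U t)) = flow (h - d) (flow d (cubic (U t))).
  by rewrite flow_flow subrK.
rewrite -flowB n2_flow ex.
have -> : cubic (U (t + d)) - flow d (cubic (U t)) =
  (cubic (U (t + d)) - cubic (U t)) - (flow d (cubic (U t)) - cubic (U t)) by ring.
have l1 : n2 (U (t + d) - U t) <= d * (A * A * A) + d * A.
  have -> : U (t + d) - U t = (U (t + d) - flow d (U t)) + (flow d (U t) - U t) by ring.
  apply: n2_add; first exact: path_diff2.
  by apply: le_trans (flow_sub_le _ d0) _; rewrite ler_wpM2l// hnH.
have l2 : n2 (cubic (U (t + d)) - cubic (U t)) <= 3 * (A * A) * (d * (A * A * A) + d * A).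
  apply: le_trans (cubic_lip (hn1 _ xT) (hn1 t0 tT')) _; first by rewrite addr_ge0.
  by rewrite ler_wpM2l// !mulr_ge0.
have l3 : n2 (flow d (cubic (U t)) - cubic (U t)) <= d * (21 * (A * A * A)).
  by apply: le_trans (flow_sub_le _ d0) _; rewrite ler_wpM2l// nH_cubic// ?hn1 ?hnH.
apply: le_trans (n2_sub l2 l3) _.
have -> : 3 * (A * A) * (d * (A * A * A) + d * A) + d * (21 * (A * A * A)) = d * duhamel_cst A.
  by rewrite /duhamel_cst; ring.
by rewrite ler_wpM2r// /duhamel_cst addr_ge0// !mulr_ge0// addr_ge0// !mulr_ge0.
Qed.

(** The correction [- i s |a|^2 a] to the linear evolution changes the cubic
    nonlinearity at first order by a multiple of [s |a|^4 a]; see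
    [second_order_identity]. Quadratic terms are of size [s^2] thanks to the
    Wiener bound of [path_diff1] on one of the two factors. *)
Lemma path_second_order t s : 0 <= t -> 0 <= s -> t + s <= T ->
  n2 (sig sg * (cubic (U (t + s)) - cubic (flow s (U t)))
      - spec_cst s%:C * quintic (U t)) <= s ^+ 2 * second_cst A.
Proof.
move=> t0 s0 tT; have tT' : t <= T by apply: le_trans tT; rewrite lerDl.
set a := U t; set b := flow s a; set i := sig sg; set S := spec_cst s%:C.
have a1 : n1 a <= A by exact: hn1.
have aH : nH a <= A by exact: hnH.
have a2 : n2 a <= A by exact: hn2.
have b1 : n1 b <= A by rewrite n1_flow.
have Ja1 : n1 (conjs a) <= A by rewrite n1_conjs.
have Jb1 : n1 (conjs b) <= A by rewrite n1_conjs.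
(* [r] is the nonlinear correction to the linear evolution, and [p] what is left
   of it after the first-order term. *)
pose r := U (t + s) - b; pose p := r + i * S * cubic a.
have er : r = p - i * S * (a * a * conjs a) by rewrite /p /cubic addrK.
have eJ : conjs r = conjs p + i * S * (conjs a * conjs a * a).
  rewrite er conjsB !conjsM conjs_sig conjsK /S conjs_cst conjc_real -/S -/i; ring.
have r1 : n1 r <= s * (A * A * A) by exact: path_diff1.
have r1' : n1 r <= A + A by apply: n1_sub => //; rewrite hn1// addr_ge0.
have r2 : n2 r <= s * (A * A * A) by exact: path_diff2.
have Jr1 : n1 (conjs r) <= s * (A * A * A) by rewrite n1_conjs.
have Jr1' : n1 (conjs r) <= A + A by rewrite n1_conjs.
have cS : cnorm (s%:C : C) <= s by rewrite cnormR ger0_norm.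
have ci : cnorm (sg%:C * 'i : C) <= 1 by rewrite cnorm_sig.
pose K2 := duhamel_cst A + 21 * (A * A * A).
have p2 : n2 p <= s ^+ 2 * K2.
  have -> : p = (r + i * S * flow s (cubic a)) - i * (S * (flow s (cubic a) - cubic a)).
    by rewrite /p; ring.
  have l1 := path_duhamel t0 s0 tT.
  have l2 := flow_sub_le (cubic a) s0.
  have l3 := n2_scal ci (n2_scal cS (le_trans l2 (ler_wpM2l s0 (nH_cubic a1 aH)))).
  by apply: le_trans (n2_sub l1 l3) _; rewrite le_eqVlt; apply/orP; left; apply/eqP; rewrite /K2; ring.
have -> : i * (cubic (U (t + s)) - cubic b) - S * quintic a =
  i * ((b * conjs b + b * conjs b) * p + b * b * conjs p)
  + i * ((b * conjs r + b * conjs r + conjs b * r + r * conjs r) * r)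
  - (i * i * S) * ((b * conjs b - a * conjs a) * cubic a + (b * conjs b - a * conjs a) * cubic a
       - (b * b - a * a) * conjs (cubic a)).
  have eU : U (t + s) = b + r by rewrite /r [b + _]addrC subrK.
  have id := second_order_identity i S a (conjs a) b (conjs b) p (conjs p).
  rewrite /= -er -eJ (sig_sqr sg1) addNr !mul0r subr0 in id.
  have eJc : conjs (cubic a) = conjs a * conjs a * a by rewrite /cubic !conjsM conjsK.
  by rewrite eJc (sig_sqr sg1) eU /quintic /cubic [conjs (b + r)]conjsD id.
have ba2 : n2 (b - a) <= s * A.
  by apply: le_trans (flow_sub_le _ s0) _; rewrite ler_wpM2l.
have c1 : n1 (cubic a) <= A * A * A by exact: n1_cubic.
have Jc1 : n1 (conjs (cubic a)) <= A * A * A by rewrite n1_conjs.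
have bJb2 : n2 (b * conjs b - a * conjs a) <= (A + A) * (s * A).
  have -> : b * conjs b - a * conjs a = conjs b * (b - a) + a * conjs (b - a).
    by rewrite conjsB; ring.
  have h1 := n2_mul Jb1 ba2; have := n2_mul a1 (_ : n2 (conjs (b - a)) <= s * A).
  rewrite n2_conjs => /(_ ba2) h2; rewrite mulrDl; exact: n2_add.
have bb2 : n2 (b * b - a * a) <= (A + A) * (s * A).
  have -> : b * b - a * a = (b + a) * (b - a) by ring.
  exact: n2_mul (n1_add b1 a1) ba2.
have l1 : n2 (i * ((b * conjs b + b * conjs b) * p + b * b * conjs p)) <=
    1 * ((A * A + A * A) * (s ^+ 2 * K2) + A * A * (s ^+ 2 * K2)).
  apply: n2_scal => //; apply: n2_add.
    exact: n2_mul (n1_add (n1_mul b1 Jb1) (n1_mul b1 Jb1)) p2.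
  by apply: n2_mul (n1_mul b1 b1) _; rewrite n2_conjs.
have l2 : n2 (i * ((b * conjs r + b * conjs r + conjs b * r + r * conjs r) * r)) <=
    1 * ((A * (s * (A * A * A)) + A * (s * (A * A * A)) + A * (s * (A * A * A))
      + (A + A) * (s * (A * A * A))) * (s * (A * A * A))).
  apply: n2_scal => //; apply: n2_mul r2.
  apply: n1_add (n1_mul r1' Jr1); apply: n1_add (n1_mul Jb1 r1).
  exact: n1_add (n1_mul b1 Jr1) (n1_mul b1 Jr1).
have l3 : n2 ((i * i * S) * ((b * conjs b - a * conjs a) * cubic a
       + (b * conjs b - a * conjs a) * cubic a - (b * b - a * a) * conjs (cubic a))) <=
   1 * (1 * (s * (A * A * A * ((A + A) * (s * A)) + A * A * A * ((A + A) * (s * A))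
       + A * A * A * ((A + A) * (s * A))))).
  move: bJb2 bb2; set dJ := b * conjs b - a * conjs a; set d2 := b * b - a * a.
  have -> : i * i * S * (dJ * cubic a + dJ * cubic a - d2 * conjs (cubic a)) =
      i * (i * (S * (cubic a * dJ + cubic a * dJ - conjs (cubic a) * d2))) by ring.
  move=> bJb2 bb2; apply: n2_scal => //; apply: n2_scal => //; apply: n2_scal => //.
  apply: n2_sub (n2_mul Jc1 bb2).
  exact: n2_add (n2_mul c1 bJb2) (n2_mul c1 bJb2).
apply: le_trans (n2_sub (n2_add l1 l2) l3) _.
by rewrite le_eqVlt; apply/orP; left; apply/eqP; rewrite /second_cst -/K2; ring.
Qed.

End Path.
End LocalError.

(** * The local error *)

(** Conjugation turns [exp (i s |k|)] into [exp (- i s |k|)], and the moving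
    frame doubles it: hence the argument [- 2 |k|]. *)
HB.lock Definition fphi1 {R : realType} (tau : R) (a : spec R) : spec R :=
  bmult (fun k => phi1 ('i * (-2 * knorm k * tau)%:C)) a.

HB.lock Definition fphi2 {R : realType} (tau : R) (a : spec R) : spec R :=
  bmult (fun k => phi2 ('i * (-2 * knorm k * tau)%:C)) a.

HB.lock Definition fprim1 {R : realType} (s : R) (a : spec R) : spec R :=
  bmult (fun k => prim1 (-2 * knorm k) s) a.

HB.lock Definition fprim2 {R : realType} (s : R) (a : spec R) : spec R :=
  bmult (fun k => prim2 (-2 * knorm k) s) a.

Section Step.
Context {R : realType}.
Local Notation C := R[i].
Implicit Types (a b c w : spec R) (sg s t h tau T A : R).

Lemma fphi1E tau a k : fphi1 tau a k = phi1 ('i * (-2 * knorm k * tau)%:C) * a k.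
Proof. by rewrite fphi1.unlock; apply: bmultE => j; exact: cnorm_phi1. Qed.

Lemma fphi2E tau a k : fphi2 tau a k = phi2 ('i * (-2 * knorm k * tau)%:C) * a k.
Proof. by rewrite fphi2.unlock; apply: bmultE => j; exact: cnorm_phi2. Qed.

Lemma fprim1E s a k : 0 <= s -> fprim1 s a k = prim1 (-2 * knorm k) s * a k.
Proof. by move=> s0; rewrite fprim1.unlock; apply: bmultE => j; exact: cnorm_prim1. Qed.

Lemma fprim2E s a k : fprim2 s a k = prim2 (-2 * knorm k) s * a k.
Proof. by rewrite fprim2.unlock; apply: bmultE => j; exact: cnorm_prim2. Qed.

Lemma fprim1_phi tau a : 0 <= tau -> fprim1 tau a = spec_cst tau%:C * fphi1 tau a.
Proof. by move=> t0; apply: spec_ext => k; rewrite fprim1E// cstME fphi1E /prim1 mulrA. Qed.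

Lemma fprim2_phi tau a : fprim2 tau a = spec_cst (tau ^+ 2)%:C * fphi2 tau a.
Proof. by apply: spec_ext => k; rewrite fprim2E cstME fphi2E /prim2 mulrA. Qed.

Lemma flow_fphi2 t tau a : flow t (fphi2 tau a) = fphi2 tau (flow t a).
Proof. apply: spec_ext => k; rewrite (flowE t (fphi2 tau a)) (fphi2E tau a).
by rewrite (fphi2E tau (flow t a)) (flowE t a) mulrCA. Qed.

Lemma knorm_jb (k : freq) : `|-2 * knorm k| <= 2 * jb k :> R.
Proof.
by rewrite normrM normrN !ger0_norm ?knorm_ge0// ler_wpM2l// knorm_le_jb.
Qed.

(** The time derivative of the multiplier, with a quadratic remainder. *)
Lemma fprim1_incr s h a : 0 <= s -> 0 <= h ->
  n2 (fprim1 (s + h) a - fprim1 s a - spec_cst h%:C * flow (-2 * s) a) <= 4 * h ^+ 2 * nH a.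
Proof.
move=> s0 h0; apply: n2_le_jb => [|k]; first by rewrite mulr_ge0 ?sqr_ge0.
rewrite [(_ - _ : spec R) k]spec_subE [(fprim1 _ _ - _) k]spec_subE cstME flowE !fprim1E ?addr_ge0//.
rewrite (_ : -2 * s * knorm k = -2 * knorm k * s); last by ring.
rewrite [h%:C * _]mulrA -!mulrBl cnormM ler_wpM2r ?cnorm_ge0//.
apply: le_trans (prim1_deriv _ _ _) _.
have := ler_wpM2r (sqr_ge0 h) (knorm_jb k); set X := h ^+ 2; set Y := `|_|.
by move=> hY; lra.
Qed.

Lemma fprim2_incr s h a : 0 <= s -> 0 <= h ->
  n2 (fprim2 (s + h) a - fprim2 s a - spec_cst (h * s)%:C * flow (-2 * s) a) <=
    2 * h ^+ 2 * (1 + 2 * s) * nH a.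
Proof.
move=> s0 h0; apply: n2_le_jb => [|k].
  by rewrite !mulr_ge0 ?sqr_ge0// addr_ge0// mulr_ge0.
rewrite [(_ - _ : spec R) k]spec_subE [(fprim2 _ _ - _) k]spec_subE cstME flowE !fprim2E.
rewrite (_ : -2 * s * knorm k = -2 * knorm k * s); last by ring.
rewrite [(h * s)%:C * _]mulrA -!mulrBl cnormM ler_wpM2r ?cnorm_ge0//.
apply: le_trans (prim2_deriv _ _ s0) _.
rewrite [leRHS](_ : _ = 2 * h ^+ 2 * ((1 + 2 * s) * jb k)); last by ring.
rewrite ler_wpM2l ?mulr_ge0 ?sqr_ge0// mulrDl mul1r.
apply: lerD; first exact: jb_ge1.
by rewrite [leRHS](_ : _ = s * (2 * jb k)) ?ler_wpM2l ?knorm_jb//; ring.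
Qed.

Lemma twist0 a w : twist 0 a w = a * a * w.
Proof. by rewrite twist.unlock oppr0 !flow0. Qed.

Lemma twistB t a v w : twist t a (v - w) = twist t a v - twist t a w.
Proof. by rewrite twist.unlock flowB mulrBr flowB. Qed.

Lemma twistZ t z a w : twist t a (spec_cst z * w) = spec_cst z * twist t a w.
Proof. by rewrite twist.unlock flowZ mulrCA flowZ. Qed.

(** When [w] oscillates like the conjugate factor, the twisted product is
    the nonlinearity of the linear evolution, seen in the moving frame. *)
Lemma twist_cubic s a : twist s a (flow (-2 * s) (conjs a)) = flow (- s) (cubic (flow s a)).
Proof.
rewrite twist.unlock /cubic conjs_flow flow_flow; congr (flow _ (_ * flow _ _)).
by ring.
Qed.

Lemma n2_twist t (A : R) a w : n1 a <= A -> n2 (twist t a w) <= A * A * n2 w.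
Proof.
move=> ha; rewrite twist.unlock n2_flow.
have := @n2_mul R (A * A) (n2 w) (flow t a * flow t a) (flow t w).
by rewrite n2_flow; apply => //; apply: n1_mul; rewrite n1_flow.
Qed.

(** One step of the scheme on Fourier series. *)
Definition Psi sg tau a : spec R :=
  let c := sig sg * spec_cst tau%:C in
  flow tau a - c * flow tau (a * a * fphi1 tau (conjs a))
  - c * (flow tau a * flow tau a * fphi2 tau (flow tau (conjs a)))
  + c * flow tau (a * a * fphi2 tau (conjs a))
  - spec_cst (tau ^+ 2 / 2)%:C * flow tau (quintic a).

End Step.

Section Local.
Context {R : realType}.
Local Notation C := R[i].
Implicit Types (a b c w : spec R) (sg s t h tau T A : R).

(** Exact solution minus scheme in the moving frame, with the step of the
    scheme replaced by an inner time [s]. It vanishes at [s = 0], and at [s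
    = tau] it is the local error ([frame_error_end]), so its increments can
    be estimated by [n2_mean_value]. *)
Definition frame_error sg (U : R -> spec R) t tau s : spec R :=
  let a := U t in
  flow (- s) (U (t + s)) - a
  + sig sg * (a * a * fprim1 s (conjs a)
      + spec_cst (tau^-1)%:C * (twist tau a (fprim2 s (conjs a)) - a * a * fprim2 s (conjs a)))
  + spec_cst (s ^+ 2 / 2)%:C * quintic a.

Lemma flow_frame t a b (x y z : C) v1 v2 v3 v4 :
  flow t (flow (- t) b - a + spec_cst x * (spec_cst y * v1 + spec_cst y * (v2 - v3))
    + spec_cst z * v4) =
  b - flow t a + spec_cst x * (spec_cst y * flow t v1
    + spec_cst y * (flow t v2 - flow t v3)) + spec_cst z * flow t v4.
Proof. by rewrite !(flowD, flowN, flowZ) flowK. Qed.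

Lemma flow_lin t (x y : C) v1 v2 v3 :
  flow t (spec_cst x * (v1 - v2) - spec_cst y * v3) =
  spec_cst x * (flow t v1 - flow t v2) - spec_cst y * flow t v3.
Proof. by rewrite !(flowB, flowZ). Qed.

Lemma twist_incr t a v1 v2 (x : C) v3 :
  twist t a (v1 - v2 - spec_cst x * v3) = twist t a v1 - twist t a v2 - spec_cst x * twist t a v3.
Proof. by rewrite !(twistB, twistZ). Qed.

Lemma flow_pull s h (x y : C) v1 v2 v3 :
  flow (- (s + h)) (v1 - flow h v2 + spec_cst x * spec_cst y * flow h v3) =
  flow (- (s + h)) v1 - flow (- s) v2 + spec_cst x * spec_cst y * flow (- s) v3.
Proof.
rewrite -rmorphM flowD flowB flowZ !flow_flow.
by rewrite (_ : - (s + h) + h = - s)//; ring.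
Qed.

Lemma flow_gap t a : flow (- t) (flow t a - a) = a - flow (- t) a.
Proof. by rewrite flowB flowNK. Qed.

Lemma flow_twist t a w : flow t (twist t a w) = flow t a * flow t a * flow t w.
Proof. by rewrite twist.unlock flowK. Qed.

Lemma frame_error_end sg U t tau : 0 < tau ->
  flow tau (frame_error sg U t tau tau) = U (t + tau) - Psi sg tau (U t).
Proof.
move=> t0; rewrite /frame_error /Psi; set a := U t; set b := U (t + tau).
rewrite fprim1_phi ?(ltW t0)// fprim2_phi.
set w1 := fphi1 tau (conjs a); set w2 := fphi2 tau (conjs a).
have e1 : a * a * (spec_cst tau%:C * w1) = spec_cst tau%:C * (a * a * w1) by rewrite mulrCA.
have e2 : a * a * (spec_cst (tau ^+ 2)%:C * w2) = spec_cst (tau ^+ 2)%:C * (a * a * w2).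
  by rewrite mulrCA.
have e3 : spec_cst (tau^-1)%:C * spec_cst (tau ^+ 2)%:C = spec_cst tau%:C :> spec R.
  by rewrite -rmorphM -rmorphM /= expr2 mulKf ?gt_eqF.
have e4 : spec_cst (tau^-1)%:C * (twist tau a (spec_cst (tau ^+ 2)%:C * w2)
    - a * a * (spec_cst (tau ^+ 2)%:C * w2)) = spec_cst tau%:C * (twist tau a w2 - a * a * w2).
  by rewrite twistZ e2 -mulrBr mulrA e3.
rewrite e4 e1 /sig flow_frame flow_twist -flow_fphi2 -/w2; ring.
Qed.

Section Increment.
Variables (sg T A : R) (U : R -> spec R) (t tau : R).
Hypotheses (sg1 : sg * sg = 1) (hU : mild_path sg T A U).
Hypotheses (t0 : 0 <= t) (tau0 : 0 < tau) (tT : t + tau <= T).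

Let a := U t.
Let w s := flow (-2 * s) (conjs a).

(** The derivative of [frame_error] with respect to [s]. *)
Definition frame_slope s : spec R :=
  - sig sg * flow (- s) (cubic (U (t + s)))
  + sig sg * (a * a * w s
      + spec_cst (s / tau)%:C * (twist tau a (w s) - a * a * w s))
  + spec_cst s%:C * quintic a.

(** The three lines are the interpolation error of [twist_interp], the
    second-order error of [path_second_order], and the effect of the moving
    frame on the last term. *)
Lemma frame_slopeE s : frame_slope s =
  - (sig sg * (twist s a (w s) - a * a * w s
      - spec_cst (s / tau)%:C * (twist tau a (w s) - a * a * w s)))
  - flow (- s) (sig sg * (cubic (U (t + s)) - cubic (flow s a)) - spec_cst s%:C * quintic a)
  + spec_cst s%:C * flow (- s) (flow s (quintic a) - quintic a).
Proof.
rewrite /frame_slope twist_cubic.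
rewrite /sig (flow_lin (- s)) (flow_gap s); ring.
Qed.

Lemma frame_incrE s h : frame_error sg U t tau (s + h) - frame_error sg U t tau s =
  (flow (- (s + h)) (U (t + (s + h))) - flow (- s) (U (t + s))
     + sig sg * spec_cst h%:C * flow (- s) (cubic (U (t + s))))
  + sig sg * (a * a * (fprim1 (s + h) (conjs a) - fprim1 s (conjs a) - spec_cst h%:C * w s)
      + spec_cst (tau^-1)%:C *
        (twist tau a (fprim2 (s + h) (conjs a) - fprim2 s (conjs a) - spec_cst (h * s)%:C * w s)
         - a * a * (fprim2 (s + h) (conjs a) - fprim2 s (conjs a) - spec_cst (h * s)%:C * w s)))
  + spec_cst (h ^+ 2 / 2)%:C * quintic a
  + spec_cst h%:C * frame_slope s.
Proof.
rewrite /frame_error /frame_slope -/a.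
have e1 : spec_cst ((s + h) ^+ 2 / 2)%:C = spec_cst (s ^+ 2 / 2)%:C
    + spec_cst h%:C * spec_cst s%:C + spec_cst (h ^+ 2 / 2)%:C :> spec R.
  by rewrite -!rmorphM -!rmorphD /=; congr (spec_cst _%:C); field.
have e2 : spec_cst (s / tau)%:C = spec_cst s%:C * spec_cst (tau^-1)%:C :> spec R.
  by rewrite -!rmorphM.
have e3 : spec_cst (h * s)%:C = spec_cst h%:C * spec_cst s%:C :> spec R.
  by rewrite -!rmorphM.
rewrite (twist_incr tau a (fprim2 (s + h) (conjs a)) _ (h * s)%:C) e3 e1 e2; ring.
Qed.

End Increment.

(** The slope of [frame_error] is [O(tau^2)] on a step of length [tau], so
    that [n2_mean_value] gives [O(tau^3)]. *)
Lemma local_error sg T A (U : R -> spec R) : sg * sg = 1 -> mild_path sg T A U ->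
  exists2 Cl : R, 0 <= Cl & forall t tau, 0 <= t -> 0 < tau -> t + tau <= T ->
    n2 (U (t + tau) - Psi sg tau (U t)) <= Cl * tau ^+ 3.
Proof.
move=> sg1 hU; have [Ci Ci0 hint] := @twist_interp R.
have [A0 hA _ _] := hU.
have K10 : 0 <= duhamel_cst A by rewrite /duhamel_cst !(addr_ge0, mulr_ge0).
have K30 : 0 <= second_cst A by rewrite /second_cst !(addr_ge0, mulr_ge0).
pose Cl := Ci * (3 * (A * A * A)) + second_cst A + 81 * (A * A * A * A * A).
have Cl0 : 0 <= Cl by rewrite !(addr_ge0, mulr_ge0).
exists Cl => // t tau t0 tau0 tT; set a := U t.
have tT' : t <= T by apply: le_trans tT; rewrite lerDl ltW.
have [a1 aH] : n1 a <= A /\ nH a <= A by apply: hA; rewrite t0.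
have a2 : n2 a <= A by apply: le_trans (n2_le_n1 _) a1.
have ci : cnorm (sg%:C * 'i : C) <= 1 by rewrite cnorm_sig.
have cr x : 0 <= x -> cnorm (x%:C : C) <= x by move=> x0; rewrite cnormR ger0_norm.
rewrite -frame_error_end// n2_flow.
have D0 : frame_error sg U t tau 0 = 0.
  have q1 : fprim1 0 (conjs a) = 0.
    by rewrite fprim1_phi// !rmorph0 mul0r.
  have q2 : fprim2 0 (conjs a) = 0 by rewrite fprim2_phi expr0n !rmorph0 mul0r.
  have q3 : twist tau a 0 = 0 by have := twistB tau a a a; rewrite !subrr.
  rewrite /frame_error -/a q1 q2 q3 addr0 -/a oppr0 flow0 subrr.
  by rewrite expr0n mul0r !rmorph0 !(mulr0, mul0r, subr0, addr0).
rewrite -[X in n2 X]subr0 -D0.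
have -> : Cl * tau ^+ 3 = tau * (Cl * tau ^+ 2) by ring.
(* The coefficient of [h ^+ 2] in the increments of [frame_error]; it depends on
   [tau] but disappears in the mean value inequality. *)
pose K := duhamel_cst A + (A * A * (4 * A)
  + tau^-1 * (A * A * (2 * (1 + 2 * tau) * A) + A * A * (2 * (1 + 2 * tau) * A)))
  + (A * A * A) * (A * A).
have tau00 : 0 <= tau by exact: ltW.
have ti0 : 0 <= tau^-1 by rewrite invr_ge0.
have tp0 : 0 <= 1 + 2 * tau by rewrite addr_ge0 ?mulr_ge0// ltW.
apply: (@n2_mean_value _ _ _ _ K) => [||s h s0 h0 sh]; first exact: ltW.
  by rewrite /K !(addr_ge0, mulr_ge0).
have st : s <= tau by apply: le_trans sh; rewrite lerDl.
have tsT : t + s <= T by apply: le_trans tT; rewrite lerD2l.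
have tshT : t + s + h <= T by apply: le_trans tT; rewrite -addrA lerD2l.
rewrite (frame_incrE sg U t tau).
set w := flow (-2 * s) (conjs a).
have w1 : n1 w <= A by rewrite n1_flow n1_conjs.
have wH : nH w <= A by rewrite nH_flow nH_conjs.
have hslope : n2 (frame_slope sg U t tau s) <= Cl * tau ^+ 2.
  have s2 : s ^+ 2 <= tau ^+ 2 by rewrite lerXn2r ?nnegrE// ltW.
  rewrite frame_slopeE -/a -/w.
  have g1 : n2 (sig sg * (twist s a w - a * a * w
      - spec_cst (s / tau)%:C * (twist tau a w - a * a * w))) <=
      1 * (Ci * tau ^+ 2 * (3 * (A * A * A))).
    apply: n2_scal => //; have := hint s tau a w; rewrite s0 st (twist0 a w).
    move=> /(_ isT tau0) h1; apply: le_trans h1 _; rewrite ler_wpM2l ?mulr_ge0 ?sqr_ge0//.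
    have -> : 3 * (A * A * A) = A * A * A + 2 * (A * A * A) by ring.
    by apply: lerD; rewrite ?ler_wpM2l// !ler_pM ?mulr_ge0 ?nH_ge0 ?n1_ge0.
  have g2 := path_second_order sg1 hU t0 s0 tsT.
  rewrite -/a -(n2_flow (- s)) in g2.
  have g3 : n2 (spec_cst s%:C * flow (- s) (flow s (quintic a) - quintic a)) <=
      s * (s * (81 * (A * A * A * A * A))).
    apply: n2_scal; first exact: cr.
    rewrite n2_flow; apply: le_trans (flow_sub_le _ s0) _.
    by rewrite ler_wpM2l// nH_quintic.
  rewrite -n2N in g1; apply: le_trans (n2_add (n2_sub g1 g2) g3) _.
  have h2 := ler_wpM2r K30 s2.
  have h3 : s * (s * (81 * (A * A * A * A * A))) <= tau ^+ 2 * (81 * (A * A * A * A * A)).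
    by rewrite mulrA -expr2 ler_wpM2r// !mulr_ge0.
  rewrite /Cl; lra.
have b1 : n2 (flow (- (s + h)) (U (t + (s + h))) - flow (- s) (U (t + s))
    + sig sg * spec_cst h%:C * flow (- s) (cubic (U (t + s)))) <= h * (h * duhamel_cst A).
  have := path_duhamel hU (_ : 0 <= t + s) h0 tshT.
  rewrite addr_ge0// => /(_ isT).
  by rewrite -(n2_flow (- (s + h))) /sig flow_pull addrA.
have b2 : n2 (sig sg * (a * a * (fprim1 (s + h) (conjs a) - fprim1 s (conjs a) - spec_cst h%:C * w)
      + spec_cst (tau^-1)%:C *
        (twist tau a (fprim2 (s + h) (conjs a) - fprim2 s (conjs a) - spec_cst (h * s)%:C * w)
         - a * a * (fprim2 (s + h) (conjs a) - fprim2 s (conjs a) - spec_cst (h * s)%:C * w)))) <=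
   1 * (A * A * (4 * h ^+ 2 * A) + tau^-1 * (A * A * (2 * h ^+ 2 * (1 + 2 * tau) * A)
     + A * A * (2 * h ^+ 2 * (1 + 2 * tau) * A))).
  have JH : nH (conjs a) <= A by rewrite nH_conjs.
  have h20 : 0 <= h ^+ 2 by exact: sqr_ge0.
  have e1 : n2 (fprim1 (s + h) (conjs a) - fprim1 s (conjs a) - spec_cst h%:C * w) <= 4 * h ^+ 2 * A.
    by apply: le_trans (fprim1_incr _ s0 h0) _; rewrite ler_wpM2l// mulr_ge0.
  have e2 : n2 (fprim2 (s + h) (conjs a) - fprim2 s (conjs a) - spec_cst (h * s)%:C * w) <=
      2 * h ^+ 2 * (1 + 2 * tau) * A.
    apply: le_trans (fprim2_incr _ s0 h0) _; rewrite ler_pM ?nH_ge0//.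
      by rewrite !mulr_ge0// addr_ge0// mulr_ge0.
    by rewrite ler_wpM2l ?mulr_ge0// lerD2l ler_wpM2l.
  apply: n2_scal => //; apply: n2_add; first exact: n2_mul (n1_mul a1 a1) e1.
  apply: n2_scal; first exact: cr.
  apply: n2_sub; last exact: n2_mul (n1_mul a1 a1) e2.
  by apply: le_trans (n2_twist _ _ a1) _; rewrite ler_wpM2l ?mulr_ge0.
have b3 : n2 (spec_cst (h ^+ 2 / 2)%:C * quintic a) <= h ^+ 2 / 2 * (A * A * A * (A * A)).
  apply: n2_scal; first by apply: cr; rewrite divr_ge0 ?sqr_ge0.
  have J1 : n1 (conjs a) <= A by rewrite n1_conjs.
  apply: n2_mul; first exact: n1_mul (n1_mul a1 a1) a1.
  by apply: (n2_mul J1); rewrite n2_conjs.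
have b4 : n2 (spec_cst h%:C * frame_slope sg U t tau s) <= h * (Cl * tau ^+ 2).
  by apply: n2_scal; first exact: cr.
apply: le_trans (n2_add (n2_add (n2_add b1 b2) b3) b4) _.
rewrite addrC lerD2l.
have : 0 <= h ^+ 2 / 2 * (A * A * A * (A * A)) by rewrite !(mulr_ge0, sqr_ge0)// invr_ge0.
set z := h ^+ 2 / 2 * _ => z0; rewrite -[leLHS]addr0; apply: le_trans (lerD (lexx _) z0) _.
rewrite le_eqVlt; apply/orP; left; apply/eqP.
have -> : K * h ^+ 2 = duhamel_cst A * h ^+ 2 + (A * A * (4 * A)
  + tau^-1 * (A * A * (2 * (1 + 2 * tau) * A) + A * A * (2 * (1 + 2 * tau) * A))) * h ^+ 2
  + (z + z) by rewrite /z /K; field; exact: lt0r_neq0.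
by rewrite addrA; congr (_ + _ + _); ring.
Qed.

End Local.

(** * Stability and global error *)

Section Stability.
Context {R : realType}.
Local Notation C := R[i].
Implicit Types (a b c w x y : spec R) (sg s t h tau T A M d : R).

Lemma n1_fphi1 tau a : n1 (fphi1 tau a) <= 2 * n1 a.
Proof.
have h : n1 (fphi1 tau a) <= n1 a.
  by apply: n1_mono => k; rewrite fphi1E cnormM ler_piMl ?cnorm_ge0 ?cnorm_phi1.
by apply: le_trans h _; rewrite ler_peMl ?n1_ge0 ?ler1n.
Qed.

Lemma n2_fphi1 tau a : n2 (fphi1 tau a) <= 2 * n2 a.
Proof.
apply: n2_le_pt => // k; rewrite fphi1E cnormM ler_wpM2r ?cnorm_ge0//.
by apply: le_trans (cnorm_phi1 _) _; rewrite ler1n.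
Qed.

Lemma nH_fphi1 tau a : nH (fphi1 tau a) <= 2 * nH a.
Proof.
have h : nH (fphi1 tau a) <= nH a.
  by apply: nH_mono => k; rewrite fphi1E cnormM ler_piMl ?cnorm_ge0 ?cnorm_phi1.
by apply: le_trans h _; rewrite ler_peMl ?nH_ge0 ?ler1n.
Qed.

Lemma n1_fphi2 tau a : n1 (fphi2 tau a) <= 2 * n1 a.
Proof.
rewrite fphi2.unlock; apply: le_trans (_ : `|2| * n1 a <= _); last by rewrite ger0_norm.
by apply: n1_bmult => k; exact: cnorm_phi2.
Qed.

Lemma n2_fphi2 tau a : n2 (fphi2 tau a) <= 2 * n2 a.
Proof.
rewrite fphi2.unlock; apply: le_trans (_ : `|2| * n2 a <= _); last by rewrite ger0_norm.
by apply: n2_bmult => k; exact: cnorm_phi2.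
Qed.

Lemma nH_fphi2 tau a : nH (fphi2 tau a) <= 2 * nH a.
Proof.
rewrite fphi2.unlock; apply: le_trans (_ : `|2| * nH a <= _); last by rewrite ger0_norm.
by apply: nH_bmult => k; exact: cnorm_phi2.
Qed.

Lemma fphi1B tau a b : fphi1 tau (a - b) = fphi1 tau a - fphi1 tau b.
Proof. by apply: spec_ext => k; rewrite fphi1E !spec_subE !fphi1E mulrBr. Qed.

Lemma fphi2B tau a b : fphi2 tau (a - b) = fphi2 tau a - fphi2 tau b.
Proof. by apply: spec_ext => k; rewrite fphi2E !spec_subE !fphi2E mulrBr. Qed.

(** The three cubic terms of the scheme have the form [a * a * x] with [x]
    the image of [conj a] under a multiplier bounded by 2. *)
Lemma n2_trilin M d a b x y : n1 a <= M -> n1 b <= M -> n1 x <= 2 * M ->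
  n2 (a - b) <= d -> n2 (x - y) <= 2 * d ->
  n2 (a * a * x - b * b * y) <= 6 * (M * M) * d.
Proof.
move=> ha hb hx hab hxy.
have -> : a * a * x - b * b * y = (a + b) * x * (a - b) + b * b * (x - y) by ring.
have h1 := n2_mul (n1_mul (n1_add ha hb) hx) hab.
have h2 := n2_mul (n1_mul hb hb) hxy.
apply: le_trans (n2_add h1 h2) _.
by rewrite le_eqVlt; apply/orP; left; apply/eqP; ring.
Qed.

Lemma nH_trilin M d a x : n1 a <= M -> n1 x <= 2 * M -> nH a <= d -> nH x <= 2 * d ->
  nH (a * a * x) <= 42 * (M * M) * d.
Proof.
move=> ha hx hd hxd.
have h1 := nH_mul (n1_mul ha ha) hx (nH_mul ha ha hd hd) hxd.
apply: le_trans h1 _.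
by rewrite le_eqVlt; apply/orP; left; apply/eqP; ring.
Qed.

Lemma quintic_lip M d a b : n1 a <= M -> n1 b <= M -> n2 (a - b) <= d ->
  n2 (quintic a - quintic b) <= 5 * (M * M * M * M) * d.
Proof.
move=> ha hb hd.
have hJa : n1 (conjs a) <= M by rewrite n1_conjs.
have hJb : n1 (conjs b) <= M by rewrite n1_conjs.
have hJd : n2 (conjs (a - b)) <= d by rewrite n2_conjs.
have -> : quintic a - quintic b =
    ((a * a + a * b + b * b) * (conjs a * conjs a)) * (a - b)
    + (b * b * b * (conjs a + conjs b)) * conjs (a - b).
  by rewrite /quintic conjsB; ring.
have h1 := n2_mul (n1_mul (n1_add (n1_add (n1_mul ha ha) (n1_mul ha hb)) (n1_mul hb hb)) (n1_mul hJa hJa)) hd.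
have h2 := n2_mul (n1_mul (n1_mul (n1_mul hb hb) hb) (n1_add hJa hJb)) hJd.
apply: le_trans (n2_add h1 h2) _.
by rewrite le_eqVlt; apply/orP; left; apply/eqP; ring.
Qed.

(** A common constant for [Psi_lip] and [Psi_tame]; [T] bounds the step, and
    turns [tau ^+ 2] into [tau * T]. *)
Definition grow_cst T M := 126 * (M * M) + 81 * T * (M * M * M * M).

Lemma grow_cst_ge0 T M : 0 <= T -> 0 <= M -> 0 <= grow_cst T M.
Proof. by move=> T0 M0; rewrite /grow_cst !(addr_ge0, mulr_ge0). Qed.

Lemma Psi_lip sg T M tau a b : sg * sg = 1 -> 0 <= tau -> tau <= T ->
  n1 a <= M -> n1 b <= M ->
  n2 (Psi sg tau a - Psi sg tau b) <= (1 + tau * grow_cst T M) * n2 (a - b).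
Proof.
move=> sg1 t0 tT ha hb; set d := n2 (a - b).
have M0 : 0 <= M := le_trans (n1_ge0 _) ha.
have d0 : 0 <= d by exact: n2_ge0.
have T0 : 0 <= T by exact: le_trans tT.
have ci : cnorm (sg%:C * 'i : C) <= 1 by rewrite cnorm_sig.
have ct : cnorm (tau%:C : C) <= tau by rewrite cnormR ger0_norm.
have cq : cnorm ((tau ^+ 2 / 2)%:C : C) <= tau ^+ 2 / 2.
  by rewrite cnormR ger0_norm// mulr_ge0 ?sqr_ge0 ?invr_ge0.
have hJa : n1 (conjs a) <= M by rewrite n1_conjs.
have hJd : n2 (conjs a - conjs b) <= d by rewrite -conjsB n2_conjs.
have e1 : n1 (fphi1 tau (conjs a)) <= 2 * M.
  by apply: le_trans (n1_fphi1 _ _) _; rewrite ler_wpM2l.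
have e2 : n1 (fphi2 tau (conjs a)) <= 2 * M.
  by apply: le_trans (n1_fphi2 _ _) _; rewrite ler_wpM2l.
have e3 : n1 (fphi2 tau (flow tau (conjs a))) <= 2 * M.
  by apply: le_trans (n1_fphi2 _ _) _; rewrite ler_wpM2l// n1_flow.
have d1 : n2 (fphi1 tau (conjs a) - fphi1 tau (conjs b)) <= 2 * d.
  by rewrite -fphi1B; apply: le_trans (n2_fphi1 _ _) _; rewrite ler_wpM2l.
have d2 : n2 (fphi2 tau (conjs a) - fphi2 tau (conjs b)) <= 2 * d.
  by rewrite -fphi2B; apply: le_trans (n2_fphi2 _ _) _; rewrite ler_wpM2l.
have d3 : n2 (fphi2 tau (flow tau (conjs a)) - fphi2 tau (flow tau (conjs b))) <= 2 * d.
  rewrite -fphi2B -flowB; apply: le_trans (n2_fphi2 _ _) _.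
  by rewrite ler_wpM2l// n2_flow.
have Ea : n1 (flow tau a) <= M by rewrite n1_flow.
have Eb : n1 (flow tau b) <= M by rewrite n1_flow.
have Ed : n2 (flow tau a - flow tau b) <= d by rewrite -flowB n2_flow.
have t1 := n2_trilin ha hb e1 (lexx d) d1.
have t2 := n2_trilin Ea Eb e3 Ed d3.
have t3 := n2_trilin ha hb e2 (lexx d) d2.
have t4 := quintic_lip ha hb (lexx d).
rewrite -(n2_flow tau) in t1; rewrite -(n2_flow tau) in t3; rewrite -(n2_flow tau) in t4.
have -> : Psi sg tau a - Psi sg tau b =
    (flow tau a - flow tau b)
    - sig sg * (spec_cst tau%:C * flow tau (a * a * fphi1 tau (conjs a) - b * b * fphi1 tau (conjs b)))
    - sig sg * (spec_cst tau%:C * (flow tau a * flow tau a * fphi2 tau (flow tau (conjs a))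
        - flow tau b * flow tau b * fphi2 tau (flow tau (conjs b))))
    + sig sg * (spec_cst tau%:C * flow tau (a * a * fphi2 tau (conjs a) - b * b * fphi2 tau (conjs b)))
    - spec_cst (tau ^+ 2 / 2)%:C * flow tau (quintic a - quintic b).
  by rewrite /Psi (flowB _ (_ * fphi1 _ _)) (flowB _ (_ * fphi2 _ _)) (flowB _ (quintic a)); ring.
apply: le_trans (n2_sub (n2_add (n2_sub (n2_sub Ed
  (n2_scal ci (n2_scal ct t1))) (n2_scal ci (n2_scal ct t2))) (n2_scal ci (n2_scal ct t3)))
  (n2_scal cq t4)) _.
set D := d; set P := M * M; set Q := M * M * M * M.
have P0 : 0 <= P by rewrite mulr_ge0.
have Q0 : 0 <= Q by rewrite !mulr_ge0.
have -> : (1 + tau * grow_cst T M) * D = D + 126 * (tau * P * D) + 81 * (tau * T * (Q * D)).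
  by rewrite /grow_cst -/P -/Q; ring.
have h1 : tau ^+ 2 / 2 * (5 * Q * D) <= 5 / 2 * (tau * T * (Q * D)).
  rewrite [leRHS](_ : _ = tau * T * (5 / 2 * (Q * D))); last by ring.
  rewrite [leLHS](_ : _ = tau * tau * (5 / 2 * (Q * D))); last by ring.
  rewrite ler_wpM2r ?mulr_ge0// ?ler_wpM2l//.
have h2 : 0 <= tau * P * D by rewrite !mulr_ge0.
have h3 : 0 <= tau * T * (Q * D) by rewrite !mulr_ge0.
have -> : 1 * (tau * (6 * P * D)) = 6 * (tau * P * D) by ring.
move: h1 h2 h3; set z1 := tau ^+ 2 / 2 * _; set z2 := tau * P * D; set z3 := tau * T * _.
by move=> *; lra.
Qed.

(** Every term of the scheme is tame: its [H^{3/2}] norm is linear in that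
    of [a], with a factor that depends on the Wiener norm only. The
    Lipschitz and growth constants are then both of the form [1 + tau K],
    and [geometric_le] bounds their powers over the whole time interval. *)
Lemma Psi_tame sg T M tau a : sg * sg = 1 -> 0 <= tau -> tau <= T ->
  n1 a <= M -> nH (Psi sg tau a) <= (1 + tau * grow_cst T M) * nH a.
Proof.
move=> sg1 t0 tT ha; set d := nH a.
have M0 : 0 <= M := le_trans (n1_ge0 _) ha.
have d0 : 0 <= d by exact: nH_ge0.
have T0 : 0 <= T by exact: le_trans tT.
have ci : cnorm (sg%:C * 'i : C) <= 1 by rewrite cnorm_sig.
have ct : cnorm (tau%:C : C) <= tau by rewrite cnormR ger0_norm.
have cq : cnorm ((tau ^+ 2 / 2)%:C : C) <= tau ^+ 2 / 2.
  by rewrite cnormR ger0_norm// mulr_ge0 ?sqr_ge0 ?invr_ge0.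
have hJa : n1 (conjs a) <= M by rewrite n1_conjs.
have hJd : nH (conjs a) <= d by rewrite nH_conjs.
have e1 : n1 (fphi1 tau (conjs a)) <= 2 * M.
  by apply: le_trans (n1_fphi1 _ _) _; rewrite ler_wpM2l.
have e2 : n1 (fphi2 tau (conjs a)) <= 2 * M.
  by apply: le_trans (n1_fphi2 _ _) _; rewrite ler_wpM2l.
have e3 : n1 (fphi2 tau (flow tau (conjs a))) <= 2 * M.
  by apply: le_trans (n1_fphi2 _ _) _; rewrite ler_wpM2l// n1_flow.
have d1 : nH (fphi1 tau (conjs a)) <= 2 * d.
  by apply: le_trans (nH_fphi1 _ _) _; rewrite ler_wpM2l.
have d2 : nH (fphi2 tau (conjs a)) <= 2 * d.
  by apply: le_trans (nH_fphi2 _ _) _; rewrite ler_wpM2l.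
have d3 : nH (fphi2 tau (flow tau (conjs a))) <= 2 * d.
  by apply: le_trans (nH_fphi2 _ _) _; rewrite ler_wpM2l// nH_flow.
have Ea : n1 (flow tau a) <= M by rewrite n1_flow.
have Ed : nH (flow tau a) <= d by rewrite nH_flow.
have t1 := nH_trilin ha e1 (lexx d) d1.
have t2 := nH_trilin Ea e3 Ed d3.
have t3 := nH_trilin ha e2 (lexx d) d2.
have t4 := nH_quintic ha (lexx d).
rewrite -(nH_flow tau) in t1; rewrite -(nH_flow tau) in t3; rewrite -(nH_flow tau) in t4.
have -> : Psi sg tau a = flow tau a
    - sig sg * (spec_cst tau%:C * flow tau (a * a * fphi1 tau (conjs a)))
    - sig sg * (spec_cst tau%:C * (flow tau a * flow tau a * fphi2 tau (flow tau (conjs a))))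
    + sig sg * (spec_cst tau%:C * flow tau (a * a * fphi2 tau (conjs a)))
    - spec_cst (tau ^+ 2 / 2)%:C * flow tau (quintic a).
  by rewrite /Psi !mulrA.
apply: le_trans (nH_sub (nH_add (nH_sub (nH_sub Ed
  (nH_scal ci (nH_scal ct t1))) (nH_scal ci (nH_scal ct t2))) (nH_scal ci (nH_scal ct t3)))
  (nH_scal cq t4)) _.
set D := d; set P := M * M; set Q := M * M * M * M.
have P0 : 0 <= P by rewrite mulr_ge0.
have Q0 : 0 <= Q by rewrite !mulr_ge0.
have -> : (1 + tau * grow_cst T M) * D = D + 126 * (tau * P * D) + 81 * (tau * T * (Q * D)).
  by rewrite /grow_cst -/P -/Q; ring.
have h1 : tau ^+ 2 / 2 * (81 * (Q * D)) <= 81 / 2 * (tau * T * (Q * D)).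
  rewrite [leRHS](_ : _ = tau * T * (81 / 2 * (Q * D))); last by ring.
  rewrite [leLHS](_ : _ = tau * tau * (81 / 2 * (Q * D))); last by ring.
  by rewrite ler_wpM2r ?mulr_ge0// ?ler_wpM2l//.
have h3 : 0 <= tau * T * (Q * D) by rewrite !mulr_ge0.
have -> : 1 * (tau * (42 * P * D)) = 42 * (tau * P * D) by ring.
move: h1 h3; set z1 := tau ^+ 2 / 2 * _; set z2 := tau * P * D; set z3 := tau * T * _.
by move=> *; lra.
Qed.

End Stability.

Section Global.
Context {R : realType}.
Implicit Types (U : R -> spec R) (sg s t h tau T A M : R).

Lemma geometric_le (K tau T : R) n : 0 <= K -> 0 <= tau -> n%:R * tau <= T ->
  (1 + tau * K) ^+ n <= expR (T * K).
Proof.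
move=> K0 t0 nT; have x0 : 0 <= tau * K by rewrite mulr_ge0.
apply: le_trans (_ : expR (tau * K) ^+ n <= _).
  by rewrite lerXn2r ?nnegrE ?expR_ge0 ?addr_ge0 ?expR_ge1Dx.
by rewrite -expRM_natl ler_expR mulrA ler_wpM2r.
Qed.

(** A bootstrap on the Wiener norm of the numerical solution. For [tau <=
    tau0] the error and the [H^{3/2}] norm are propagated together, and
    [n1_interp], with [e] and [tau0] chosen so that each of its two terms is
    at most 1/2, keeps the Wiener norm below [A + 1]. For [tau > tau0] there
    are at most [N] steps. *)
Lemma spectral_convergence sg T A U : sg * sg = 1 -> 0 < T -> mild_path sg T A U ->
  exists2 CT : R, 0 < CT & forall tau n, 0 < tau -> n%:R * tau <= T ->
    n2 (U (n%:R * tau) - iter n (Psi sg tau) (U 0)) <= CT * tau ^+ 2.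
Proof.
move=> sg1 T0 hU; have [Cl Cl0 hloc] := local_error sg1 hU.
have [A0 hA _ _] := hU; have T0' := ltW T0.
have [_ U0H] : n1 (U 0) <= A /\ nH (U 0) <= A by apply: hA; rewrite lexx T0'.
pose M := A + 1; have M0 : 0 <= M by rewrite addr_ge0.
pose K := grow_cst T M; have K0 : 0 <= K by exact: grow_cst_ge0.
pose X := expR (T * K); have X0 : 0 <= X by exact: expR_ge0.
(* As long as the bootstrap lasts, the numerical solution is at most [X * A] in
   [H^{3/2}], and its distance to the exact one at most [A + X * A]. *)
pose e := (2 * (A + X * A + 1))^-1.
have XA0 : 0 <= A + X * A by rewrite addr_ge0// mulr_ge0.
have e0 : 0 < e by rewrite invr_gt0 mulr_gt0// ltr_wpDl.
have [Ce Ce0 hint] := @n1_interp R e e0.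
pose Z := Ce * (T * Cl * X).
have Z0 : 0 <= Z by rewrite !mulr_ge0.
pose tau0 := (2 * (Z + 1))^-1.
have tau00 : 0 < tau0 by rewrite invr_gt0 mulr_gt0// ltr_wpDl.
have tau01 : tau0 <= 1.
  by rewrite invf_le1 ?mulr_gt0// ?ltr_wpDl//; lra.
have Ztau : Z * tau0 <= 2^-1.
  rewrite /tau0 invfM mulrCA ler_piMr ?invr_ge0// ler_pdivrMr ?ltr_wpDl// mul1r; lra.
have small tau n : 0 < tau -> tau <= tau0 -> n%:R * tau <= T ->
    n2 (U (n%:R * tau) - iter n (Psi sg tau) (U 0)) <= n%:R * (Cl * tau ^+ 3) * (1 + tau * K) ^+ n
    /\ nH (iter n (Psi sg tau) (U 0)) <= (1 + tau * K) ^+ n * A.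
  move=> t0 tt0; have t0' := ltW t0.
  have q0 : 0 <= 1 + tau * K by rewrite addr_ge0// mulr_ge0.
  elim: n => [|n IH] nT.
    by rewrite /= !mul0r subrr n2_0 expr0 mul1r.
  have nT' : n%:R * tau <= T by apply: le_trans nT; rewrite ler_wpM2r// ler_nat.
  have [IH1 IH2] := IH nT'; set v := iter n _ _ in IH1 IH2 *.
  have nt0 : 0 <= n%:R * tau by rewrite mulr_ge0.
  have gX : (1 + tau * K) ^+ n <= X by exact: geometric_le.
  have [u1 uH] : n1 (U (n%:R * tau)) <= A /\ nH (U (n%:R * tau)) <= A.
    by apply: hA; rewrite nt0.
  have vM : n1 v <= M.
    have -> : v = U (n%:R * tau) - (U (n%:R * tau) - v) by rewrite opprB addrC subrK.
    apply: n1_sub => //; apply: le_trans (hint _) _.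
    have h1 : Ce * n2 (U (n%:R * tau) - v) <= 2^-1.
      apply: le_trans Ztau; rewrite /Z -mulrA ler_wpM2l//; apply: le_trans IH1 _.
      have -> : n%:R * (Cl * tau ^+ 3) * (1 + tau * K) ^+ n =
          (n%:R * tau) * (Cl * ((1 + tau * K) ^+ n * tau ^+ 2)) by ring.
      have -> : T * Cl * X * tau0 = T * (Cl * (X * tau0)) by ring.
      have t2 : tau ^+ 2 <= tau0.
        by rewrite expr2 -[leRHS]mulr1 ler_pM// (le_trans tt0).
      apply: ler_pM => //; first by rewrite !mulr_ge0// ?exprn_ge0.
      by rewrite ler_wpM2l// ler_pM ?exprn_ge0.
    have h2 : e * nH (U (n%:R * tau) - v) <= 2^-1.
      apply: le_trans (ler_wpM2l (ltW e0) (nH_sub uH (le_trans IH2 (ler_wpM2r A0 gX)))) _.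
      by rewrite /e invfM -mulrA ler_piMr ?invr_ge0// mulrC ler_pdivrMr ?ltr_wpDl// mul1r; lra.
    by apply: le_trans (lerD h1 h2) _; lra.
  have tT : tau <= T by apply: le_trans nT; rewrite ler_peMl// ler1n.
  split; last first.
    rewrite /= -/v; apply: le_trans (Psi_tame sg1 t0' tT vM) _.
    by rewrite exprS -mulrA ler_wpM2l.
  have eS : n.+1%:R * tau = n%:R * tau + tau by rewrite -natr1 mulrDl mul1r.
  rewrite /= -/v eS.
  have -> : U (n%:R * tau + tau) - Psi sg tau v =
     (U (n%:R * tau + tau) - Psi sg tau (U (n%:R * tau))) +
     (Psi sg tau (U (n%:R * tau)) - Psi sg tau v) by rewrite addrA subrK.
  have l1 : n2 (U (n%:R * tau + tau) - Psi sg tau (U (n%:R * tau))) <= Cl * tau ^+ 3.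
    by apply: hloc => //; rewrite -eS.
  have uM : n1 (U (n%:R * tau)) <= M by apply: le_trans u1 _; rewrite lerDl.
  have l2 := Psi_lip sg1 t0' tT uM vM.
  apply: le_trans (n2_add l1 (le_trans l2 (ler_wpM2l q0 IH1))) _.
  rewrite -natr1 -/K; set q := 1 + tau * K; set z := Cl * tau ^+ 3.
  have -> : (n%:R + 1) * z * q ^+ n.+1 = z * (q ^+ n.+1) + q * (n%:R * z * q ^+ n).
    by rewrite exprS; ring.
  rewrite lerD2r ler_peMr//; first by rewrite mulr_ge0// exprn_ge0.
  by rewrite exprn_ege1// lerDl mulr_ge0.
have [C1 C11 hC1] := @n1_emb R.
have C10 : 0 <= C1 by exact: le_trans C11.
(* The growth in one step when the Wiener norm is merely estimated by that of
   [H^{3/2}]. *)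
pose g x := (1 + T * grow_cst T (C1 * x)) * x.
have g_ge x : 0 <= x -> x <= g x.
  by move=> x0; rewrite /g mulrDl mul1r lerDl mulr_ge0// mulr_ge0// grow_cst_ge0// mulr_ge0.
have g_mono x y : 0 <= x -> x <= y -> g x <= g y.
  move=> x0 xy; have y0 := le_trans x0 xy; rewrite /g.
  have h : C1 * x <= C1 * y by rewrite ler_wpM2l.
  have c0 : 0 <= C1 * x by rewrite mulr_ge0.
  have c0' : 0 <= C1 * y by rewrite mulr_ge0.
  apply: ler_pM => //; first by rewrite addr_ge0// mulr_ge0// grow_cst_ge0.
  rewrite lerD2l ler_wpM2l// /grow_cst; apply: lerD.
    by rewrite ler_wpM2l// ler_pM.
  by rewrite ler_wpM2l ?mulr_ge0// !ler_pM ?mulr_ge0.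
have it_ge0 n : 0 <= iter n g A by elim: n => //= n IH; exact: le_trans IH (g_ge _ IH).
pose N := Num.truncn (T / tau0).
have it_mono n : (n <= N)%N -> iter n g A <= iter N g A.
  move=> nN; rewrite -(subnK nN) iterD; elim: (N - n)%N => //= k IH.
  apply: le_trans IH (g_ge _ _); rewrite -iterD; exact: it_ge0.
have crude tau n : 0 < tau -> tau <= T -> nH (iter n (Psi sg tau) (U 0)) <= iter n g A.
  move=> t0 tT; elim: n => [//|n IH] /=.
  set v := iter n _ _ in IH *.
  apply: le_trans (g_mono _ _ (nH_ge0 v) IH).
  apply: le_trans (Psi_tame sg1 (ltW t0) tT (hC1 v)) _.
  rewrite /g ler_wpM2r ?nH_ge0// lerD2l ler_wpM2r// grow_cst_ge0// mulr_ge0 ?nH_ge0//.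
pose Y := A + C1 * iter N g A.
have Y0 : 0 <= Y by rewrite addr_ge0// mulr_ge0.
have TCX : 0 <= T * Cl * X by rewrite !mulr_ge0.
have Yt : 0 <= Y / tau0 ^+ 2 by rewrite divr_ge0 ?sqr_ge0.
exists (T * Cl * X + Y / tau0 ^+ 2 + 1) => [|tau n t0 nT].
  by rewrite ltr_wpDl// addr_ge0.
have t0' := ltW t0.
have [->|n0] := eqVneq n 0%N.
  by rewrite mul0r subrr n2_0 mulr_ge0 ?sqr_ge0// !addr_ge0.
have tT : tau <= T by apply: le_trans nT; rewrite ler_peMl// ler1n lt0n.
have [tt0|tt0] := leP tau tau0.
  have [h1 _] := small tau n t0 tt0 nT; apply: le_trans h1 _.
  apply: le_trans (_ : T * Cl * X * tau ^+ 2 <= _); last first.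
    by rewrite ler_wpM2r ?sqr_ge0// -addrA lerDl addr_ge0.
  have gX : (1 + tau * K) ^+ n <= X by exact: geometric_le.
  have -> : n%:R * (Cl * tau ^+ 3) * (1 + tau * K) ^+ n =
      (n%:R * tau) * (Cl * (1 + tau * K) ^+ n) * tau ^+ 2 by ring.
  have q0 : 0 <= (1 + tau * K) ^+ n by rewrite exprn_ge0// addr_ge0// mulr_ge0.
  rewrite ler_wpM2r ?sqr_ge0// -[T * Cl * X]mulrA.
  by apply: ler_pM; rewrite ?mulr_ge0// ler_wpM2l.
have nN : (n <= N)%N.
  rewrite /N truncn_ge_nat ?divr_ge0 ?(ltW tau00)// ler_pdivlMr//.
  by apply: le_trans nT; rewrite ler_wpM2l// ltW.
have nt0 : 0 <= n%:R * tau by rewrite mulr_ge0.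
have u2 : n2 (U (n%:R * tau)) <= A.
  by apply: le_trans (n2_le_n1 _) _; have [] := hA (n%:R * tau); rewrite ?nt0.
have v2 : n2 (iter n (Psi sg tau) (U 0)) <= C1 * iter N g A.
  apply: le_trans (n2_le_n1 _) _; apply: le_trans (hC1 _) _; rewrite ler_wpM2l//.
  exact: le_trans (crude tau n t0 tT) (it_mono n nN).
apply: le_trans (n2_sub u2 v2) _; rewrite -/Y.
apply: le_trans (_ : Y / tau0 ^+ 2 * tau ^+ 2 <= _); last first.
  by rewrite ler_wpM2r ?sqr_ge0// addrAC lerDr addr_ge0.
rewrite -mulrA ler_peMr// mulrC ler_pdivlMr ?exprn_gt0// mul1r.
by rewrite lerXn2r ?nnegrE// ltW.
Qed.

End Global.

(** * Functions on the torus and their Fourier series *)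

Section SchemeRepr.
Context {R : realType}.
Local Notation C := R[i].
Implicit Types (a b c w : spec R) (f g v : torus_fun R) (sg s t h tau : R).

Lemma repr_half_wave t f a : repr f a -> repr (half_wave t f) (flow t a).
Proof.
move=> fa; rewrite /half_wave /nabla_op.
rewrite (_ : (fun k => _) = fun k => cis (t * knorm k)); last first.
  by apply/funext => k; rewrite -mulrA -rmorphM cexp_iR.
by rewrite flow.unlock; apply: repr_multiplier fa => k; exact: flow_sym_le.
Qed.

Let symE tau (k : freq) : - (2 * 'i * tau%:C) * (knorm k)%:C = 'i * (-2 * knorm k * tau)%:C :> C.
Proof. by rewrite !rmorphM rmorphN rmorph_nat; ring. Qed.

Lemma repr_phi1 tau f a : repr f a -> repr (nabla_op phi1 (- (2 * 'i * tau%:C)) f) (fphi1 tau a).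
Proof.
move=> fa; rewrite /nabla_op.
rewrite (_ : (fun k => _) = fun k => phi1 ('i * (-2 * knorm k * tau)%:C)); last first.
  by apply/funext => k; rewrite symE.
by rewrite fphi1.unlock; apply: repr_multiplier fa => k; exact: cnorm_phi1.
Qed.

Lemma repr_phi2 tau f a : repr f a -> repr (nabla_op phi2 (- (2 * 'i * tau%:C)) f) (fphi2 tau a).
Proof.
move=> fa; rewrite /nabla_op.
rewrite (_ : (fun k => _) = fun k => phi2 ('i * (-2 * knorm k * tau)%:C)); last first.
  by apply/funext => k; rewrite symE.
by rewrite fphi2.unlock; apply: repr_multiplier fa => k; exact: cnorm_phi2.
Qed.

Lemma modulus_sqr (z : C) : modulus z ^+ 2 = z * conjc z.
Proof. by rewrite mul_conj /modulus rmorphXn. Qed.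

Lemma repr_cubic f a : repr f a -> repr (fun x => modulus (f x) ^+ 2 * f x) (cubic a).
Proof.
move=> fa; apply: repr_ext (reprM (reprM fa fa) (repr_conj fa)) => x.
by rewrite modulus_sqr /fconj; ring.
Qed.

Lemma repr_quintic f a : repr f a -> repr (fun x => modulus (f x) ^+ 4 * f x) (quintic a).
Proof.
move=> fa; have ca := repr_conj fa.
apply: repr_ext (reprM (reprM (reprM fa fa) fa) (reprM ca ca)) => x.
by rewrite (exprM _ 2 2) modulus_sqr /fconj; ring.
Qed.

Lemma repr_scheme_step sg tau v a : repr v a ->
  repr (scheme_step sg tau v) (Psi sg tau a).
Proof.
move=> va; have ca := repr_conj va.
have ec : spec_cst (sg%:C * 'i * tau%:C) = sig sg * spec_cst tau%:C :> spec R.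
  by rewrite rmorphM.
have r1 := repr_half_wave tau va.
have r2 := reprZ (sg%:C * 'i * tau%:C)
  (repr_half_wave tau (reprM (reprX 2 va) (repr_phi1 tau ca))).
have r3 := reprZ (sg%:C * 'i * tau%:C)
  (reprM (reprX 2 r1) (repr_phi2 tau (repr_half_wave tau ca))).
have r4 := reprZ (sg%:C * 'i * tau%:C)
  (repr_half_wave tau (reprM (reprX 2 va) (repr_phi2 tau ca))).
have r5 := reprZ (tau ^+ 2 / 2)%:C (repr_half_wave tau (repr_quintic va)).
have := reprB (reprD (reprB (reprB r1 r2) r3) r4) r5.
by rewrite ec !expr2.
Qed.

Lemma repr_scheme sg tau v a n : repr v a ->
  repr (scheme sg tau v n) (iter n (Psi sg tau) a).
Proof. by move=> va; elim: n => //= n IH; exact: repr_scheme_step. Qed.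

Lemma weight_powR (k : freq) : (1 + knorm k ^+ 2) `^ (3 / 2) = wH k ^+ 2 :> R.
Proof.
have x0 : 0 <= 1 + knorm k ^+ 2 :> R by rewrite addr_ge0 ?sqr_ge0.
rewrite sqr_wH /jb -(powR12_sqrt x0) -[RHS]powR_mulrn ?powR_ge0// -powRrM.
by congr (_ `^ _); field.
Qed.

Lemma Hs_norm_esum f a : (forall k : freq, fourier f k = a k) ->
  Hs_norm (3 / 2) f = ((\int[@freq_counting R]_k (habs a k ^+ 2)%:E) `^ 2^-1)%E.
Proof.
move=> fa; rewrite /Hs_norm sum_esum; last by move=> k; rewrite lee_fin sqr_ge0.
congr (_ `^ _)%E; apply: eq_esum => k _.
by rewrite weight_powR fa; congr (_%:E); rewrite /habs [RHS]exprMn.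
Qed.

Lemma repr_Hs_norm f a : repr f a -> Hs_norm (3 / 2) f = (nH a)%:E.
Proof.
move=> fa; rewrite (@Hs_norm_esum f a); last by move=> k; exact: repr_fourier.
have [h0 h1] := nHP a.
have fin : (\int[@freq_counting R]_k (habs a k ^+ 2)%:E)%E \is a fin_num.
  by rewrite ge0_fin_numE ?sum_sqr_ge0//; exact: le_lt_trans h1 (ltry _).
rewrite (_ : (\int[_]_k _)%E = (nH a ^+ 2)%:E).
  by rewrite poweR_EFin -powR_mulrn ?nH_ge0// -powRrM divff ?powRr1 ?nH_ge0 ?pnatr_eq0.
by rewrite /nH /nrm2 sqr_sqrtr ?fineK// fine_ge0// sum_sqr_ge0.
Qed.

(** The finiteness of [Hs_norm] says that the Fourier coefficients are in
    [spec]. *)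
Lemma in_Hs_repr f : in_Hs (3 / 2) f -> exists a, repr f a.
Proof.
move=> [f2 fH].
pose a0 : freq -> C := fourier f.
have hf : a0 \in @spec_pred R.
  apply/spec_predP/HfinP; rewrite ltey; apply/eqP => h.
  move: fH; rewrite /Hs_norm.
  have e : (\esum_(k in [set: int * int])
     ((1 + knorm k ^+ 2) `^ (3 / 2) * ComplexField.Normc.normc (fourier f k) ^+ 2)%R%:E = +oo)%E.
    rewrite -h sum_esum; last by move=> k; rewrite lee_fin sqr_ge0.
    apply: eq_esum => k _.
    by rewrite weight_powR; congr (_%:E); rewrite /habs [RHS]exprMn.
  by rewrite e /poweR invr_eq0 pnatr_eq0.
by exists (Spec hf); apply: in_L2_repr.
Qed.

Lemma repr_sum N (z : 'I_N -> C) (f : 'I_N -> torus_fun R) (a : 'I_N -> spec R) :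
  (forall i, repr (f i) (a i)) ->
  repr (fun x => \sum_(i < N) z i * f i x) (\sum_(i < N) spec_cst (z i) * a i).
Proof.
elim: N => [|N IH] in z f a * => h.
  rewrite big_ord0 -(rmorph0 (@spec_cst R)).
  by apply: repr_ext (repr_cst 0) => x; rewrite big_ord0.
rewrite big_ord_recl.
apply: repr_ext (reprD (reprZ (z ord0) (h ord0)) (IH _ _ _ (fun i => h (lift ord0 i)))) => x.
by rewrite big_ord_recl.
Qed.

End SchemeRepr.

(** * From mild solutions to paths of Fourier series *)

Section RiemannSums.
Context {R : realType}.
Local Notation C := R[i].
Implicit Types (a b c w : spec R) (sg s t h tau T : R).

Lemma n2_sum N (h L : R) (x : 'I_N -> spec R) : 0 <= h -> (forall i, n2 (x i) <= L) ->
  n2 (\sum_(i < N) spec_cst h%:C * x i) <= N%:R * (h * L).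
Proof.
move=> h0; elim: N x => [|N IH] x hx; first by rewrite big_ord0 n2_0 mul0r.
rewrite big_ord_recl -natr1 mulrDl mul1r addrC; apply: n2_add; first exact: IH.
by apply: n2_scal => //; rewrite cnormR ger0_norm.
Qed.

Lemma n1_sum N (h L : R) (x : 'I_N -> spec R) : 0 <= h -> (forall i, n1 (x i) <= L) ->
  n1 (\sum_(i < N) spec_cst h%:C * x i) <= N%:R * (h * L).
Proof.
move=> h0; elim: N x => [|N IH] x hx.
  rewrite big_ord0 mul0r -(mulr0 (spec_cst 0)); apply: le_trans (n1_cst _ _) _.
  by rewrite cnorm0 mul0r.
rewrite big_ord_recl -natr1 mulrDl mul1r addrC; apply: n1_add; first exact: IH.
by apply: n1_scal => //; rewrite cnormR ger0_norm.
Qed.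

Lemma nH_sum N (h L : R) (x : 'I_N -> spec R) : 0 <= h -> (forall i, nH (x i) <= L) ->
  nH (\sum_(i < N) spec_cst h%:C * x i) <= N%:R * (h * L).
Proof.
move=> h0; elim: N x => [|N IH] x hx.
  rewrite big_ord0 mul0r -(mulr0 (spec_cst 0)); apply: le_trans (nH_cst _ _) _.
  by rewrite cnorm0 mul0r.
rewrite big_ord_recl -natr1 mulrDl mul1r addrC; apply: nH_add; first exact: IH.
by apply: nH_scal => //; rewrite cnormR ger0_norm.
Qed.

(** Balls of the Wiener algebra are closed in [L^2], along approximations
    that stay bounded in [H^{3/2}]: by [n1_interp] these also converge in
    the Wiener norm. *)
Lemma n1_closed (a : spec R) (L B : R) :
  (forall e, 0 < e -> exists b, [/\ n2 (a - b) <= e, n1 b <= L & nH b <= B]) -> n1 a <= L.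
Proof.
move=> h; apply/ler_addgt0Pr => e e0.
have [b0 [_ _ hb0]] := h 1 ltr01.
have B0 : 0 <= B by exact: le_trans (nH_ge0 _) hb0.
have aB : 0 < nH a + B + 1 by rewrite ltr_wpDl// addr_ge0// nH_ge0.
have d0 : 0 < e / 2 / (nH a + B + 1) by rewrite !divr_gt0.
have [Ce Ce0 hint] := n1_interp d0.
have d1 : 0 < e / 2 / (Ce + 1) by rewrite !divr_gt0// ltr_wpDl.
have e2 : 0 <= e / 2 by rewrite divr_ge0// ltW.
have [b [b2 b1 bH]] := h _ d1.
have -> : a = b + (a - b) by rewrite addrC subrK.
apply: n1_add => //; apply: le_trans (hint _) _.
have h1 : Ce * n2 (a - b) <= e / 2.
  apply: le_trans (ler_wpM2l Ce0 b2) _; rewrite mulrCA ler_piMr//.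
  by rewrite ler_pdivrMr ?ltr_wpDl// mul1r lerDl.
have h2 : e / 2 / (nH a + B + 1) * nH (a - b) <= e / 2.
  rewrite -mulrA ler_piMr// mulrC ler_pdivrMr// mul1r.
  by apply: le_trans (nH_sub (lexx _) bH) _; rewrite lerDl.
by apply: le_trans (lerD h1 h2) _; lra.
Qed.

End RiemannSums.

Section Bridge.
Context {R : realType}.
Local Notation C := R[i].
Implicit Types (a b c w : spec R) (sg s t h tau T : R).

Lemma n2_eq0 a : n2 a <= 0 -> a = 0.
Proof.
move=> a0; have {a0} e : n2 a = 0 by apply/le_anti; rewrite a0 n2_ge0.
have [_ h] := n2P a; rewrite e expr0n /= in h.
apply: spec_ext => k; rewrite spec_0E; apply: cnorm_eq0; apply/eqP; rewrite -sqrf_eq0.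
apply/eqP/le_anti; rewrite sqr_ge0 andbT -lee_fin; apply: le_trans h.
by apply: (@le_term_sum R (fun k => (cnorm (a k) ^+ 2)%:E)) => j; rewrite lee_fin sqr_ge0.
Qed.

Lemma nH_dist a b : `|nH b - nH a| <= nH (a - b).
Proof.
have h1 := nHD b (a - b); have h2 := nHD a (b - a).
have e1 : b + (a - b) = a by rewrite addrC subrK.
have e2 : a + (b - a) = b by rewrite addrC subrK.
have e3 : nH (b - a) = nH (a - b) by rewrite -nHN opprB.
rewrite e1 in h1; rewrite e2 e3 in h2.
by rewrite ler_norml lerNl opprB !lerBlDl h1 h2.
Qed.

Lemma in_Icc (s T : R) : (s \in `[0, T]) = (0 <= s <= T).
Proof. by rewrite in_itv. Qed.

(** The [H^{3/2}] norm of a continuous path is a continuous function on a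
    compact interval. *)
Lemma continuous_bounded_path T (u : R -> torus_fun R) : 0 < T ->
  Hs_continuous_on (3 / 2) 0 T u ->
  exists (U : R -> spec R) (B : R), forall t, 0 <= t <= T -> repr (u t) (U t) /\ nH (U t) <= B.
Proof.
move=> T0 [uH uc].
have hU t : exists a : spec R, 0 <= t <= T -> repr (u t) a.
  have [tT|tT] := boolP (0 <= t <= T); last by exists 0.
  by have [|a ha] := @in_Hs_repr _ (u t); [apply: uH; rewrite in_itv|exists a].
have [U hUU] := choice hU.
suff [B hB] : exists B, forall t, 0 <= t <= T -> nH (U t) <= B.
  by exists U, B => t tT; split; [exact: hUU|exact: hB].
have cU : {within `[0, T], continuous (fun t => nH (U t))}.
  apply/subspace_continuousP => x xI; apply/cvgrPdist_le => e e0.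
  have xT : 0 <= x <= T by move: xI; rewrite /= in_itv.
  have xI' : x \in `[0, T] by rewrite in_itv.
  have /fine_cvgP[_ /cvgrPdist_le/(_ e e0) h] := uc x xI'.
  apply: filterS2 h (withinT _ _) => t /= ht tI.
  have tT : 0 <= t <= T by move: tI; rewrite in_itv.
  move: ht; rewrite (repr_Hs_norm (reprB (hUU t tT) (hUU x xT))) /= sub0r normrN.
  rewrite ger0_norm ?nH_ge0// => h; apply: le_trans h.
  exact: nH_dist.
have [c _ hc] := EVT_max (ltW T0) cU.
by exists (nH (U c)) => t tT; apply: hc; rewrite in_Icc.
Qed.

Section Mild.
Variables (sg T B : R) (u0 : torus_fun R) (u : R -> torus_fun R) (U : R -> spec R) (a0 : spec R).
Hypotheses (sg1 : sg * sg = 1) (T0 : 0 < T) (hmild : mild_solution sg u0 T u).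
Hypotheses (hU : forall t, 0 <= t <= T -> repr (u t) (U t) /\ nH (U t) <= B).
Hypothesis (ha0 : repr u0 a0).

Let duhamel t := sig sg * (U t - flow t a0).

(** The [L^2] integral in the definition of mild solutions, transported to
    Fourier series: its value is the function [duhamel], whatever
    representative the definition provides. *)
Lemma mild_riemann t e : 0 <= t <= T -> 0 < e -> exists2 d : R, 0 < d &
  forall (N : nat) (p c : nat -> R), p 0%N = 0 -> p N = t ->
    (forall i, (i < N)%N -> [/\ p i <= c i, c i <= p i.+1 & p i.+1 - p i < d]) ->
    (forall i, (i < N)%N -> 0 <= c i <= T) ->
    n2 (\sum_(i < N) spec_cst (p i.+1 - p i)%:C * flow (t - c i) (cubic (U (c i))) - duhamel t) < e.
Proof.
move=> tT e0; have [g [g2 gint] gae] := hmild (t := t) (etrans (in_Icc _ _) tT).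
have rg : repr g (duhamel t).
  have r1 := reprZ (sg%:C * 'i) (reprB (hU tT).1 (repr_half_wave t ha0)).
  apply: repr_ae r1; first by have [] := in_L2_cintegrable g2.
  apply: filterS gae => x ->.
  have e1 : sg%:C * 'i * (sg%:C * 'i) = -1 :> C by rewrite mulrACA mul_ii -rmorphM sg1 mul1r.
  transitivity (- (sg%:C * 'i * (sg%:C * 'i)) * g x); first by rewrite e1 opprK mul1r.
  by ring.
have [d d0 hd] := gint e e0; exists d => // N p c p0 pN hp hc.
have := hd N p c p0 pN hp.
have r (i : 'I_N) : repr (half_wave (t - c i) (fun x => modulus (u (c i) x) ^+ 2 * u (c i) x))
    (flow (t - c i) (cubic (U (c i)))).
  by apply: repr_half_wave; apply: repr_cubic; exact: (hU (hc i (ltn_ord i))).1.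
rewrite (repr_L2norm (reprB (repr_sum (fun i : 'I_N => (p i.+1 - p i)%:C) r) rg)).
by rewrite lte_fin.
Qed.

(** At time 0 the empty partition is allowed, so the integral vanishes. *)
Lemma mild_init : U 0 = a0.
Proof.
have h : n2 (duhamel 0) <= 0.
  apply/ler_addgt0Pr => e e0; rewrite add0r.
  have T00 : 0 <= (0 : R) <= T by rewrite lexx ltW.
  have [d _ hd] := mild_riemann T00 e0.
  have r := hd 0%N (fun=> 0) (fun=> 0) erefl erefl.
  have {}r := r (fun _ q => False_ind _ (notF q)) (fun _ q => False_ind _ (notF q)).
  by move: r; rewrite big_ord0 sub0r n2N => /ltW.
have hz : duhamel 0 = 0 by exact: n2_eq0.
have := congr1 (fun x => sig sg * x) hz.
rewrite /duhamel mulr0 mulrA sig_sqr// mulN1r flow0 => /eqP; rewrite oppr_eq0 subr_eq0 => /eqP.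
by [].
Qed.

(** Duhamel's formula between two times, with a Riemann sum for the
    integral. Both integrals, up to [t1] and up to [t2], are approximated
    along the same partition of [[0, t1]], so that after transport by the
    group the contributions of [[0, t1]] cancel. *)
Lemma mild_increment t1 t2 e : 0 <= t1 -> t1 <= t2 -> t2 <= T -> 0 < e ->
  exists (N : nat) (c : nat -> R), [/\ (0 < N)%N, forall i, (i < N)%N -> t1 <= c i <= t2 &
    n2 (U t2 - flow (t2 - t1) (U t1) - (- sig sg *
      \sum_(i < N) spec_cst ((t2 - t1) / N%:R)%:C * flow (t2 - c i) (cubic (U (c i))))) <= e].
Proof.
move=> t10 t12 t2T e0; have e20 : 0 < e / 2 by rewrite divr_gt0.
have t1T : 0 <= t1 <= T by rewrite t10 (le_trans t12).
have t2T' : 0 <= t2 <= T by rewrite (le_trans t10).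
have [d1 d10 h1] := mild_riemann t1T e20.
have [d2 d20 h2] := mild_riemann t2T' e20.
pose d := Num.min d1 d2; have d0 : 0 < d by rewrite lt_min d10.
pose N := (Num.truncn (T / d)).+1.
have N0 : 0 < N%:R :> R by rewrite ltr0n.
have TN : T / N%:R < d.
  by rewrite ltr_pdivrMr// mulrC -ltr_pdivrMr//; exact: truncnS_gt.
have [dd1 dd2] : d <= d1 /\ d <= d2 by rewrite /d !ge_min !lexx orbT.
pose h := t2 - t1; have h0 : 0 <= h by rewrite subr_ge0.
(* [N] equal pieces on [[0, t1]], followed by [N] equal pieces on [[t1, t2]]. *)
pose p (i : nat) : R := if (i <= N)%N then i%:R * (t1 / N%:R) else t1 + (i%:R - N%:R) * (h / N%:R).
have pS i : (i < N)%N -> p i.+1 - p i = t1 / N%:R.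
  by move=> iN; rewrite /p iN ltnW// -natr1 mulrDl mul1r addrAC subrr add0r.
have pN : p N = t1 by rewrite /p leqnn mulrC divfK// gt_eqF.
have pge i : (N <= i)%N -> p i = t1 + (i%:R - N%:R) * (h / N%:R).
  rewrite leq_eqVlt => /orP[/eqP <-|Ni]; first by rewrite pN subrr mul0r addr0.
  by rewrite /p leqNgt Ni.
have pS' i : (N <= i)%N -> p i.+1 - p i = h / N%:R.
  by move=> iN; rewrite !pge ?leqW// -natr1; ring.
have p0 : p 0%N = 0 by rewrite /p /= mul0r.
have pNN : p (N + N)%N = t2.
  by rewrite pge ?leq_addr// natrD addrK mulrC divfK ?gt_eqF// /h addrC subrK.
have t1N : t1 / N%:R < d by apply: le_lt_trans TN; rewrite ler_pM2r ?invr_gt0//; case/andP: t1T.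
have hN : h / N%:R < d.
  by apply: le_lt_trans TN; rewrite ler_pM2r ?invr_gt0// lerBlDr ler_wpDr.
have t1N0 : 0 <= t1 / N%:R by rewrite divr_ge0// ltW.
have hN0 : 0 <= h / N%:R by rewrite divr_ge0// ltW.
have pin1 i : (i < N)%N -> 0 <= p i <= t1.
  move=> iN; rewrite /p ltnW// mulr_ge0//= mulrCA ler_piMr// ler_pdivrMr// mul1r ler_nat ltnW//.
have pin2 i : (i < N)%N -> t1 <= p (N + i)%N <= t2.
  move=> iN; rewrite pge ?leq_addr// natrD [N%:R + _]addrC addrK lerDl mulr_ge0//=.
  rewrite -lerBrDl -/h mulrCA ler_piMr// ler_pdivrMr// mul1r ler_nat ltnW//.
exists N, (fun i => p (N + i)%N); split => //.
have s1 : n2 (\sum_(i < N) spec_cst (t1 / N%:R)%:C * flow (t1 - p i) (cubic (U (p i)))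
    - duhamel t1) < e / 2.
  rewrite (_ : \sum_(i < N) _ =
      \sum_(i < N) spec_cst (p i.+1 - p i)%:C * flow (t1 - p i) (cubic (U (p i)))); last first.
    by apply: eq_bigr => i _; rewrite pS.
  apply: h1 => // i iN; last first.
    by have /andP[q0 q1] := pin1 i iN; rewrite q0 (le_trans q1)//; case/andP: t1T.
  rewrite lexx pS//; split => //; last exact: lt_le_trans t1N dd1.
  by rewrite -subr_ge0 pS.
have s2 : n2 (\sum_(i < N) spec_cst (t1 / N%:R)%:C * flow (t2 - p i) (cubic (U (p i)))
    + \sum_(i < N) spec_cst (h / N%:R)%:C * flow (t2 - p (N + i)%N) (cubic (U (p (N + i)%N)))
    - duhamel t2) < e / 2.
  rewrite (_ : \sum_(i < N) _ + \sum_(i < N) _ =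
      \sum_(i < N + N) spec_cst (p i.+1 - p i)%:C * flow (t2 - p i) (cubic (U (p i)))); last first.
    rewrite big_split_ord; congr (_ + _); apply: eq_bigr => i _ /=; first by rewrite pS.
    by rewrite pS' ?leq_addr.
  have split i : (i < N + N)%N -> (i < N)%N \/ exists2 j, (j < N)%N & i = (N + j)%N.
    move=> iN; have [iN'|iN'] := ltnP i N; [by left|right].
    by exists (i - N)%N; rewrite ?ltn_subLR// subnKC.
  apply: h2 => // i /split[iN|[j jN ->]].
  - rewrite lexx pS//; split => //; last exact: lt_le_trans t1N dd2.
    by rewrite -subr_ge0 pS.
  - rewrite lexx pS' ?leq_addr//; split => //; last exact: lt_le_trans hN dd2.
    by rewrite -subr_ge0 pS' ?leq_addr.
  - by have /andP[q0 q1] := pin1 i iN; rewrite q0 (le_trans q1)//; case/andP: t1T.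
  - by have /andP[q0 q1] := pin2 j jN; rewrite (le_trans t10 q0) (le_trans q1).
set S2 := \sum_(i < N) _ in s2; set S3 := \sum_(i < N) _ in s2.
set S1 := \sum_(i < N) _ in s1.
have S12 : flow h S1 = S2.
  rewrite /S1 /S2; elim/big_ind2: _ => [|x1 x2 y1 y2 <- <-|i _].
  - by have := flowB h 0 0; rewrite !subrr.
  - by rewrite flowD.
  - by rewrite flowZ flow_flow /h addrA subrK.
rewrite -/h -/S3.
have -> : U t2 - flow h (U t1) - (- sig sg * S3) =
    sig sg * ((S2 + S3 - duhamel t2) - flow h (S1 - duhamel t1)).
  rewrite flowB S12 /duhamel.
  have -> : flow h (sig sg * (U t1 - flow t1 a0)) = sig sg * (flow h (U t1) - flow t2 a0).
    by rewrite /sig flowZ flowB flow_flow /h subrK.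
  have -> : sig sg * (S2 + S3 - sig sg * (U t2 - flow t2 a0) -
      (S2 - sig sg * (flow h (U t1) - flow t2 a0))) =
    sig sg * S3 - (sig sg * sig sg) * (U t2 - flow h (U t1)) by ring.
  by rewrite sig_sqr//; ring.
have -> : e = 1 * (e / 2 + e / 2) by field.
apply: n2_scal; first by rewrite cnorm_sig.
by apply: n2_sub; [exact: ltW|rewrite n2_flow; exact: ltW].
Qed.

(** Each term of the Riemann sum obeys the assumed bound, hence so does
    their mean, and [n1_closed] passes to the limit in the Wiener norm. *)
Lemma mild_is_path : exists A, mild_path sg T A U.
Proof.
have [C1 C11 hC1] := @n1_emb R.
have B0 : 0 <= B.
  have [_ q] : repr (u 0) (U 0) /\ nH (U 0) <= B by apply: hU; rewrite lexx ltW.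
  exact: le_trans (nH_ge0 _) q.
have C10 : 0 <= C1 by exact: le_trans C11.
exists (C1 * B); set A := C1 * B.
have A0 : 0 <= A by rewrite mulr_ge0.
have hA t : 0 <= t <= T -> n1 (U t) <= A /\ nH (U t) <= A.
  move=> /hU[_ tB]; split; last by apply: le_trans tB _; rewrite ler_peMl.
  by apply: le_trans (hC1 _) _; rewrite ler_wpM2l.
have inT t1 t2 x : 0 <= t1 -> t2 <= T -> t1 <= x <= t2 -> 0 <= x <= T.
  by move=> q1 q2 /andP[q3 q4]; rewrite (le_trans q1 q3) (le_trans q4 q2).
have cs : cnorm (- (sg%:C * 'i) : C) <= 1 by rewrite cnormN cnorm_sig.
split=> // t1 t2.
- move=> w L t10 t12 t2T hw; set h := t2 - t1.
  have h0 : 0 <= h by rewrite subr_ge0.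
  apply/ler_addgt0Pr => e e0.
  have [N [c [N0 hc hX]]] := mild_increment t10 t12 t2T e0.
  move: hX; rewrite -/h; set X := U t2 - _; set S := \sum_(i < N) _ => hX.
  have NR : (N%:R : R) != 0 by rewrite pnatr_eq0 -lt0n.
  have hN : 0 <= h / N%:R by rewrite divr_ge0.
  have hS : S - spec_cst h%:C * w =
      \sum_(i < N) spec_cst (h / N%:R)%:C * (flow (t2 - c i) (cubic (U (c i))) - w).
    under [RHS]eq_bigr do rewrite mulrBr.
    rewrite sumrB; congr (_ - _).
    rewrite sumr_const card_ord -mulrnAl -rmorphMn -rmorphMn /=.
    by rewrite -[h / _ *+ N]mulr_natr divfK.
  have -> : X + sig sg * spec_cst h%:C * w =
      (X - - sig sg * S) + (- sig sg) * (S - spec_cst h%:C * w) by ring.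
  rewrite [leRHS]addrC; apply: n2_add; last first.
    rewrite hS /sig -rmorphN.
    have -> : h * L = 1 * (N%:R * (h / N%:R * L)) by field.
    apply: n2_scal => //; apply: n2_sum => // i.
    by apply: hw; exact: hc.
  exact: hX.
- move=> L t10 t12 t2T hL; set h := t2 - t1.
  have h0 : 0 <= h by rewrite subr_ge0.
  apply: (@n1_closed _ _ _ (h * (21 * (A * A * A)))) => e e0.
  have [N [c [N0 hc hX]]] := mild_increment t10 t12 t2T e0.
  have NR : (N%:R : R) != 0 by rewrite pnatr_eq0 -lt0n.
  have hN : 0 <= h / N%:R by rewrite divr_ge0.
  have eL z : h * z = 1 * (N%:R * (h / N%:R * z)) by field.
  exists (- sig sg * \sum_(i < N) spec_cst (h / N%:R)%:C * flow (t2 - c i) (cubic (U (c i)))).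
  split; first exact: hX.
  - rewrite [leRHS]eL /sig -rmorphN; apply: n1_scal => //; apply: n1_sum => // i.
    by rewrite n1_flow; apply: hL; exact: hc.
  - rewrite [leRHS]eL /sig -rmorphN; apply: nH_scal => //; apply: nH_sum => // i.
    have [q1 q2] := hA _ (inT _ _ _ t10 t2T (hc i (ltn_ord i))).
    by rewrite nH_flow; exact: nH_cubic.
Qed.

End Mild.
End Bridge.

Theorem corollary24 (R : realType) (sgn : R) (hsgn : sgn = 1 \/ sgn = -1)
    (u0 : torus_fun R) (hu0 : in_Hs (3 / 2) u0)
    (T : R) (hT : 0 < T)
    (u : R -> torus_fun R)
    (hcont : Hs_continuous_on (3 / 2) 0 T u)
    (hmild : mild_solution sgn u0 T u) :
  exists2 CT : R, 0 < CT &
    forall (tau : R) (n : nat), 0 < tau -> n%:R * tau <= T ->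
      (L2norm (fun x => (u (n%:R * tau) x - scheme sgn tau u0 n x)%R)
         <= (CT * tau ^+ 2)%:E)%E.
Proof.
have sg1 : sgn * sgn = 1 by case: hsgn => ->; rewrite ?mulrNN mulr1.
have [a0 ha0] := in_Hs_repr hu0.
have [U [B hU]] := continuous_bounded_path hT hcont.
have [A hA] := mild_is_path sg1 hT hmild hU ha0.
have [CT CT0 hCT] := spectral_convergence sg1 hT hA.
exists CT => // tau n tau0 nT.
have nT0 : 0 <= n%:R * tau <= T by rewrite nT mulr_ge0// ltW.
have r := reprB (hU _ nT0).1 (repr_scheme sgn tau n ha0).
rewrite (repr_L2norm r) lee_fin -(mild_init sg1 hT hmild hU ha0).
exact: hCT.
Qed.
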